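(* Let $d\ge 3$ and let $a:\mathbb{R}^d\to\mathbb{R}$ be a bounded continuous function with $a\ge 0$, $a(-x)=a(x)$ for all $x$, $\int_{\mathbb{R}^d}a(y)\,\mathrm{d}y=1$, $\int_{\mathbb{R}^d}|x|^2a(x)\,\mathrm{d}x<\infty$, and $\hat a\in L^1(\mathbb{R}^d)$, where $\hat a(k)=\int_{\mathbb{R}^d}e^{-i(k,y)}a(y)\,\mathrm{d}y$. For $x\in\mathbb{R}^d$ let $X=\{X(t),t\ge 0\}$ be the compound Poisson process (continuous time random walk) on a probability space $(\Omega,P)$, starting from $x$, with generator $$Lf(u)=\int_{\mathbb{R}^d}a(u-y)\,[f(y)-f(u)]\,\mathrm{d}y .$$ Let $CL(\mathbb{R}^d)=C_b(\mathbb{R}^d)\cap L^1(\mathbb{R}^d)$ with norm $\|f\|_{CL}=\sup|f|+\|f\|_{L^1(\mathbb{R}^d)}$, and for $f\in CL(\mathbb{R}^d)$ let $Y(f)=\int_0^\infty f(X(t))\,\mathrm{d}t$. Then for each $x\in\mathbb{R}^d$ the operator $$Y: CL(\mathbb{R}^d)\to L^1(\Omega,P)$$ has a unique representation given, for all $f\in CL(\mathbb{R}^d)$ and every $\omega\in\Omega$, by $$Y(f)(\omega)=\int_{\mathbb{R}^d}f(y)\,\mu^x(\mathrm{d}y,\omega)$$ with a vector valued Radon measure $\mu^x(\mathrm{d}y,\omega)$ on $\mathcal{B}_b(\mathbb{R}^d)$ which is $\sigma$-additive in the strong topology of $L^1(\Omega,P)$.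
   Context: $C_b(\mathbb{R}^d)$ is the space of bounded continuous real functions on $\mathbb{R}^d$; $\mathcal{B}_b(\mathbb{R}^d)$ is the family of bounded Borel subsets of $\mathbb{R}^d$. The random variable $Y(f)=\int_0^\infty f(X(t))\,\mathrm{d}t$ is the limit in $L^1(\Omega,P)$, as $T\to\infty$, of $Y(f,T)=\int_0^T f(X(t))\,\mathrm{d}t$; it depends on the fixed starting point $x$. A vector valued Radon measure is here an $L^1(\Omega,P)$-valued measure which is finite on all bounded Borel sets $A\in\mathcal{B}_b(\mathbb{R}^d)$; its value on $A$ is written $\mu^x(A,\omega)$. $\sigma$-additivity in the strong topology means countable additivity with convergence in the norm of $L^1(\Omega,P)$. The integral $\int_{\mathbb{R}^d}f(y)\,\mu^x(\mathrm{d}y,\omega)$ is the integral of $f$ with respect to this vector valued measure. *)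

(* Defs.v *)
From HB Require Import structures.
From mathcomp Require Import all_boot all_order all_algebra.
From mathcomp Require Import all_classical all_reals all_analysis.
From mathcomp Require Import complex.
From mathcomp Require Import measurable_realfun lra.

Set Implicit Arguments.
Unset Strict Implicit.
Unset Printing Implicit Defensive.

Import Order.TTheory GRing.Theory Num.Theory.
Import numFieldNormedType.Exports HBSimple.

Local Open Scope classical_set_scope.
Local Open Scope ring_scope.

(* Borel sigma-algebra.  The library norm on matrices is the sup norm; it has
   the same open sets and the same bounded sets as the Euclidean norm. *)
HB.instance Definition _ (R : realType) (m n : nat) :=
  Measurable.copy 'M[R]_(m, n) (g_sigma_algebraType (@open 'M[R]_(m, n))).

Section borel_rV.
Context (R : realType).

Lemma continuous_measurable_rV n (f : 'rV[R]_n -> R) :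
  continuous f -> measurable_fun setT f.
Proof.
move=> cf; apply: (measurability _ (RGenOpens.measurableE R)).
move=> _ [_ [a [b ->] <-]]; rewrite setTI.
apply: sub_sigma_algebra.
by move/continuousP: cf; apply; exact: interval_open.
Qed.

Lemma measurable_coord n (i : 'I_n) :
  measurable_fun setT (fun v : 'rV[R]_n => v ord0 i).
Proof. by apply: continuous_measurable_rV => v; exact: coord_continuous. Qed.

Lemma measurable_fun_rV d (T : measurableType d) n (f : T -> 'rV[R]_n) :
  (forall i, measurable_fun setT (fun t => f t ord0 i)) ->
  measurable_fun setT f.
Proof.
move=> mf; apply: (@measurability _ _ _ _ _ _ (@open 'rV[R]_n)) => //.
move=> _ [U oU <-]; rewrite setTI.
pose c (q : 'rV[rat]_n) : 'rV[R]_n := map_mx ratr q.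
pose e (k : nat) : R := k.+1%:R^-1.
pose B (p : 'rV[rat]_n * nat) := ball (c p.1) (e p.2).
have e0 k : 0 < e k by rewrite invr_gt0.
have mB p : measurable (f @^-1` B p).
  have -> : f @^-1` B p = \bigcap_(i in [set: 'I_n])
      (fun t => f t ord0 i) @^-1` (ball (c p.1 ord0 i) (e p.2)).
    apply/seteqP; split=> [t [_ h] i _|t h]; first exact: h.
    by split=> // i j; rewrite ord1; exact: h.
  apply: fin_bigcap_measurable => // i _.
  rewrite -[X in measurable X]setTI; apply: mf => //.
  by apply: open_measurable; exact: ball_open.
have -> : f @^-1` U = \bigcup_(p in [set p | B p `<=` U]) (f @^-1` B p).
  apply/seteqP; split=> [t Uft|t [p /= BU Bt]]; last exact: BU.
  have [r r0 rU] : exists2 r : R, 0 < r & ball (f t) r `<=` U.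
    have : nbhs (f t) U by apply: open_nbhs_nbhs.
    by rewrite -nbhs_ballE => -[r /= r0 rU]; exists r.
  have [k kr] : exists k, e k + e k < r.
    have [N _ hN] := near_infty_natSinv_lt (PosNum (divr_gt0 r0 (ltr0n R 2))).
    exists N; rewrite (splitr r) ltrD//; exact: (hN N (leqnn N)).
  have qP i : exists q : rat, `|f t ord0 i - ratr q| < e k.
    have /rat_in_itvoo[q] : f t ord0 i - e k < f t ord0 i + e k.
      by rewrite ltrBlDr -addrA ltrDl addr_gt0.
    rewrite in_itv/= => /andP[h1 h2]; exists q.
    by rewrite ltr_norml ltrBrDr addrC -ltrBrDr opprK addrC ltrBlDr; lra.
  pose q : 'rV[rat]_n := \row_i projT1 (cid (qP i)).
  have qE i : `|f t ord0 i - c q ord0 i| < e k.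
    by rewrite !mxE; case: cid.
  exists (q, k) => /=.
    move=> v [_ hv]; apply: rU; split=> // i j.
    have := hv i j; rewrite (ord1 i) /ball/= => h.
    have -> : f t ord0 j - v ord0 j =
      (f t ord0 j - c q ord0 j) + (c q ord0 j - v ord0 j).
      by rewrite addrA subrK.
    by rewrite (le_lt_trans (ler_normD _ _))// (lt_trans _ kr)// ltrD.
  by split=> // i j; rewrite (ord1 i) /ball/= distrC.
rewrite bigcup_mkcond; apply: countable_bigcupT_measurable => [|p].
  exact: countableP.
by case: ifP => _; [exact: mB|exact: measurable0].
Qed.
End borel_rV.

Section lebesgue_rV.
Context (R : realType).

Definition cons_rV n (p : R * 'rV[R]_n) : 'rV[R]_n.+1 :=
  \row_i (if unlift ord0 i is Some j then p.2 ord0 j else p.1).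

Definition uncons_rV n (v : 'rV[R]_n.+1) : R * 'rV[R]_n :=
  (v ord0 ord0, \row_j v ord0 (lift ord0 j)).

Lemma uncons_rVK n : cancel (@uncons_rV n) (@cons_rV n).
Proof.
move=> v; apply/rowP => i; rewrite mxE.
by case: unliftP => [j ->|->]//=; rewrite mxE.
Qed.

Lemma cons_rVK n : cancel (@cons_rV n) (@uncons_rV n).
Proof.
move=> [t v]; congr pair; first by rewrite mxE unlift_none.
by apply/rowP => j; rewrite !mxE liftK.
Qed.

Lemma measurable_cons_rV n : measurable_fun setT (@cons_rV n).
Proof.
apply: measurable_fun_rV => i; case: (unliftP ord0 i) => [j|] ->.
  rewrite (_ : (fun _ => _) = (fun v : 'rV[R]_n => v ord0 j) \o snd).
    by apply: measurableT_comp => //; exact: measurable_coord.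
  by apply/funext => p; rewrite /= mxE liftK.
rewrite (_ : (fun _ => _) = fst)//.
by apply/funext => p; rewrite /= mxE unlift_none.
Qed.

Lemma measurable_uncons_rV n : measurable_fun setT (@uncons_rV n).
Proof.
apply/measurable_fun_pairP; split; first exact: measurable_coord.
apply: measurable_fun_rV => i.
rewrite (_ : (fun _ => _) = (fun v : 'rV[R]_n.+1 => v ord0 (lift ord0 i))).
  exact: measurable_coord.
by apply/funext => v; rewrite /= mxE.
Qed.

Section step.
Context n (m : {sigma_finite_measure set 'rV[R]_n -> \bar R}).

Definition lebesgue_rV_step : set 'rV[R]_n.+1 -> \bar R :=
  pushforward (@lebesgue_measure R \x m)%E (@cons_rV n).

HB.instance Definition _ := Measure.copy lebesgue_rV_step
  (measure_function_pushforward__canonical__measure_function_Measure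
     (@lebesgue_measure R \x m)%E (measurable_cons_rV (n := n))).

Let sigma_finite_step : sigma_finite setT lebesgue_rV_step.
Proof.
have /sigma_finiteP[F [TF ndF Foo]] := sigma_finiteT (@lebesgue_measure R).
have /sigma_finiteP[G [TG ndG Goo]] := sigma_finiteT m.
exists (fun k => @uncons_rV n @^-1` (F k `*` G k)).
  apply/seteqP; split=> // v _.
  have [i _ Fi] : (\bigcup_i F i) (uncons_rV v).1 by rewrite -TF.
  have [j _ Gj] : (\bigcup_i G i) (uncons_rV v).2 by rewrite -TG.
  exists (maxn i j) => //; split.
    by move: Fi; exact/subsetPset/ndF/leq_maxl.
  by move: Gj; exact/subsetPset/ndG/leq_maxr.
move=> k; have [mF Fk] := Foo k; have [mG Gk] := Goo k; split.
  rewrite -[X in measurable X]setTI; apply: measurable_uncons_rV => //.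
  exact: measurableX.
rewrite /lebesgue_rV_step /pushforward -comp_preimage.
rewrite (_ : _ @^-1` _ = F k `*` G k); last first.
  by rewrite (_ : _ \o _ = id)//; apply/funext => p; exact: cons_rVK.
by rewrite product_measure1E// lte_mul_pinfty// ge0_fin_numE.
Qed.

HB.instance Definition _ := Measure_isSigmaFinite.Build _ _ _
  lebesgue_rV_step sigma_finite_step.
End step.

(* Iterated product of the one-dimensional Lebesgue measure, transported along
   R * R^k ~ R^(k.+1); see lebesgue_rV_box. *)
Fixpoint lebesgue_rV n : {sigma_finite_measure set 'rV[R]_n -> \bar R} :=
  match n with
  | 0 => \d_(0 : 'rV[R]_0)
  | k.+1 => lebesgue_rV_step (lebesgue_rV k)
  end.

End lebesgue_rV.

Lemma lebesgue_rV_box (R : realType) n (A : 'I_n -> set R) :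
  (forall i, measurable (A i)) ->
  lebesgue_rV R n [set v | forall i, A i (v ord0 i)] =
  (\prod_(i < n) lebesgue_measure (A i))%E.
Proof.
elim: n A => [|n IH] A mA /=.
  by rewrite big_ord0 diracE mem_set//= => -[].
rewrite big_ord_recl /= /lebesgue_rV_step /pushforward.
pose B := [set v : 'rV[R]_n | forall i, A (lift ord0 i) (v ord0 i)].
have mB : measurable B.
  have -> : B = \bigcap_(i in [set: 'I_n])
      (fun v : 'rV[R]_n => v ord0 i) @^-1` A (lift ord0 i).
    by apply/seteqP; split=> [v h i _|v h i]; exact: h.
  apply: fin_bigcap_measurable => // i _.
  by rewrite -[X in measurable X]setTI; exact: measurable_coord.
rewrite (_ : _ @^-1` _ = A ord0 `*` B).
  apply: (eq_trans (@product_measure1E _ _ _ _ _ (@lebesgue_measure R)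
    (lebesgue_rV R n) _ _ (mA ord0) mB)).
  by apply: (congr1 (mule _)); exact: (IH (fun i => A (lift ord0 i))).
apply/seteqP; split=> [[t v] /= h|[t v] /= [h0 hB] i].
  split; first by have := h ord0; rewrite mxE unlift_none.
  by move=> i; have := h (lift ord0 i); rewrite mxE liftK.
by rewrite mxE; case: unliftP => [j ->|->].
Qed.

Section euclidean_space.
Context (R : realType) (d : nat).
Implicit Types (a f : 'rV[R]_d -> R) (k y u : 'rV[R]_d).

(* The Euclidean |x|^2 is dotv x x; `|x| is the sup norm. *)
Definition dotv k y : R := \sum_(i < d) k ord0 i * y ord0 i.

(* exp(it) *)
Definition expi (t : R) : R[i] := (cos t +i* sin t)%C.

Definition fourier a k : R[i] :=
  let F y := expi (- dotv k y) * (a y)%:C%C in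
  ((\int[lebesgue_rV R d]_y complex.Re (F y)) +i*
   (\int[lebesgue_rV R d]_y complex.Im (F y)))%C.

Definition fourier_L1 a : Prop :=
  (lebesgue_rV R d).-integrable setT
    (fun k => (ComplexField.Normc.normc (fourier a k))%:E).

Definition Cb f : Prop := continuous f /\ bounded_fun f.

Definition CL f : Prop :=
  Cb f /\ (lebesgue_rV R d).-integrable setT (fun y => (f y)%:E).

Definition Bb (A : set 'rV[R]_d) : Prop := measurable A /\ bounded_set A.

(* Lf(u) = \int a(u - y) [f(y) - f(u)] dy *)
Definition jump_operator a f u : R :=
  \int[lebesgue_rV R d]_y (a (u - y) * (f y - f u)).

End euclidean_space.

Section compound_poisson.
Context (R : realType) (dO : measure_display) (Omega : measurableType dO).
Context (P : probability Omega R).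

Definition independent_family (I : eqType) (dT : measure_display)
    (T : measurableType dT) (Z : I -> Omega -> T) : Prop :=
  forall (s : seq I) (A : I -> set T), uniq s ->
    (forall i, measurable (A i)) ->
    P (\bigcap_(i in [set` s]) Z i @^-1` A i) =
    (\prod_(i <- s) P (Z i @^-1` A i))%E.

Record poisson_process (lambda : R) (N : R -> Omega -> nat) : Prop := {
  poisson_start : forall w, N 0 w = 0%N;
  poisson_measurable : forall t, 0 <= t -> measurable_fun setT (N t);
  poisson_nondecreasing : forall w s t, 0 <= s -> s <= t -> (N s w <= N t w)%N;
  poisson_right_continuous :
    forall w t, 0 <= t -> \forall s \near t^'+, N s w = N t w;
  poisson_increment_law : forall s t k, 0 <= s -> s < t ->
    P [set w | (N t w - N s w)%N = k] =
    (poisson_pmf (lambda * (t - s)) k)%:E;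
  poisson_independent_increments : forall t : nat -> R,
    0 <= t 0%N -> {homo t : m n / (m <= n)%N >-> m <= n} ->
    independent_family (fun i w => (N (t i.+1) w - N (t i) w)%N) }.

Context (d : nat).

(* X(t) = x + xi_0 + ... + xi_(N(t) - 1), where N is a Poisson process of rate
   lambda independent of the i.i.d. jumps xi_i of law nu.  The condition
   nu {0} = 0 is the usual normalization that makes the pair (lambda, nu) unique
   for a given generator.  Only times t >= 0 matter. *)
Record compound_poisson_sum (x : 'rV[R]_d) (lambda : R)
    (nu : probability 'rV[R]_d R) (N : R -> Omega -> nat)
    (xi : nat -> Omega -> 'rV[R]_d) (X : R -> Omega -> 'rV[R]_d) : Prop := {
  cps_rate : 0 < lambda;
  cps_jump_neq0 : nu [set 0] = 0%E;
  cps_poisson : poisson_process lambda N;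
  cps_measurable : forall i, measurable_fun setT (xi i);
  cps_law : forall i A, measurable A -> P (xi i @^-1` A) = nu A;
  cps_independent : independent_family xi;
  cps_independent_poisson : forall (s : seq R) (A : R -> set nat)
      (r : seq nat) (B : nat -> set 'rV[R]_d),
    (forall t, t \in s -> 0 <= t) -> (forall i, measurable (B i)) ->
    P (\bigcap_(t in [set` s]) N t @^-1` A t `&`
       \bigcap_(i in [set` r]) xi i @^-1` B i) =
    (P (\bigcap_(t in [set` s]) N t @^-1` A t) *
     P (\bigcap_(i in [set` r]) xi i @^-1` B i))%E;
  cps_sum : forall t w, 0 <= t -> X t w = x + \sum_(i < N t w) xi i w }.

Definition compound_poisson_process (x : 'rV[R]_d)
    (X : R -> Omega -> 'rV[R]_d) : Prop :=
  exists lambda nu N xi, compound_poisson_sum x lambda nu N xi X.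

(* The increments of a compound Poisson process are stationary and independent,
   so its transition semigroup is P_t f(u) = E f(u + X(t) - X(0)). *)
Definition transition (x : 'rV[R]_d) (X : R -> Omega -> 'rV[R]_d)
    (t : R) (f : 'rV[R]_d -> R) (u : 'rV[R]_d) : R :=
  \int[P]_w f (u + (X t w - x)).

(* (P_t f - f)/t converges to L f in sup norm as t decreases to 0, for all f in
   C_b(R^d) *)
Definition has_generator (x : 'rV[R]_d) (X : R -> Omega -> 'rV[R]_d)
    (L : ('rV[R]_d -> R) -> 'rV[R]_d -> R) : Prop :=
  forall f, Cb f -> forall e, 0 < e -> \forall t \near 0^'+, forall u,
    `| t^-1 * (transition x X t f u - f u) - L f u | <= e.

End compound_poisson.

Section vector_measure.
Context (R : realType) (dO : measure_display) (Omega : measurableType dO).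
Context (P : probability Omega R) (d : nat).
Implicit Types (f : 'rV[R]_d -> R) (X : R -> Omega -> 'rV[R]_d).
Implicit Types (mu nu : set 'rV[R]_d -> Omega -> R) (y z : Omega -> R).

(* Elements of L^1(Omega, P) are given by representatives y with y \in Lfun P 1;
   equality in L^1(Omega, P) is equality %[ae P]. *)
Definition L1dist y z : \bar R :=
  'N[P]_1[EFin \o (y \- z)%R]%E.

Definition occupation X f (T : R) : Omega -> R :=
  fun w => \int[lebesgue_measure]_(t in `[0, T]) f (X t w).

(* y represents Y(f), the limit in L^1(Omega, P) of Y(f, T) as T tends to
   infinity *)
Definition is_Y X f y : Prop :=
  [/\ y \in Lfun P 1,
      forall T, 0 <= T -> occupation X f T \in Lfun P 1 &
      L1dist (occupation X f T) y @[T --> +oo] --> 0%E].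

(* Only the values of mu on bounded Borel sets matter.  Countable additivity
   contains mu set0 = 0 and finite additivity. *)
Record vector_radon_measure mu : Prop := {
  vrm_L1 : forall A, Bb A -> mu A \in Lfun P 1;
  vrm_sigma_additive : forall F : nat -> set 'rV[R]_d,
    (forall i, Bb (F i)) -> trivIset setT F -> Bb (\bigcup_i F i) ->
    L1dist (fun w => \sum_(i < n) mu (F i) w) (mu (\bigcup_i F i))
      @[n --> \oo] --> 0%E }.

(* \int_A s d(mu).  When s vanishes outside a bounded set, the term c = 0 is the
   only one that evaluates mu on a possibly unbounded set, and it is 0. *)
Definition vintegral_sfun mu (s : {sfun 'rV[R]_d >-> R}) (A : set 'rV[R]_d)
  : Omega -> R :=
  fun w => \sum_(c \in range s) c * mu (A `&` s @^-1` [set c]) w.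

(* y represents the integral of f with respect to mu, in the sense of Dunford and
   Schwartz (Linear Operators I, IV.10.7), for simple functions over the
   delta-ring of bounded Borel sets: there are such functions s_n -> f pointwise
   for which \int_A s_n d(mu) converges in L^1(Omega, P) for every Borel set A,
   and y is the limit for A = R^d. *)
Definition is_vintegral mu f y : Prop :=
  exists s : nat -> {sfun 'rV[R]_d >-> R},
    [/\ forall n, bounded_set (s n @^-1` [set~ 0]),
        forall u, s n u @[n --> \oo] --> f u,
        forall A, measurable A -> exists2 z, z \in Lfun P 1 &
          L1dist (vintegral_sfun mu (s n) A) z @[n --> \oo] --> 0%E,
        y \in Lfun P 1 &
        L1dist (vintegral_sfun mu (s n) setT) y @[n --> \oo] --> 0%E].

Definition represents X mu : Prop :=
  forall f y, CL f -> is_Y X f y -> is_vintegral mu f y.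

End vector_measure.

(* Main.v *)
Require Import Defs.
From HB Require Import structures.
From mathcomp Require Import all_boot all_order all_algebra.
From mathcomp Require Import all_classical all_reals all_analysis.
From mathcomp Require Import measurable_realfun ring lra.
Set Implicit Arguments.
Unset Strict Implicit.
Unset Printing Implicit Defensive.
Import Order.TTheory GRing.Theory Num.Theory.
Import numFieldNormedType.Exports HBSimple.
Local Open Scope classical_set_scope.
Local Open Scope ring_scope.

(** The process is a random walk x + xi_0 + ... + xi_(n-1) observed at an
    independent Poisson time.  Testing the generator at the point 0 on functions
    that vanish there shows that jumps occur at rate one and have law a(u) du
    ([generator_law]).  Write A f(u) = \int f(u + h) a(h) dh.  The walk is held an
    expected time one at each of its steps, so the expected value of
    \int_0^oo f(X(t)) dt is at most \sum_n A^n f(x) for f >= 0; it is the integral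
    of f against the Green measure [green] ([green_le]).

    The heart of the matter is that this sum is finite when f is bounded,
    integrable and d >= 3 (transience).  The proof is Nash's argument.  The squared L^2
    norm loses exactly half the Dirichlet form at each step ([energy]):
      2 |f|^2 - 2 |A f|^2 = \int \int |f - f(. + h' - h)|^2 nu(dh) nu(dh').
    A translation by k h costs at most k^2 times a translation by h, and the
    correlation of f with its translate by k (h' - h), averaged over h', is
    O(k^-d |f|_1^2) since nu has a bounded density ([nash_step]).  Hence
    u_n = |A^n f|^2 satisfies u_n <= C (k^2 (u_n - u_(n+1)) + k^-3) for every integer
    k > 0, and the choice k ~ u_n^(-1/3) bounds u_n by a multiple of
    u_n^(1/3) - u_(n+1)^(1/3), which telescopes ([nash_summable]).  As A is
    self-adjoint, A^(2m+1) f(x) is the inner product of A^m a(. - x) and A^m f, so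
    summability of the norms gives that of A^n f(x) ([potential_summable]).

    With a Green measure that is finite on bounded integrable functions, existence
    is soft.  The map f -> \int_0^oo f(X(t)) dt is a contraction from L^1(green) to
    L^1(P) ([occ_dist]); the random measure is the total time spent in a set, and
    its countable additivity and the representation of Y follow from dominated
    convergence in L^1(green).

    For uniqueness, fix an event W.  The mean over W of a vector measure is a real
    set function, countably additive on bounded Borel sets, hence on each ball a
    difference of two finite measures.  The mean over W of an integral of f, for f
    bounded with bounded support, is then the ordinary integral of f
    ([dunford_schwartz_signed_int]).  The difficulty is that the simple functions
    s_n defining the integral are not uniformly bounded: they are on the sets
    {|v| <= q, |s_n v| <= q for all n}, and what remains outside is small uniformly
    in n by a lemma of Vitali-Hahn-Saks type ([uniform_tails]).  So two representing
    measures agree, in mean over W, on continuous functions that approximate the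
    indicator of a bounded open set, hence on bounded open sets, hence on bounded
    Borel sets by Dynkin's lemma; W is arbitrary. *)

(** * Lebesgue measure on row vectors under affine maps *)

Section measurable_rV.
Context (R : realType) d (T : measurableType d) (n : nat).
Implicit Types f g : T -> 'rV[R]_n.

Lemma measurable_rV_coord f (i : 'I_n) : measurable_fun setT f ->
  measurable_fun setT (fun t => f t ord0 i).
Proof. by move=> mf; apply: (measurableT_comp (measurable_coord i) mf). Qed.

Lemma measurable_rVD f g : measurable_fun setT f -> measurable_fun setT g ->
  measurable_fun setT (fun t => f t + g t).
Proof.
move=> mf mg; apply: measurable_fun_rV => i.
under eq_fun do rewrite mxE.
by apply: measurable_funD; exact: measurable_rV_coord.
Qed.

Lemma measurable_rVZ (c : T -> R) f :
  measurable_fun setT c -> measurable_fun setT f ->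
  measurable_fun setT (fun t => c t *: f t).
Proof.
move=> mc mf; apply: measurable_fun_rV => i.
under eq_fun do rewrite mxE.
by apply: measurable_funM => //; exact: measurable_rV_coord.
Qed.

Lemma measurable_rVN f : measurable_fun setT f ->
  measurable_fun setT (fun t => - f t).
Proof.
move=> mf; under eq_fun do rewrite -scaleN1r.
by apply: measurable_rVZ => //; exact: measurable_cst.
Qed.

Lemma measurable_rVB f g : measurable_fun setT f -> measurable_fun setT g ->
  measurable_fun setT (fun t => f t - g t).
Proof. by move=> mf mg; apply: measurable_rVD => //; exact: measurable_rVN. Qed.

End measurable_rV.

(** The pushforward bundled with its measure structure, which depends on a proof
    that the map is measurable. *)
Definition pushm d1 d2 (T1 : measurableType d1) (T2 : measurableType d2)
  (R : realType) (m : {measure set T1 -> \bar R}) (f : T1 -> T2)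
  (mf : measurable_fun setT f) : {measure set T2 -> \bar R} :=
  measure_function_pushforward__canonical__measure_function_Measure m mf.

Section lebesgue_affine.
Context (R : realType).
Local Notation leb := (@lebesgue_measure R).
Local Open Scope ereal_scope.

Lemma measurable_affine (c b : R) : measurable_fun setT
  ((fun t => (c * t + b)%R) : measurableTypeR R -> measurableTypeR R).
Proof. by apply: measurable_funD => //; apply: measurable_funM. Qed.

(** Lebesgue measure is determined by its values on half-open intervals, where the
    identity is a computation. *)
Lemma lebesgue_measure_affine (c b : R) (A : set R) : (0 < c)%R ->
  measurable A ->
  c%:E * leb ((fun t : measurableTypeR R => (c * t + b)%R) @^-1` A) = leb A.
Proof.
move=> c0 mA.
pose m := mscale (NngNum (ltW c0)) (pushm leb (measurable_affine c b)).
symmetry; apply: (@lebesgue_measure_unique R m) => // _ [[u v]] _ <-.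
change (leb `]u, v] = c%:E * leb ((fun t : measurableTypeR R => (c * t + b)%R) @^-1` `]u, v])).
rewrite (_ : _ @^-1` _ = `]((u - b) / c)%R, ((v - b) / c)%R]%classic); last first.
  apply/seteqP; split => t /=; rewrite !in_itv/= => /andP[h1 h2]; apply/andP.
    by split; [rewrite ltr_pdivrMr// mulrC|rewrite ler_pdivlMr// mulrC]; lra.
  move: h1 h2; rewrite ltr_pdivrMr// ler_pdivlMr// => h1 h2.
  by split; rewrite [(c * t)%R]mulrC; lra.
rewrite !lebesgue_measure_itv/= !lte_fin ltr_pM2r ?invr_gt0// ltrD2r.
case: ifPn => uv; last by rewrite mule0.
by rewrite -EFinM; congr EFin; field; rewrite gt_eqF.
Qed.

Lemma ge0_integral_affine_pos (g : R -> \bar R) (c b : R) : (0 < c)%R ->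
  measurable_fun setT g -> (forall t, 0 <= g t) ->
  \int[leb]_t g (c * t + b)%R = (c^-1)%:E * \int[leb]_t g t.
Proof.
move=> c0 mg g0.
have -> : \int[leb]_t g t =
    \int[mscale (NngNum (ltW c0)) (pushm leb (measurable_affine c b))]_t g t.
  apply: eq_measure_integral => A mA _.
  exact/esym/lebesgue_measure_affine.
rewrite ge0_integral_mscale//= ge0_integral_pushforward//; last first.
  exact: measurable_affine.
by rewrite preimage_setT muleA -EFinM mulVf ?gt_eqF// mul1e.
Qed.

Lemma ge0_integral_opp (g : R -> \bar R) :
  measurable_fun setT g -> (forall t, 0 <= g t) ->
  \int[leb]_t g (- t)%R = \int[leb]_t g t.
Proof.
move=> mg g0.
have mN : measurable_fun setT (-%R : measurableTypeR R -> measurableTypeR R).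
  exact: oppr_measurable.
have -> : \int[leb]_t g t = \int[pushm leb mN]_t g t.
  by apply: eq_measure_integral => A mA _; exact/esym/lebesgue_measureN.
by rewrite ge0_integral_pushforward// preimage_setT.
Qed.

Lemma ge0_integral_affine (g : R -> \bar R) (c b : R) : c != 0%R ->
  measurable_fun setT g -> (forall t, 0 <= g t) ->
  \int[leb]_t g (c * t + b)%R = (`|c|^-1)%:E * \int[leb]_t g t.
Proof.
move=> cneq0 mg g0; have [c0|c0|/eqP] := ltgtP c 0%R; last by rewrite (negbTE cneq0).
  rewrite ltr0_norm// -(ge0_integral_affine_pos b (c := - c))//; last by rewrite oppr_gt0.
  rewrite -[RHS]ge0_integral_opp//.
    by under [RHS]eq_integral do rewrite mulrNN.
  by apply: measurableT_comp => //; exact: measurable_affine.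
by rewrite gtr0_norm// ge0_integral_affine_pos.
Qed.

End lebesgue_affine.

Section lebesgue_rV_affine.
Context (R : realType).
Local Open Scope ereal_scope.

Lemma integral_lebesgue_rVS n (g : 'rV[R]_n.+1 -> \bar R) :
  measurable_fun setT g -> (forall v, 0 <= g v) ->
  \int[lebesgue_rV R n.+1]_v g v =
  \int[lebesgue_measure]_t \int[lebesgue_rV R n]_v g (cons_rV (t, v)).
Proof.
move=> mg g0 /=; rewrite ge0_integral_pushforward//; last first.
  exact: measurable_cons_rV.
rewrite preimage_setT fubini_tonelli1//=.
  by apply: measurableT_comp => //; exact: measurable_cons_rV.
Qed.

(** An affine map with scalar linear part acts on the head and on the tail of a row
    vector separately, so Tonelli's theorem reduces the dimension by one. *)
Lemma ge0_integral_affine_rV n (g : 'rV[R]_n -> \bar R) (c : R) b : c != 0%R ->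
  measurable_fun setT g -> (forall v, 0 <= g v) ->
  \int[lebesgue_rV R n]_v g (c *: v + b)%R =
  (`|c| ^- n)%:E * \int[lebesgue_rV R n]_v g v.
Proof.
move=> c0; elim: n => [|n IH] in g b *.
  move=> mg g0; rewrite expr0 invr1 mul1e.
  apply: eq_integral => v _; congr g; apply/rowP => -[]//.
move=> mg g0.
have maff : measurable_fun setT (fun v : 'rV[R]_n.+1 => c *: v + b)%R.
  by apply: measurable_rVD => //; exact: measurable_rVZ.
have mgaff : measurable_fun setT (fun v : 'rV[R]_n.+1 => g (c *: v + b)%R).
  exact: measurableT_comp.
rewrite !integral_lebesgue_rVS//.
pose b' := (uncons_rV b).2; pose b0 := (uncons_rV b).1.
have E t v : (c *: cons_rV (t, v) + b = cons_rV (c * t + b0, c *: v + b'))%R.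
  apply/rowP => i; rewrite !mxE; case: unliftP => [j|] ->.
    by rewrite !mxE.
  by [].
have mgc t : measurable_fun setT (fun v : 'rV[R]_n => g (cons_rV (t, v))).
  apply: measurableT_comp => //; apply: measurableT_comp.
    exact: measurable_cons_rV.
  exact: measurable_pair1.
have mF : measurable_fun setT (fun t : measurableTypeR R =>
    \int[lebesgue_rV R n]_v g (cons_rV (t, v))).
  apply: (measurable_fun_fubini_tonelli_F (fun p => g (cons_rV p))) => //.
  by apply: measurableT_comp => //; exact: measurable_cons_rV.
under eq_integral => t _.
  under eq_integral do rewrite E.
  rewrite (IH (fun v => g (cons_rV ((c * t + b0)%R, v))))//.
  over.
rewrite /= ge0_integralZl//; last 2 first.
- exact: (measurableT_comp mF (measurable_affine c b0)).
- by move=> t _; apply: integral_ge0.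
rewrite (ge0_integral_affine b0 c0 (g := fun t => \int[lebesgue_rV R n]_v g (cons_rV (t, v))))//.
- by rewrite muleA -EFinM exprS invfM mulrC.
- by move=> t; apply: integral_ge0.
Qed.

End lebesgue_rV_affine.

(** * Averaging over one jump and Nash's inequality *)

Section ge0_integrals.
Context d (T : measurableType d) (R : realType) (mu : {measure set T -> \bar R}).
Local Open Scope ereal_scope.

Lemma ge0_le_intT (f g : T -> \bar R) : (forall x, 0 <= f x) ->
  measurable_fun setT f -> measurable_fun setT g -> (forall x, f x <= g x) ->
  \int[mu]_x f x <= \int[mu]_x g x.
Proof. by move=> f0 mf mg fg; apply: ge0_le_integral => // x _; exact: fg. Qed.

Lemma intDT (f g : T -> \bar R) : (forall x, 0 <= f x) -> (forall x, 0 <= g x) ->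
  measurable_fun setT f -> measurable_fun setT g ->
  \int[mu]_x (f x + g x) = \int[mu]_x f x + \int[mu]_x g x.
Proof. by move=> f0 g0 mf mg; apply: ge0_integralD. Qed.

Lemma intZT (f : T -> \bar R) (k : R) : (forall x, 0 <= f x) -> (0 <= k)%R ->
  measurable_fun setT f ->
  \int[mu]_x (k%:E * f x) = k%:E * \int[mu]_x f x.
Proof. by move=> f0 k0 mf; apply: ge0_integralZl_EFin. Qed.

End ge0_integrals.

Section iid_variance.
Context d (T : measurableType d) (R : realType) (P : probability T R).
Local Open Scope ereal_scope.

Lemma integral_cst_prob (c : \bar R) : \int[P]_x c = c.
Proof. by rewrite integral_cst// [X in _ * X]probability_setT mule1. Qed.

Lemma integral_prob_le (p : T -> R) (M : R) : measurable_fun setT p ->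
  (forall x, 0 <= p x)%R -> (forall x, p x <= M)%R ->
  \int[P]_x (p x)%:E <= M%:E.
Proof.
move=> mp p0 pM; rewrite -(integral_cst_prob M%:E); apply: ge0_le_intT => //.
- exact/measurable_EFinP.
Qed.

(** The mean of (U - U')^2 is twice the variance of U for independent U, U' with the
    same law.  The square of the mean is on the left because the second moment may
    be infinite. *)
Lemma iid_variance (p : T -> R) (m : R) : measurable_fun setT p ->
  (forall x, 0 <= p x)%R -> \int[P]_x (p x)%:E = m%:E ->
  \int[P]_x \int[P]_y ((p x - p y) ^+ 2)%:E + 2%:E * (m ^+ 2)%:E =
  2%:E * \int[P]_x (p x ^+ 2)%:E.
Proof.
move=> mp p0 pm.
have m0 : (0 <= m)%R.
  by rewrite -lee_fin -pm; apply: integral_ge0 => x _; rewrite lee_fin.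
have mE (c : R) : measurable_fun setT (fun x => (c * p x)%:E).
  by apply/measurable_EFinP; exact: measurable_funM.
have mS : measurable_fun setT (fun x => (p x ^+ 2)%:E).
  by apply/measurable_EFinP; exact: measurable_funX.
have mD : measurable_fun setT (fun z : T * T => ((p z.1 - p z.2) ^+ 2)%:E).
  apply/measurable_EFinP; apply: measurable_funX; apply: measurable_funB.
    exact: measurableT_comp.
  exact: measurableT_comp.
have p0E x : 0 <= (p x)%:E by rewrite lee_fin.
have c0 x : (0 <= 2 * p x)%R by rewrite mulr_ge0.
have mp' : measurable_fun setT (fun x => (p x)%:E) by exact/measurable_EFinP.
have s0 x : 0 <= (p x ^+ 2)%:E by rewrite lee_fin sqr_ge0.
have sq2 x y : 0 <= ((p x - p y) ^+ 2)%:E by rewrite lee_fin sqr_ge0.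
have mD1 x : measurable_fun setT (fun y => ((p x - p y) ^+ 2)%:E).
  exact: (measurableT_comp mD (measurable_pair1 x)).
have c2 x y : 0 <= (2 * p x)%:E * (p y)%:E by rewrite -EFinM lee_fin !mulr_ge0.
have mc2 x : measurable_fun setT (fun y => (2 * p x)%:E * (p y)%:E).
  by under eq_fun do rewrite -EFinM; exact: mE.
have inner x : \int[P]_y ((p x - p y) ^+ 2)%:E + (2 * p x * m)%:E =
    (p x ^+ 2)%:E + \int[P]_y (p y ^+ 2)%:E.
  rewrite EFinM -pm -intZT// -intDT//.
  rewrite -[X in X + _](integral_cst_prob (p x ^+ 2)%:E) -intDT//.
  by apply: eq_integral => y _; rewrite -EFinM -!EFinD; congr EFin; ring.
have mF : measurable_fun setT (fun x => \int[P]_y ((p x - p y) ^+ 2)%:E).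
  apply: (measurable_fun_fubini_tonelli_F (fun z => ((p z.1 - p z.2) ^+ 2)%:E)).
    exact: mD.
  by move=> z; rewrite lee_fin sqr_ge0.
have F0 x : 0 <= \int[P]_y ((p x - p y) ^+ 2)%:E.
  by apply: integral_ge0 => y _; rewrite lee_fin sqr_ge0.
have c3 x : 0 <= (2 * m * p x)%:E by rewrite lee_fin !mulr_ge0.
transitivity (\int[P]_x (\int[P]_y ((p x - p y) ^+ 2)%:E + (2 * m * p x)%:E)).
  rewrite [RHS]intDT//.
  congr (_ + _); under eq_integral do rewrite EFinM.
  by rewrite intZT ?mulr_ge0// pm -!EFinM; congr EFin; ring.
under eq_integral => x _ do rewrite mulrAC inner.
rewrite intDT//; last by move=> x; apply: integral_ge0.
by rewrite integral_cst_prob -mule2n mule_natl.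
Qed.
End iid_variance.

Section averaging.
Context (R : realType) (d : nat) (nu : probability 'rV[R]_d R).
Local Notation V := 'rV[R]_d.
Local Notation leb := (lebesgue_rV R d).
Local Open Scope ereal_scope.
Implicit Types f g : V -> R.

(** The test functions of the averaging operator: the class is stable under [avg],
    and all the integrals below are finite on it. *)
Record bounded_L1p f : Prop := {
  bL1_meas : measurable_fun setT f ;
  bL1_ge0 : forall u, (0 <= f u)%R ;
  bL1_bound : exists M, forall u, (f u <= M)%R ;
  bL1_fin : \int[leb]_u (f u)%:E < +oo }.

Definition avg f (u : V) : R := fine (\int[nu]_h (f (u + h)%R)%:E).

Lemma ge0_integral_shift (g : V -> \bar R) (b : V) :
  measurable_fun setT g -> (forall v, 0 <= g v) ->
  \int[leb]_v g (v + b)%R = \int[leb]_v g v.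
Proof.
move=> mg g0; have := ge0_integral_affine_rV b (oner_neq0 R) mg g0.
rewrite normr1 expr1n invr1 mul1e => <-.
by under [RHS]eq_integral do rewrite scale1r.
Qed.

Lemma ge0_integral_oppV (g : V -> \bar R) :
  measurable_fun setT g -> (forall v, 0 <= g v) ->
  \int[leb]_v g (- v)%R = \int[leb]_v g v.
Proof.
move=> mg g0; have := @ge0_integral_affine_rV R d g (-1)%R 0 _ mg g0.
rewrite normrN1 expr1n invr1 mul1e => <-//.
by under [RHS]eq_integral do rewrite scaleN1r addr0.
Qed.

Lemma measurable_shift2 f : measurable_fun setT f ->
  measurable_fun setT (fun z : V * V => (f (z.1 + z.2)%R)%:E).
Proof.
by move=> mf; apply/measurable_EFinP/measurableT_comp => //; exact: measurable_rVD.
Qed.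

Lemma measurable_shift1 f u : measurable_fun setT f ->
  measurable_fun setT (fun h : V => (f (u + h)%R)%:E).
Proof.
by move=> mf; exact: (measurableT_comp (measurable_shift2 mf) (measurable_pair1 u)).
Qed.

Lemma avgE f u : bounded_L1p f -> (avg f u)%:E = \int[nu]_h (f (u + h)%R)%:E.
Proof.
move=> gf; rewrite fineK// ge0_fin_numE; last first.
  by apply: integral_ge0 => h _; rewrite lee_fin (bL1_ge0 gf).
have [M fM] := bL1_bound gf.
apply: (@le_lt_trans _ _ M%:E); last exact: ltry.
apply: integral_prob_le => // [|h]; last exact: (bL1_ge0 gf).
apply/measurable_EFinP; exact: measurable_shift1 (bL1_meas gf).
Qed.

(** Translation invariance of Lebesgue measure: averaging preserves mass. *)
Lemma integral_avg f : bounded_L1p f ->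
  \int[leb]_u (avg f u)%:E = \int[leb]_u (f u)%:E.
Proof.
move=> gf; under eq_integral do rewrite avgE//.
have f0 h : 0 <= (f h)%:E by rewrite lee_fin (bL1_ge0 gf).
rewrite (fubini_tonelli (fun z : V * V => (f (z.1 + z.2)%R)%:E))//=; last first.
  exact: measurable_shift2 (bL1_meas gf).
rewrite -[RHS](integral_cst_prob nu); apply: eq_integral => h _.
apply: (ge0_integral_shift (g := fun u => (f u)%:E)) => //.
by apply/measurable_EFinP; exact: bL1_meas.
Qed.

Lemma bL1_avg f : bounded_L1p f -> bounded_L1p (avg f).
Proof.
move=> gf; split.
- rewrite (_ : avg f = fine \o fun u => \int[nu]_h (f (u + h)%R)%:E)//.
  apply: measurableT_comp; first exact: fine_measurable.
  apply: (measurable_fun_fubini_tonelli_F (fun z : V * V => (f (z.1 + z.2)%R)%:E)).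
    exact: measurable_shift2 (bL1_meas gf).
  by move=> z; rewrite lee_fin (bL1_ge0 gf).
- move=> u; rewrite -lee_fin avgE//.
  by apply: integral_ge0 => h _; rewrite lee_fin (bL1_ge0 gf).
- have [M fM] := bL1_bound gf; exists M => u; rewrite -lee_fin avgE//.
  apply: integral_prob_le => // [|h]; last exact: (bL1_ge0 gf).
  apply/measurable_EFinP; exact: measurable_shift1 (bL1_meas gf).
- by rewrite integral_avg// (bL1_fin gf).
Qed.

Definition sqnorm f := \int[leb]_u (f u ^+ 2)%:E.
Definition diffsq f (h : V) := \int[leb]_u ((f u - f (u + h)%R) ^+ 2)%:E.

Lemma measurable_sqdist d' (T : measurableType d') f (p q : T -> V) :
  measurable_fun setT f -> measurable_fun setT p -> measurable_fun setT q ->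
  measurable_fun setT (fun t => ((f (p t) - f (q t)) ^+ 2)%:E).
Proof.
move=> mf mp mq; apply/measurable_EFinP; apply: measurable_funX.
by apply: measurable_funB; exact: measurableT_comp.
Qed.

Lemma sqdist_ge0 (x y : R) : 0 <= ((x - y) ^+ 2)%:E.
Proof. by rewrite lee_fin sqr_ge0. Qed.

Lemma diffsq_shift f h h' : bounded_L1p f ->
  \int[leb]_u ((f (u + h)%R - f (u + h')%R) ^+ 2)%:E = diffsq f (h' - h)%R.
Proof.
move=> gf.
transitivity (\int[leb]_u ((f (u + h)%R - f (u + h + (h' - h))%R) ^+ 2)%:E).
  by apply: eq_integral => u _; rewrite -addrA [(h + _)%R]addrC subrK.
apply: (ge0_integral_shift (g := fun u => ((f u - f (u + (h' - h))%R) ^+ 2)%:E)).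
- apply: (@measurable_sqdist _ _ _ id) => //; first exact: bL1_meas gf.
  exact: measurable_rVD.
- by move=> v; exact: sqdist_ge0.
Qed.

Lemma measurable_diffsq f d' (T : measurableType d') (p : T -> V) : bounded_L1p f ->
  measurable_fun setT p -> measurable_fun setT (fun t => diffsq f (p t)).
Proof.
move=> gf mp.
apply: (measurable_fun_fubini_tonelli_F
  (fun z : T * V => ((f z.2 - f (z.2 + p z.1)%R) ^+ 2)%:E)).
  apply: measurable_sqdist => //; first exact: bL1_meas gf.
  by apply: measurable_rVD => //; exact: measurableT_comp.
by move=> z; exact: sqdist_ge0.
Qed.

Lemma diffsq_ge0 f h : 0 <= diffsq f h.
Proof. by apply: integral_ge0 => u _; exact: sqdist_ge0. Qed.

Lemma sqnorm_ge0 f : 0 <= sqnorm f.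
Proof. by apply: integral_ge0 => u _; rewrite lee_fin sqr_ge0. Qed.

(** The variance identity [iid_variance] for the function h -> f(u + h), integrated
    over u: what averaging removes from the squared norm is half the Dirichlet form
    of f. *)
Lemma energy f : bounded_L1p f ->
  \int[nu]_h \int[nu]_h' diffsq f (h' - h)%R + 2%:E * sqnorm (avg f) = 2%:E * sqnorm f.
Proof.
move=> gf; have mf := bL1_meas gf.
pose q (u h h' : V) : \bar R := ((f (u + h)%R - f (u + h')%R) ^+ 2)%:E.
have q0 u h h' : 0 <= q u h h' by exact: sqdist_ge0.
have I0 u h : 0 <= \int[nu]_h' q u h h' by exact: integral_ge0.
have mI (p1 p2 : V * V -> V) : measurable_fun setT p1 -> measurable_fun setT p2 ->
    measurable_fun setT (fun z : V * V => \int[nu]_h' q (p1 z) (p2 z) h').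
  move=> m1 m2; apply: (measurable_fun_fubini_tonelli_F
    (fun y : (V * V) * V => q (p1 y.1) (p2 y.1) y.2)) => //.
  by apply: measurable_sqdist => //; apply: measurable_rVD => //;
    [exact: measurableT_comp|exact: measurableT_comp|exact: measurableT_comp].
have -> : \int[nu]_h \int[nu]_h' diffsq f (h' - h)%R =
    \int[leb]_u \int[nu]_h \int[nu]_h' q u h h'.
  rewrite -(fubini_tonelli (fun z : V * V => \int[nu]_h' q z.2 z.1 h'))//=; last exact: mI.
  apply: eq_integral => h _.
  rewrite -(fubini_tonelli (fun z : V * V => q z.2 h z.1))//=.
    by apply: eq_integral => h' _; rewrite -diffsq_shift.
  apply: measurable_sqdist => //; apply: measurable_rVD => //.
have mavg2 : measurable_fun setT (fun u => (avg f u ^+ 2)%:E).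
  by apply/measurable_EFinP/measurable_funX; exact: (bL1_meas (bL1_avg gf)).
have a0 u : 0 <= (avg f u ^+ 2)%:E by rewrite lee_fin sqr_ge0.
rewrite /sqnorm -intZT// -[LHS]intDT//; last first.
- apply: emeasurable_funM => //.
- apply: (measurable_fun_fubini_tonelli_F
    (fun z : V * V => \int[nu]_h' q z.1 z.2 h')) => //.
  exact: mI.
- by move=> u; rewrite mule_ge0.
- by move=> u; apply: integral_ge0.
under eq_integral => u _.
  rewrite (iid_variance (P := nu) (p := fun h : V => f (u + h)%R) (m := avg f u)); last 3 first.
  - by apply/measurable_EFinP; exact: measurable_shift1.
  - by move=> x; exact: (bL1_ge0 gf).
  - by rewrite avgE.
  over.
have mS : measurable_fun setT (fun z : V * V => (f (z.1 + z.2)%R ^+ 2)%:E).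
  by apply/measurable_EFinP/measurable_funX/measurable_EFinP; exact: measurable_shift2.
have S0 (u : V) : 0 <= (f u ^+ 2)%:E by rewrite lee_fin sqr_ge0.
have mS1 : measurable_fun setT (fun u : V => \int[nu]_h (f (u + h)%R ^+ 2)%:E).
  exact: (measurable_fun_fubini_tonelli_F (fun z : V * V => (f (z.1 + z.2)%R ^+ 2)%:E)).
rewrite intZT//; last by move=> u; apply: integral_ge0.
congr (_ * _).
rewrite (fubini_tonelli (fun z : V * V => (f (z.1 + z.2)%R ^+ 2)%:E))//=.
rewrite -[RHS](integral_cst_prob nu); apply: eq_integral => h _.
apply: (ge0_integral_shift (g := fun u => (f u ^+ 2)%:E)) => //.
by apply/measurable_EFinP/measurable_funX.
Qed.

(** A translation by k h consists of k translations by h, so the L^2 distance of f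
    to its translate grows at most linearly in k. *)
Lemma diffsq_scale f h k : bounded_L1p f ->
  diffsq f (k%:R *: h)%R <= (k%:R ^+ 2)%:E * diffsq f h.
Proof.
move=> gf; have mf := bL1_meas gf.
have m1 (p q : V) : measurable_fun setT
    (fun u : V => ((f (u + p)%R - f (u + q)%R) ^+ 2)%:E).
  by apply: measurable_sqdist => //; exact: measurable_rVD.
have m0 (p : V) : measurable_fun setT
    (fun u : V => ((f u - f (u + p)%R) ^+ 2)%:E).
  by apply: (@measurable_sqdist _ _ _ id) => //; exact: measurable_rVD.
elim: k => [|[|k] IH].
- rewrite scale0r expr0n mul0e le_eqVlt; apply/orP; left; apply/eqP.
  by apply: integral0_eq => u _; rewrite addr0 subrr expr0n.
- by rewrite scale1r expr1n mul1e.
pose c : R := k.+1%:R.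
have c0 : (0 < c)%R by rewrite ltr0n.
have cS : (k.+2%:R = c + 1 :> R)%R by rewrite /c -[in LHS]addn1 natrD.
(* (p + q)^2 <= (1 + 1/c) p^2 + (1 + c) q^2, where c = k + 1 makes the two bounds
   c^2 and 1 add up to (c + 1)^2 *)
apply: (@le_trans _ _ ((1 + c^-1)%:E * diffsq f (c *: h)%R + (1 + c)%:E * diffsq f h)).
  have -> : diffsq f h =
      \int[leb]_u ((f (u + c *: h)%R - f (u + k.+2%:R *: h)%R) ^+ 2)%:E.
    by rewrite diffsq_shift// cS scalerDl scale1r addrAC subrr add0r.
  have cc0 : (0 <= 1 + c^-1)%R by rewrite addr_ge0// invr_ge0 ltW.
  have cc1 : (0 <= 1 + c)%R by rewrite addr_ge0// ltW.
  have mm0 := m0 (c *: h)%R; have mm1 := m1 (c *: h)%R (k.+2%:R *: h)%R.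
  rewrite -!intZT//; try by move=> u; exact: sqdist_ge0.
  rewrite -intDT//; last first.
  - exact: emeasurable_funM.
  - exact: emeasurable_funM.
  - by move=> u; rewrite mule_ge0// sqdist_ge0.
  - by move=> u; rewrite mule_ge0// sqdist_ge0.
  apply: ge0_le_intT => //.
  - by move=> u; exact: sqdist_ge0.
  - by apply: emeasurable_funD; exact: emeasurable_funM.
  - move=> u; rewrite -!EFinM -EFinD lee_fin.
    set y := f (u + k.+2%:R *: h)%R; set z := f (u + c *: h)%R; set t := f u.
    rewrite -subr_ge0.
    rewrite (_ : _ - _ = c^-1 * (t - z - c * (z - y)) ^+ 2)%R.
      by rewrite mulr_ge0 ?sqr_ge0// invr_ge0 ltW.
    by field; rewrite gt_eqF.
apply: (@le_trans _ _ ((1 + c^-1)%:E * ((c ^+ 2)%:E * diffsq f h) + (1 + c)%:E * diffsq f h)).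
  by rewrite leeD2r// lee_pmul2l// lte_fin addr_gt0// invr_gt0.
rewrite muleA -ge0_muleDl.
- rewrite -EFinM -EFinD cS (_ : (1 + c^-1) * c ^+ 2 + (1 + c) = (c + 1) ^+ 2)%R//.
  by field; rewrite gt_eqF.
- by rewrite -EFinM lee_fin mulr_ge0 ?sqr_ge0// addr_ge0// invr_ge0 ltW.
- by rewrite lee_fin addr_ge0// ltW.
Qed.

(** Integrate f^2 <= (f - g)^2 + 2 f g for g the translate of f by k (h' - h), and
    average over h and h'.  The squared difference costs k^2 by [diffsq_scale].  In
    the product the average over h' is at most M times a Lebesgue integral, in which
    the substitution v = k h' produces the factor k^-d. *)
Lemma nash_step (M : R) f k : (0 < k)%N -> bounded_L1p f -> (0 <= M)%R ->
  (forall g : V -> \bar R, measurable_fun setT g -> (forall v, 0 <= g v) ->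
    \int[nu]_h g h <= M%:E * \int[leb]_h g h) ->
  sqnorm f <= (k%:R ^+ 2)%:E * (\int[nu]_h \int[nu]_h' diffsq f (h' - h)%R) +
    2%:E * ((M * k%:R ^- d)%:E * (\int[leb]_u (f u)%:E) ^+ 2).
Proof.
move=> k0 gf M0 nuM; have mf := bL1_meas gf.
have kR0 : (0 < k%:R :> R)%R by rewrite ltr0n.
have [r r0 m1E] : exists2 r : R, (0 <= r)%R & \int[leb]_u (f u)%:E = r%:E.
  have I0 : 0 <= \int[leb]_u (f u)%:E.
    by apply: integral_ge0 => u _; rewrite lee_fin (bL1_ge0 gf).
  exists (fine (\int[leb]_u (f u)%:E)); first exact: fine_ge0.
  by rewrite fineK// ge0_fin_numE// (bL1_fin gf).
rewrite m1E -EFin_expe -EFinM.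
have f0 := bL1_ge0 gf.
pose C (h h' : V) := \int[leb]_u (f u * f (u + k%:R *: (h' - h))%R)%:E.
have mC3 (h : V) : measurable_fun setT
    (fun z : V * V => (f z.1 * f (z.1 + k%:R *: (z.2 - h))%R)%:E).
  apply/measurable_EFinP; apply: measurable_funM; first exact: measurableT_comp.
  apply: measurableT_comp => //; apply: measurable_rVD => //.
  by apply: measurable_rVZ => //; exact: measurable_rVB.
have C0 h h' : 0 <= C h h'.
  by apply: integral_ge0 => u _; rewrite lee_fin mulr_ge0.
have mC h : measurable_fun setT (C h).
  apply: (measurable_fun_fubini_tonelli_G
    (fun z : V * V => (f z.1 * f (z.1 + k%:R *: (z.2 - h))%R)%:E)) => //.
  by move=> z; rewrite lee_fin mulr_ge0.
pose K := (M * k%:R ^- d * r)%R.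
have K0 : (0 <= K)%R by rewrite !mulr_ge0// invr_ge0 exprn_ge0// ltW.
have mfE : measurable_fun setT (fun u => (f u)%:E) by exact/measurable_EFinP.
have C_le h : \int[nu]_h' C h h' <= (K * r)%:E.
  rewrite -(fubini_tonelli
    (fun z : V * V => (f z.1 * f (z.1 + k%:R *: (z.2 - h))%R)%:E))//=; last first.
    by move=> z; rewrite lee_fin mulr_ge0.
  rewrite EFinM -m1E -intZT//; apply: ge0_le_intT.
  - by move=> u; apply: integral_ge0 => h' _; rewrite lee_fin mulr_ge0.
  - apply: (measurable_fun_fubini_tonelli_F
      (fun z : V * V => (f z.1 * f (z.1 + k%:R *: (z.2 - h))%R)%:E)) => //.
    by move=> z; rewrite lee_fin mulr_ge0.
  - exact: emeasurable_funM.
  move=> u; under eq_integral do rewrite EFinM.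
  have maff (b : V) : measurable_fun setT (fun v : V => (f (k%:R *: v + b)%R)%:E).
    apply/measurable_EFinP; apply: measurableT_comp => //.
    by apply: measurable_rVD => //; exact: measurable_rVZ.
  under eq_integral => h' _.
    rewrite (_ : u + k%:R *: (h' - h) = k%:R *: h' + (u - k%:R *: h))%R; last first.
      by rewrite scalerBr addrCA addrA.
    over.
  rewrite intZT//; last by move=> h'; rewrite lee_fin.
  rewrite muleC; apply: lee_wpmul2r; first by rewrite lee_fin.
  apply: (le_trans (nuM _ (maff _) _)); first by move=> v; rewrite lee_fin.
  rewrite (ge0_integral_affine_rV _ _ (g := fun v => (f v)%:E))//; last first.
    exact: lt0r_neq0.
  by rewrite m1E -!EFinM gtr0_norm// mulrA.
rewrite -(integral_cst_prob nu (sqnorm f)).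
have mD : measurable_fun setT (fun z : V * V => diffsq f (z.2 - z.1)%R).
  by apply: measurable_diffsq => //; exact: measurable_rVB.
have mD1 h : measurable_fun setT (fun h' : V => diffsq f (h' - h)%R).
  by apply: measurable_diffsq => //; exact: measurable_rVB.
have mF : measurable_fun setT (fun h : V => \int[nu]_h' diffsq f (h' - h)%R).
  apply: (measurable_fun_fubini_tonelli_F (fun z : V * V => diffsq f (z.2 - z.1)%R)) => //.
  by move=> z; exact: diffsq_ge0.
have F0 (h : V) : 0 <= \int[nu]_h' diffsq f (h' - h)%R.
  by apply: integral_ge0 => h' _; exact: diffsq_ge0.
have -> : (2 * (M * k%:R ^- d * r ^+ 2))%:E = (2 * (K * r))%:E.
  by congr EFin; rewrite /K expr2 !mulrA.
rewrite -intZT ?exprn_ge0//.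
rewrite -(integral_cst_prob nu (2 * (K * r))%:E) -intDT//; last first.
- exact: emeasurable_funM.
- by move=> h; rewrite lee_fin !mulr_ge0.
- by move=> h; rewrite mule_ge0// lee_fin exprn_ge0// ltW.
apply: ge0_le_intT => //.
- by move=> h; exact: sqnorm_ge0.
- by apply: emeasurable_funD => //; exact: emeasurable_funM.
move=> h.
apply: (@le_trans _ _ (\int[nu]_h' (diffsq f (k%:R *: (h' - h))%R + 2%:E * C h h'))).
  rewrite -[X in X <= _](integral_cst_prob nu (sqnorm f)); apply: ge0_le_intT => //.
  - by move=> h'; exact: sqnorm_ge0.
  - apply: emeasurable_funD; last exact: emeasurable_funM.
    by apply: measurable_diffsq => //; apply: measurable_rVZ => //; exact: measurable_rVB.
  move=> h'.
  have mC1 : measurable_fun setT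
      (fun u : V => (f u * f (u + k%:R *: (h' - h))%R)%:E).
    exact: (measurableT_comp (mC3 h) (measurable_pair2 h')).
  have mS1 : measurable_fun setT
      (fun u : V => ((f u - f (u + k%:R *: (h' - h))%R) ^+ 2)%:E).
    by apply: (@measurable_sqdist _ _ _ id) => //; exact: measurable_rVD.
  have C10 (u : V) : 0 <= (f u * f (u + k%:R *: (h' - h))%R)%:E.
    by rewrite lee_fin mulr_ge0.
  rewrite /C -intZT// /diffsq -intDT//; last first.
  - exact: emeasurable_funM.
  - by move=> u; rewrite mule_ge0.
  - by move=> u; exact: sqdist_ge0.
  apply: ge0_le_intT.
  - by move=> u; rewrite lee_fin sqr_ge0.
  - by apply/measurable_EFinP/measurable_funX.
  - by apply: emeasurable_funD => //; exact: emeasurable_funM.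
  - move=> u; rewrite -EFinM -EFinD lee_fin.
    by have := sqr_ge0 (f (u + k%:R *: (h' - h))%R); nra.
have mDk : measurable_fun setT (fun h' : V => diffsq f (k%:R *: (h' - h))%R).
  by apply: measurable_diffsq => //; apply: measurable_rVZ => //; exact: measurable_rVB.
rewrite intDT//; last first.
- exact: emeasurable_funM.
- by move=> h'; rewrite mule_ge0.
- by move=> h'; exact: diffsq_ge0.
rewrite [X in _ + X <= _]intZT// (EFinM 2); apply: leeD; last first.
  exact: lee_wpmul2l.
rewrite -intZT ?exprn_ge0//; last by move=> h'; exact: diffsq_ge0.
apply: ge0_le_intT => //.
- by move=> h'; exact: diffsq_ge0.
- exact: emeasurable_funM.
- by move=> h'; exact: diffsq_scale.
Qed.

End averaging.

(** * Finiteness of the potential in dimension at least three *)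

(** For k slightly larger than K / u_n^(1/3) the term k^-3 is absorbed by half of u_n,
    and k^2 (u_n - u_(n+1)) is at most a multiple of u_n^(1/3) - u_(n+1)^(1/3), by the
    mean value inequality for the cube.  The sum of these differences telescopes. *)
Lemma nash_summable (R : realType) (u : nat -> R) (C : R) : 0 <= C ->
  (forall n, 0 <= u n) -> (forall n, u n.+1 <= u n) ->
  (forall n k, (0 < k)%N -> u n <= C * (k%:R ^+ 2 * (u n - u n.+1) + k%:R ^- 3)) ->
  exists B, forall N, \sum_(i < N) u i <= B.
Proof.
move=> C0 u0 ud uC.
pose w n : R := u n `^ (3%:R^-1).
have w0 n : 0 <= w n by exact: powR_ge0.
have wE n : w n ^+ 3 = u n.
  by rewrite -powR_mulrn// -powRrM mulVf ?pnatr_eq0// powRr1.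
have wd n : w n.+1 <= w n by apply: ge0_ler_powR; rewrite ?nnegrE ?invr_ge0//.
have wd0 n : w n <= w 0%N by elim: n => // n; exact: le_trans.
(* K^3 >= 2 C is what makes C / k^3 at most u_n / 2 when k u_n^(1/3) > K *)
pose K : R := 2 * C + 1.
have K1 : 1 <= K by rewrite /K lerDr mulr_ge0.
have K0 : 0 < K by exact: lt_le_trans K1.
have K3 : 2 * C <= K ^+ 3.
  apply: (@le_trans _ _ K); first by rewrite /K lerDl.
  by rewrite -{1}[K]expr1 ler_weXn2l.
pose B : R := 6 * C * (K + w 0%N) ^+ 2.
have B0 : 0 <= B by apply: mulr_ge0; [exact: mulr_ge0|exact: sqr_ge0].
have step n : u n <= B * (w n - w n.+1).
  have [wn0|wn0] := eqVneq (w n) 0.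
    by rewrite -wE wn0 expr0n mulr_ge0// sub0r oppr_ge0 -wn0.
  have wp : 0 < w n by rewrite lt_neqAle eq_sym wn0 w0.
  pose k := (Num.truncn (K / w n)).+1.
  have Kw0 : 0 <= K / w n by rewrite divr_ge0// ltW.
  have /andP[k1 k2] := truncn_itv Kw0.
  have kl : K < k%:R * w n by rewrite -ltr_pdivrMr.
  have kr : k%:R * w n <= K + w n.
    by rewrite /k -addn1 natrD mulrDl mul1r lerD2r -ler_pdivlMr.
  have k0 : 0 < k%:R :> R by rewrite ltr0n.
  have h1 : C * k%:R ^- 3 <= u n / 2.
    rewrite ler_pdivrMr ?exprn_gt0// -wE mulrAC ler_pdivlMr// -exprMn mulrC [w n * _]mulrC.
    apply: (le_trans K3); apply: lerXn2r; rewrite ?nnegrE ?ltW//.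
    by rewrite (lt_trans K0).
  have h2 : k%:R ^+ 2 * (u n - u n.+1) <= 3 * (K + w 0%N) ^+ 2 * (w n - w n.+1).
    rewrite -!wE.
    have e : w n ^+ 3 - w n.+1 ^+ 3 <= 3 * w n ^+ 2 * (w n - w n.+1).
      rewrite -subr_ge0 (_ : _ - _ = (w n - w n.+1) ^+ 2 * (2 * w n + w n.+1)).
        by rewrite mulr_ge0 ?sqr_ge0// addr_ge0// mulr_ge0.
      by ring.
    apply: (le_trans (ler_wpM2l (sqr_ge0 _) e)).
    rewrite [leLHS](_ : _ = (k%:R * w n) ^+ 2 * (3 * (w n - w n.+1))); last by ring.
    rewrite [leRHS](_ : _ = (K + w 0%N) ^+ 2 * (3 * (w n - w n.+1))); last by ring.
    apply: ler_wpM2r; first by rewrite mulr_ge0// subr_ge0.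
    apply: lerXn2r; rewrite ?nnegrE; first by rewrite mulr_ge0.
      by rewrite addr_ge0// ltW.
    by apply: (le_trans kr); rewrite lerD2l.
  have := uC n k isT; rewrite mulrDr => h3.
  have := ler_wpM2l C0 h2 => h4.
  by rewrite /B; lra.
exists (B * w 0%N) => N.
apply: (@le_trans _ _ (B * (w 0%N - w N))); last first.
  by rewrite ler_wpM2l// lerBlDr lerDl.
elim: N => [|N IH]; first by rewrite big_ord0 subrr mulr0.
rewrite big_ord_recr/=; apply: (le_trans (lerD IH (step N))).
by rewrite -mulrDr addrA subrK.
Qed.

Section potential.
Context (R : realType) (d : nat) (nu : probability 'rV[R]_d R).
Local Notation V := 'rV[R]_d.
Local Notation leb := (lebesgue_rV R d).
Context (a : V -> R) (M : R).
Context (ma : measurable_fun setT a) (a0 : forall u, 0 <= a u).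
Context (aM : forall u, a u <= M) (aN : forall u, a (- u) = a u).
Context (nuE : forall g : V -> \bar R, measurable_fun setT g ->
  (forall v, 0 <= g v)%E ->
  (\int[nu]_h g h = \int[leb]_h ((a h)%:E * g h))%E).
Local Open Scope ereal_scope.
Implicit Types f g : V -> R.
Local Notation avg := (avg nu).

Let M0 : (0 <= M)%R. Proof. exact: le_trans (a0 0%R) (aM 0%R). Qed.

Let mEa : measurable_fun setT (fun h => (a h)%:E).
Proof. exact/measurable_EFinP. Qed.

Let nu_le (g : V -> \bar R) : measurable_fun setT g -> (forall v, 0 <= g v) ->
  \int[nu]_h g h <= M%:E * \int[leb]_h g h.
Proof.
move=> mg g0; rewrite nuE// -intZT//; apply: ge0_le_intT.
- by move=> v; rewrite mule_ge0// lee_fin.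
- exact: emeasurable_funM.
- exact: emeasurable_funM.
- by move=> v; rewrite lee_wpmul2r// lee_fin.
Qed.

Let nu_sym (g : V -> \bar R) : measurable_fun setT g -> (forall v, 0 <= g v) ->
  \int[nu]_h g (- h)%R = \int[nu]_h g h.
Proof.
move=> mg g0; rewrite !nuE//; last first.
  by apply: measurableT_comp => //; exact: measurable_rVN.
rewrite -[RHS](ge0_integral_oppV (g := fun h => (a h)%:E * g h)).
- by apply: eq_integral => h _; rewrite aN.
- exact: emeasurable_funM.
- by move=> v; rewrite mule_ge0// lee_fin.
Qed.

Definition inner g f := \int[leb]_u (g u * f u)%:E.

(** The substitution u -> u - h moves the translation to the other factor with the
    opposite sign, which the symmetry of the density undoes. *)
Lemma avg_selfadjoint g f : bounded_L1p g -> bounded_L1p f -> inner (avg g) f = inner g (avg f).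
Proof.
move=> gg gf; have mf := bL1_meas gf; have mg := bL1_meas gg.
have f0 := bL1_ge0 gf; have g0 := bL1_ge0 gg.
have m1 : measurable_fun setT (fun z : V * V => (f z.1 * g (z.1 + z.2)%R)%:E).
  apply/measurable_EFinP; apply: measurable_funM; first exact: measurableT_comp.
  by apply: measurableT_comp => //; exact: measurable_rVD.
have m2 : measurable_fun setT (fun z : V * V => (g z.1 * f (z.1 - z.2)%R)%:E).
  apply/measurable_EFinP; apply: measurable_funM; first exact: measurableT_comp.
  by apply: measurableT_comp => //; exact: measurable_rVB.
transitivity (\int[leb]_u \int[nu]_h (f u * g (u + h)%R)%:E).
  apply: eq_integral => u _; rewrite mulrC EFinM avgE// -intZT//.
  - by move=> h; rewrite lee_fin.
  - exact: measurable_shift1.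
rewrite (fubini_tonelli (fun z : V * V => (f z.1 * g (z.1 + z.2)%R)%:E))//=; last first.
  by move=> z; rewrite lee_fin mulr_ge0.
transitivity (\int[nu]_h \int[leb]_u (g u * f (u - h)%R)%:E).
  apply: eq_integral => h _.
  rewrite -[RHS](ge0_integral_shift (g := fun u : V => (g u * f (u - h)%R)%:E) h).
  - by apply: eq_integral => u _; rewrite addrK mulrC.
  - exact: (measurableT_comp m2 (measurable_pair2 h)).
  - by move=> u; rewrite lee_fin mulr_ge0.
rewrite -(fubini_tonelli (fun z : V * V => (g z.1 * f (z.1 - z.2)%R)%:E))//=; last first.
  by move=> z; rewrite lee_fin mulr_ge0.
apply: eq_integral => u _; rewrite EFinM avgE//.
under eq_integral do rewrite EFinM.
have mfu : measurable_fun setT (fun h : V => (f (u + h)%R)%:E).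
  exact: measurable_shift1.
rewrite -(nu_sym (g := fun h : V => (f (u + h)%R)%:E))//.
  rewrite intZT//; first by move=> h; rewrite lee_fin.
  by apply: (measurableT_comp mfu); exact: measurable_rVN.
by move=> v; rewrite lee_fin.
Qed.

Lemma inner_le g f : bounded_L1p g -> bounded_L1p f -> inner g f <= (2^-1)%:E * (sqnorm g + sqnorm f).
Proof.
move=> gg gf; have mf := bL1_meas gf; have mg := bL1_meas gg.
have f0 := bL1_ge0 gf; have g0 := bL1_ge0 gg.
have m2 (h : V -> R) : measurable_fun setT h -> measurable_fun setT (fun u => (h u ^+ 2)%:E).
  by move=> mh; apply/measurable_EFinP/measurable_funX.
have s0 (h : V -> R) u : 0 <= (h u ^+ 2)%:E by rewrite lee_fin sqr_ge0.
rewrite /sqnorm -intDT; [|exact: s0|exact: s0|exact: m2|exact: m2].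
rewrite -intZT//; last first.
- by apply: emeasurable_funD; exact: m2.
- by move=> u; rewrite adde_ge0.
apply: ge0_le_intT.
- by move=> u; rewrite lee_fin mulr_ge0.
- by apply/measurable_EFinP/measurable_funM.
- by apply: emeasurable_funM => //; apply: emeasurable_funD; exact: m2.
- move=> u; rewrite -EFinD -EFinM lee_fin.
  by have := sqr_ge0 (g u - f u)%R; lra.
Qed.

Lemma sqnorm_fin f : bounded_L1p f -> sqnorm f \is a fin_num.
Proof.
move=> gf; have f0 := bL1_ge0 gf; have [B fB] := bL1_bound gf.
have B0 : (0 <= B)%R := le_trans (f0 0%R) (fB 0%R).
have mf : measurable_fun setT (fun u => (f u)%:E).
  by apply/measurable_EFinP; exact: bL1_meas.
rewrite ge0_fin_numE ?sqnorm_ge0//.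
apply: (@le_lt_trans _ _ (B%:E * \int[leb]_u (f u)%:E)).
  rewrite -intZT//.
  apply: ge0_le_intT.
  - by move=> u; rewrite lee_fin sqr_ge0.
  - by apply/measurable_EFinP/measurable_funX; exact: bL1_meas.
  - exact: emeasurable_funM.
  - by move=> u; rewrite -EFinM lee_fin expr2 ler_wpM2r.
rewrite lte_mul_pinfty ?lee_fin//; exact: bL1_fin.
Qed.

Lemma bL1_iter f n : bounded_L1p f -> bounded_L1p (iter n avg f).
Proof. by move=> gf; elim: n => //= n; exact: bL1_avg. Qed.

Lemma integral_iter_avg f n : bounded_L1p f ->
  \int[leb]_u (iter n avg f u)%:E = \int[leb]_u (f u)%:E.
Proof.
move=> gf; elim: n => //= n IH; rewrite integral_avg//; exact: bL1_iter.
Qed.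

Lemma inner_iter g f n : bounded_L1p g -> bounded_L1p f ->
  inner g (iter n avg f) = inner (iter n avg g) f.
Proof.
move=> gg gf; elim: n => [//|n IH] in g gg *.
rewrite iterS iterSr -avg_selfadjoint//; last exact: bL1_iter.
by rewrite IH//; exact: bL1_avg.
Qed.

(** A pointwise value of [avg] is an inner product, to which self-adjointness
    applies. *)
Lemma avg_inner f x : bounded_L1p f ->
  (avg f x)%:E = inner (fun y : V => a (y - x)%R) f.
Proof.
move=> gf; have f0 := bL1_ge0 gf; rewrite avgE// nuE; last first.
- by move=> v; rewrite lee_fin.
- by apply: measurable_shift1; exact: bL1_meas.
rewrite -(ge0_integral_shift (g := fun h : V => (a h)%:E * (f (x + h)%R)%:E) (- x)%R).
- by apply: eq_integral => u _; rewrite [(x + _)%R]addrC subrK EFinM.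
- by apply: emeasurable_funM => //; apply: measurable_shift1; exact: bL1_meas.
- by move=> v; rewrite mule_ge0// lee_fin.
Qed.

Lemma bL1_density (x : V) : bounded_L1p (fun y : V => a (y - x)%R).
Proof.
split => //.
- by apply: measurableT_comp => //; exact: measurable_rVB.
- by exists M => u.
- rewrite (ge0_integral_shift (g := fun h : V => (a h)%:E))//.
  have := nuE (measurable_cst 1) (fun=> lee01).
  rewrite integral_cst_prob; under eq_integral do rewrite mule1.
  by move=> <-; rewrite ltry.
Qed.

(** By [energy] the Dirichlet form of the n-th iterate is twice the decrease of the
    squared norm, so that [nash_step] is the hypothesis of [nash_summable].  The mass
    in it does not depend on n, and the dimension enters through k^-d <= k^-3. *)
Lemma sqnorm_iter_summable f : (3 <= d)%N -> bounded_L1p f ->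
  exists B : R, forall N, (\sum_(i < N) fine (sqnorm (iter i avg f)) <= B)%R.
Proof.
move=> d3 gf.
pose r := fine (\int[leb]_u (f u)%:E).
have rE : \int[leb]_u (f u)%:E = r%:E.
  rewrite fineK// ge0_fin_numE ?(bL1_fin gf)//.
  by apply: integral_ge0 => u _; rewrite lee_fin (bL1_ge0 gf).
pose C : R := (2 + 2 * M * r ^+ 2)%R.
pose u n := fine (sqnorm (iter n avg f)).
have uE n : sqnorm (iter n avg f) = (u n)%:E.
  by rewrite fineK//; apply: sqnorm_fin; exact: bL1_iter.
have MR0 : (0 <= 2 * M * r ^+ 2)%R.
  by apply: mulr_ge0; [exact: mulr_ge0|exact: sqr_ge0].
have C0 : (0 <= C)%R by rewrite addr_ge0.
have EE n : \int[nu]_h \int[nu]_h' diffsq (iter n avg f) (h' - h)%R =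
    (2 * (u n - u n.+1))%:E.
  have := energy nu (bL1_iter n gf); rewrite -iterS !uE.
  case: (\int[nu]_h _) => //=.
  move=> e; rewrite -!EFinM -EFinD => -[] => eE; congr EFin; lra.
have D0 n : (0 <= u n - u n.+1)%R.
  have : 0 <= (2 * (u n - u n.+1))%:E.
    rewrite -EE; apply: integral_ge0 => h _; apply: integral_ge0 => h' _.
    exact: diffsq_ge0.
  by rewrite lee_fin pmulr_rge0.
apply: (nash_summable C0 (u := u)).
- by move=> n; rewrite fine_ge0// sqnorm_ge0.
- by move=> n; rewrite -subr_ge0.
move=> n k k0.
have := nash_step k0 (bL1_iter n gf) M0 nu_le.
rewrite EE uE integral_iter_avg// rE -EFin_expe -!EFinM -EFinD lee_fin => /le_trans; apply.
have k1 : (1 <= k%:R :> R)%R by rewrite ler1n.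
have kp : (0 < k%:R :> R)%R by rewrite ltr0n.
have kd : (k%:R ^- d <= k%:R ^- 3 :> R)%R.
  by rewrite lef_pV2 ?posrE ?exprn_gt0// ler_weXn2l.
have p1 : (0 <= k%:R ^+ 2 * (u n - u n.+1))%R.
  by apply: mulr_ge0 => //; exact: sqr_ge0.
have p2 : (0 <= k%:R ^- 3 :> R)%R by rewrite invr_ge0 exprn_ge0// ltW.
pose A := (2 * M * r ^+ 2)%R.
have q1 : (0 <= A * (k%:R ^+ 2 * (u n - u n.+1)))%R by exact: mulr_ge0.
have q2 : (A * k%:R ^- d <= A * k%:R ^- 3)%R by exact: ler_wpM2l.
rewrite /C -/A; move: p1 p2 q1 q2.
rewrite (_ : 2 * (M * k%:R ^- d * r ^+ 2) = A * k%:R ^- d)%R; last first.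
  by rewrite /A; ring.
rewrite [(k%:R ^+ 2 * (2 * _))%R]mulrCA.
move: (k%:R ^+ 2 * _)%R (k%:R ^- d)%R (k%:R ^- 3)%R => p q q'; lra.
Qed.

(** The iterate of order 2m + 1 at x is the inner product of the m-th iterates of
    a(. - x) and f, hence at most half the sum of their squared norms.  The iterates
    of order 2m + 2 are those of order 2m + 1 for [avg f]. *)
Lemma potential_summable f x : (3 <= d)%N -> bounded_L1p f ->
  exists B : R, forall N, (\sum_(i < N) iter i avg f x <= B)%R.
Proof.
move=> d3 gf; pose phi (y : V) := a (y - x)%R.
have gphi : bounded_L1p phi := bL1_density x.
have [B1 hB1] := sqnorm_iter_summable d3 gphi.
have [B2 hB2] := sqnorm_iter_summable d3 gf.
have [B3 hB3] := sqnorm_iter_summable d3 (bL1_avg nu gf).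
pose n2 f := fine (sqnorm f).
have b0 i : (0 <= iter i avg f x)%R := bL1_ge0 (bL1_iter i gf) x.
have key g m : bounded_L1p g -> (iter (m + m).+1 avg g x <=
    2^-1 * (n2 (iter m avg phi) + n2 (iter m avg g)))%R.
  move=> gg; rewrite -lee_fin iterS avg_inner; last exact: bL1_iter.
  rewrite iterD inner_iter//; last exact: bL1_iter.
  apply: (le_trans (inner_le (bL1_iter m gphi) (bL1_iter m gg))).
  by rewrite -[sqnorm (iter m avg phi)]fineK ?sqnorm_fin//;
    [rewrite -[sqnorm (iter m avg g)]fineK ?sqnorm_fin//|]; exact: bL1_iter.
have main N : (\sum_(i < (N + N).+1) iter i avg f x <= f x +
    2^-1 * (\sum_(i < N) n2 (iter i avg phi) + \sum_(i < N) n2 (iter i avg f)) +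
    2^-1 * (\sum_(i < N) n2 (iter i avg phi) +
            \sum_(i < N) n2 (iter i avg (avg f))))%R.
  elim: N => [|N IH]; first by rewrite addn0 big_ord1 !big_ord0 !(addr0, mulr0).
  rewrite addSn addnS big_ord_recr [in leLHS]big_ord_recr/= -!iterS.
  rewrite !(big_ord_recr N)/=.
  have k1 := key f N gf.
  have k2 := key (avg f) N (bL1_avg nu gf).
  rewrite -iterSr in k2.
  move: IH k1 k2; rewrite !iterS; lra.
exists (f x + 2^-1 * (B1 + B2) + 2^-1 * (B1 + B3))%R => N.
apply: (@le_trans _ _ (\sum_(i < (N + N).+1) iter i avg f x)%R).
  rewrite -!(big_mkord xpredT (fun i => iter i avg f x)).
  have NN : (N <= (N + N).+1)%N by rewrite -addnS leq_addr.
  by rewrite [leRHS](big_cat_nat _ NN)//= lerDl sumr_ge0.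
apply: (le_trans (main N)).
have := hB1 N; have := hB2 N; have := hB3 N; rewrite /n2; lra.
Qed.

End potential.

(** * The random walk and the process at a fixed time *)

Section image_law.
Context d1 d2 (T1 : measurableType d1) (T2 : measurableType d2) (R : realType).
Context (P : probability T1 R) (f : T1 -> T2) (mf : measurable_fun setT f).

Definition mfun_of : {mfun T1 >-> T2} :=
  HB.pack f (isMeasurableFun.Build _ _ _ _ f mf).

Definition image_law : probability T2 R := distribution P mfun_of.

Lemma integral_image_law (g : T2 -> \bar R) : measurable_fun setT g ->
  (forall y, 0 <= g y)%E ->
  (\int[image_law]_y g y = \int[P]_w g (f w))%E.
Proof.
by move=> mg g0; rewrite ge0_integral_pushforward// preimage_setT.
Qed.

End image_law.
Arguments image_law {d1 d2 T1 T2 R} P {f} mf.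

(** Dividing by the mass p reduces this to uniqueness of the product probability; the
    null measure is treated apart. *)
Lemma product_prob_unique d1 d2 (T1 : measurableType d1) (T2 : measurableType d2)
    (R : realType) (m1 : probability T1 R) (m2 : probability T2 R)
    (m : {measure set (T1 * T2) -> \bar R}) (p : R) : 0 <= p ->
  (m setT <= p%:E)%E ->
  (forall A B, measurable A -> measurable B ->
    m (A `*` B) = p%:E * (m1 A * m2 B))%E ->
  forall C, measurable C -> m C = (p%:E * (m1 \x m2) C)%E.
Proof.
move=> p0 mp mE C mC; have [pp|pp] := eqVneq p 0.
  rewrite pp mul0e; apply/eqP; rewrite eq_le measure_ge0 andbT.
  by rewrite pp in mp; apply: (le_trans _ mp); apply: le_measure; rewrite ?inE.
have ip0 : 0 <= p^-1 by rewrite invr_ge0.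
have -> : ((m1 \x m2) C = (p^-1)%:E * m C)%E.
  apply: (@product_measure_unique _ _ _ _ _ m1 m2 (mscale (NngNum ip0) m)) => //.
  move=> A B mA mB; change ((p^-1)%:E * m (A `*` B) = m1 A * m2 B)%E.
  by rewrite mE// muleA -EFinM mulVf// mul1e.
by rewrite muleA -EFinM mulfV// mul1e.
Qed.

Section walk.
Context (R : realType) (dO : measure_display) (Omega : measurableType dO).
Context (P : probability Omega R) (d : nat) (x : 'rV[R]_d) (lambda : R).
Context (nu : probability 'rV[R]_d R) (N : R -> Omega -> nat).
Context (xi : nat -> Omega -> 'rV[R]_d) (X : R -> Omega -> 'rV[R]_d).
Context (H : compound_poisson_sum P x lambda nu N xi X).
Local Notation V := 'rV[R]_d.

Definition walk n (w : Omega) : V := x + \sum_(i < n) xi i w.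

Lemma measurable_walk n : measurable_fun setT (walk n).
Proof.
apply: measurable_rVD => //; elim: n => [|n IH].
  by under eq_fun do rewrite big_ord0; exact: measurable_cst.
under eq_fun do rewrite big_ord_recr.
by apply: measurable_rVD => //; exact: (cps_measurable H).
Qed.

Definition law n := image_law P (measurable_walk n).

Lemma lawE n C : law n C = P (walk n @^-1` C).
Proof. by []. Qed.

Lemma measurable_step n :
  measurable_fun setT (fun w => (walk n w, xi n w) : V * V).
Proof.
by apply/measurable_fun_pairP; split;
  [exact: measurable_walk|exact: (cps_measurable H)].
Qed.

(** An event on the Poisson process at time t and on the jumps with indices in r.
    When these indices are at least n, it is independent of [walk n]. *)
Definition future (t : R) (A : set nat) (r : seq nat) (B : nat -> set V) :=
  (N t @^-1` A) `&` \bigcap_(i in [set` r]) xi i @^-1` B i.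

Lemma measurable_future t A r B : 0 <= t -> (forall i, measurable (B i)) ->
  measurable (future t A r B).
Proof.
move=> t0 mB; apply: measurableI.
  rewrite -[X in measurable X]setTI.
  by apply: (poisson_measurable (cps_poisson H)).
rewrite bigcap_seq; apply: bigsetI_measurable => i _.
by rewrite -[X in measurable X]setTI; apply: (cps_measurable H).
Qed.

Lemma future_prob t A r B : 0 <= t -> (forall i, measurable (B i)) -> uniq r ->
  P (future t A r B) = (P (N t @^-1` A) * \prod_(i <- r) nu (B i))%E.
Proof.
move=> t0 mB ur.
have := cps_independent_poisson H (s := [:: t]) (fun=> A) r (B := B).
rewrite (cps_independent H ur mB).
rewrite (_ : \bigcap_(t0 in [set` [:: t]]) _ = N t @^-1` A); last first.
  by rewrite bigcap_seq big_seq1.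
move=> ->//; last by move=> s; rewrite inE => /eqP ->.
by congr (_ * _)%E; apply: eq_bigr => i _; exact: (cps_law H).
Qed.

(** Rectangles suffice by [product_prob_unique].  A condition on the jump xi_n can be
    counted as part of the event on future jumps, to which the independence of
    [walk n] applies. *)
Lemma walk_future_step n : (forall t A r B C, 0 <= t ->
    (forall i, measurable (B i)) -> uniq r -> all (leq n) r -> measurable C ->
    (P (future t A r B `&` walk n @^-1` C) = P (future t A r B) * law n C)%E) ->
  forall t A r B C, 0 <= t -> (forall i, measurable (B i)) -> uniq r ->
    all (leq n.+1) r -> measurable C ->
  (P (future t A r B `&` (fun w => (walk n w, xi n w)) @^-1` C) =
   P (future t A r B) * (law n \x nu) C)%E.
Proof.
move=> IH t A r B C t0 mB ur nr mC.
have mU := measurable_future A r t0 mB.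
have mS := measurable_step n.
set U := future t A r B in mU *.
have PU : P U \is a fin_num by exact: fin_num_measure.
have := @product_prob_unique _ _ _ _ _ (law n) nu (pushm (mrestr P mU) mS) (fine (P U)).
rewrite fineK// => /(_ _ _ _ C mC) h.
rewrite setIC; apply: h.
- exact: fine_ge0.
- by change (P (setT `&` U) <= P U)%E; rewrite setTI.
move=> A1 B1 mA1 mB1.
change (P ((fun w => (walk n w, xi n w)) @^-1` (A1 `*` B1) `&` U) =
  P U * (law n A1 * nu B1))%E.
pose B' i := if i == n then B1 else B i.
have mB' i : measurable (B' i) by rewrite /B'; case: ifP.
have nr' : n \notin r.
  by apply/negP => nr''; have /allP/(_ _ nr'') := nr; rewrite ltnn.
have EB : \bigcap_(i in [set` r]) xi i @^-1` B' i =
          \bigcap_(i in [set` r]) xi i @^-1` B i.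
  apply: eq_bigcapr => i /= ir; rewrite /B'; case: eqP => // ni.
  by move: nr'; rewrite -ni ir.
have -> : (fun w => (walk n w, xi n w)) @^-1` (A1 `*` B1) `&` U =
    future t A (n :: r) B' `&` walk n @^-1` A1.
  rewrite /U /future -EB !bigcap_seq big_cons.
  have -> : B' n = B1 by rewrite /B' eqxx.
  by apply/seteqP; split=> w /=; tauto.
rewrite IH//=; last by rewrite leqnn; apply: sub_all nr => i; exact: ltnW.
rewrite /U !future_prob//=; last by rewrite nr'.
rewrite big_cons {1}/B' eqxx.
have -> : (\prod_(j <- r) nu (B' j) = \prod_(j <- r) nu (B j))%E.
  apply: eq_big_seq => i ir; rewrite /B'; case: eqP => // ni.
  by move: nr'; rewrite -ni ir.
rewrite -!muleA; congr (_ * _)%E.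
by rewrite muleCA; congr (_ * _)%E; rewrite muleC.
by rewrite nr'.
Qed.

Let poisson_all (t : R) : future t setT [::] (fun=> setT) = setT.
Proof.
by rewrite /future preimage_setT setTI set_nil bigcap_set0.
Qed.

Lemma walkS n w : walk n.+1 w = walk n w + xi n w.
Proof. by rewrite /walk big_ord_recr /= addrA. Qed.

Let madd : measurable_fun setT (fun z : V * V => z.1 + z.2).
Proof. exact: measurable_rVD. Qed.

Lemma walk_future n : forall t A r B C, 0 <= t ->
  (forall i, measurable (B i)) -> uniq r -> all (leq n) r -> measurable C ->
  (P (future t A r B `&` walk n @^-1` C) = P (future t A r B) * law n C)%E.
Proof.
elim: n => [|n IH] t A r B C t0 mB ur nr mC.
  rewrite lawE; have [Cx|Cx] := pselect (C x).
    have -> : walk 0 @^-1` C = setT.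
      by apply/seteqP; split => // w _; rewrite /walk/= big_ord0 addr0.
    by rewrite setIT [X in (_ * X)%E]probability_setT mule1.
  have -> : walk 0 @^-1` C = set0.
    by apply/seteqP; split => // w; rewrite /walk/= big_ord0 addr0.
  by rewrite setI0 measure0 mule0.
pose C' := (fun z : V * V => z.1 + z.2) @^-1` C.
have mC' : measurable C' by rewrite -[X in measurable X]setTI; exact: madd.
have E : walk n.+1 @^-1` C = (fun w => (walk n w, xi n w)) @^-1` C'.
  by apply/seteqP; split => w /=; rewrite /C' /= walkS.
have step := walk_future_step IH.
rewrite lawE E step//.
have := step 0 setT [::] (fun=> setT) C'; rewrite poisson_all setTI probability_setT.
by rewrite mul1e => ->.
Qed.

Lemma law_step n C : measurable C ->
  P ((fun w => (walk n w, xi n w)) @^-1` C) = (law n \x nu)%E C.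
Proof.
move=> mC.
have := walk_future_step (@walk_future n) (t := 0) setT (r := [::]) (B := fun=> setT).
rewrite poisson_all probability_setT => /(_ C).
by rewrite setTI mul1e => ->.
Qed.

Lemma poisson_walk t n k C : 0 <= t -> measurable C ->
  (P (N t @^-1` [set k] `&` walk n @^-1` C) = P (N t @^-1` [set k]) * law n C)%E.
Proof.
move=> t0 mC.
have := @walk_future n t [set k] [::] (fun=> setT) C t0 (fun=> measurableT) isT isT mC.
by rewrite /future set_nil bigcap_set0 setIT.
Qed.

Lemma integral_lawS n (g : V -> \bar R) : measurable_fun setT g ->
  (forall v, 0 <= g v)%E ->
  (\int[law n.+1]_v g v = \int[law n]_v \int[nu]_h g (v + h)%R)%E.
Proof.
move=> mg g0; rewrite integral_image_law//.
have mga : measurable_fun setT (fun z : V * V => g (z.1 + z.2)).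
  exact: measurableT_comp.
rewrite -(fubini_tonelli1 (fun z : V * V => g (z.1 + z.2)))//.
have -> : (\int[law n \x nu]_z g (z.1 + z.2)%R =
    \int[pushm P (measurable_step n)]_z g (z.1 + z.2)%R)%E.
  by apply: eq_measure_integral => A mA _; exact/esym/law_step.
rewrite ge0_integral_pushforward//=; last exact: measurable_step.
by apply: eq_integral => w _; rewrite walkS.
Qed.

Lemma integral_law0 (g : V -> \bar R) : measurable_fun setT g ->
  (forall v, 0 <= g v)%E -> (\int[law 0]_v g v = g x)%E.
Proof.
move=> mg g0; rewrite integral_image_law//.
under eq_integral do rewrite /walk big_ord0 addr0.
by rewrite integral_cst_prob.
Qed.

Lemma integral_law_iter n f : bounded_L1p f ->
  (\int[law n]_v (f v)%:E = (iter n (avg nu) f x)%:E)%E.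
Proof.
elim: n f => [|n IH] f gf.
  rewrite integral_law0//; first by apply/measurable_EFinP; exact: bL1_meas.
  by move=> v; rewrite lee_fin (bL1_ge0 gf).
rewrite integral_lawS.
- under eq_integral do rewrite -avgE//.
  by rewrite IH ?iterSr//; exact: bL1_avg.
- by apply/measurable_EFinP; exact: bL1_meas.
- by move=> v; rewrite lee_fin (bL1_ge0 gf).
Qed.

End walk.

Lemma ge0_integral_mrestr d (T : measurableType d) (R : realType)
    (mu : {measure set T -> \bar R}) (D : set T) (mD : measurable D)
    (f : T -> \bar R) : measurable_fun setT f -> (forall x, 0 <= f x)%E ->
  (\int[mrestr mu mD]_x f x = \int[mu]_(x in D) f x)%E.
Proof.
move=> mf f0; have mDc := measurableC mD.
rewrite -(setUv D) ge0_integral_setU//; last 2 first.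
- by rewrite setUv.
- by apply/disj_setPS => w []//.
rewrite [X in (_ + X)%E](_ : _ = 0%E) ?adde0.
  apply: eq_measure_integral => A mA AD; change (mu (A `&` D) = mu A); congr (mu _).
  exact: setIidl.
rewrite -(integral_measure_zero (~` D) f); apply: eq_measure_integral => A mA AD.
have AD0 : A `&` D = set0 by apply/seteqP; split=> // w [/AD].
by change (mu (A `&` D) = 0)%E; rewrite AD0 measure0.
Qed.

Lemma measurable_nat_select d d' (T : measurableType d) (T' : measurableType d')
    (K : T -> nat) (F : nat -> T -> T') :
  (forall n, measurable (K @^-1` [set n])) ->
  (forall n, measurable_fun setT (F n)) ->
  measurable_fun setT (fun w => F (K w) w).
Proof.
move=> mK mF _ B mB; rewrite setTI.
have -> : (fun w => F (K w) w) @^-1` B =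
    \bigcup_n (K @^-1` [set n] `&` F n @^-1` B).
  apply/seteqP; split => [w /= BF|w [n _ [/= <- //]]].
  by exists (K w).
apply: bigcupT_measurable => n; apply: measurableI => //.
by rewrite -[X in measurable X]setTI; exact: mF.
Qed.

Section at_time.
Context (R : realType) (dO : measure_display) (Omega : measurableType dO).
Context (P : probability Omega R) (d : nat) (x : 'rV[R]_d) (lambda : R).
Context (nu : probability 'rV[R]_d R) (N : R -> Omega -> nat).
Context (xi : nat -> Omega -> 'rV[R]_d) (X : R -> Omega -> 'rV[R]_d).
Context (H : compound_poisson_sum P x lambda nu N xi X).
Local Notation V := 'rV[R]_d.
Local Notation walk := (walk x xi).
Local Notation law := (law H).

Lemma X_walk t w : 0 <= t -> X t w = walk (N t w) w.
Proof. by move=> t0; rewrite (cps_sum H). Qed.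

Lemma measurable_count t n : 0 <= t -> measurable (N t @^-1` [set n]).
Proof.
move=> t0; rewrite -[X in measurable X]setTI.
by apply: (poisson_measurable (cps_poisson H)).
Qed.

Lemma measurable_X t : 0 <= t -> measurable_fun setT (X t).
Proof.
move=> t0; rewrite (_ : X t = fun w => walk (N t w) w); last first.
  by apply/funext => w; exact: X_walk.
apply: measurable_nat_select => n; first exact: measurable_count.
exact: (measurable_walk H).
Qed.

Lemma int_walk_on t n (g : V -> \bar R) : 0 <= t -> measurable_fun setT g ->
  (forall v, 0 <= g v)%E ->
  (\int[P]_(w in N t @^-1` [set n]) g (walk n w) =
   P (N t @^-1` [set n]) * \int[law n]_v g v)%E.
Proof.
move=> t0 mg g0; have mD := measurable_count n t0.
have mw := measurable_walk H n.
rewrite -(ge0_integral_mrestr _ mD)//; last exact: measurableT_comp.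
have PD : P (N t @^-1` [set n]) \is a fin_num by exact: fin_num_measure.
have p0 : 0 <= fine (P (N t @^-1` [set n])) by exact: fine_ge0.
transitivity (\int[mscale (NngNum p0) (law n)]_v g v)%E; last first.
  by rewrite ge0_integral_mscale//= fineK.
transitivity (\int[pushm (mrestr P mD) mw]_v g v)%E.
  by rewrite ge0_integral_pushforward// preimage_setT.
apply: eq_measure_integral => C mC _.
change (P (walk n @^-1` C `&` N t @^-1` [set n]) =
  (fine (P (N t @^-1` [set n])))%:E * law n C)%E.
by rewrite fineK// setIC (poisson_walk H).
Qed.

Lemma count_prob t n : 0 < t ->
  P (N t @^-1` [set n]) = (poisson_pmf (lambda * t) n)%:E.
Proof.
move=> t0; have := poisson_increment_law (cps_poisson H) n (lexx 0) t0.
rewrite subr0 => <-; congr (P _); apply/seteqP; split => w /=;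
by rewrite (poisson_start (cps_poisson H)) subn0.
Qed.

(** Conditioning on the number of jumps up to time t. *)
Lemma expectation_X t (g : V -> \bar R) : 0 < t -> measurable_fun setT g ->
  (forall v, 0 <= g v)%E ->
  (\int[P]_w g (X t w) =
   \sum_(n <oo) (poisson_pmf (lambda * t) n)%:E * \int[law n]_v g v)%E.
Proof.
move=> t0 mg g0; have t0' := ltW t0.
have mX := measurable_X t0'.
have E : \bigcup_n (N t @^-1` [set n]) = setT.
  by apply/seteqP; split => // w _; exists (N t w).
rewrite -{1}E ge0_integral_bigcup//.
- apply: eq_eseriesr => n _; rewrite -count_prob// -int_walk_on//.
  by apply: eq_integral => w; rewrite inE/= => Nn; rewrite X_walk// Nn.
- by move=> n; exact: measurable_count.
- by rewrite E; exact: measurableT_comp.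
- by apply/trivIsetP => i j _ _ ij; apply/seteqP; split=> // w [/= -> /eqP]; rewrite (negbTE ij).
Qed.

Lemma integral_law1 (g : V -> \bar R) : measurable_fun setT g ->
  (forall v, 0 <= g v)%E ->
  (\int[law 1]_v g (v - x)%R = \int[nu]_h g h)%E.
Proof.
move=> mg g0; have mg' : measurable_fun setT (fun v : V => g (v - x)%R).
  by apply: measurableT_comp => //; exact: measurable_rVB.
rewrite (integral_lawS H 0 (g := fun v : V => g (v - x)%R))//.
rewrite (integral_law0 H (g := fun v : V => (\int[nu]_h g (v + h - x)%R)%E)).
- by apply: eq_integral => h _; rewrite addrAC subrr add0r.
- apply: (measurable_fun_fubini_tonelli_F (fun z : V * V => g (z.1 + z.2 - x)%R)) => //.
  by apply: measurableT_comp => //; apply: measurable_rVB => //; exact: measurable_rVD.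
- by move=> v; apply: integral_ge0.
Qed.

End at_time.

(** * Approximation of open sets, densities, dominated convergence *)

Section open_approx.
Context (R : realType) (V : normedModType R) (U : set V).

Definition dist_compl (u : V) : R := inf [set `|u - v| | v in ~` U].

Let lb (u : V) : has_lbound [set `|u - v| | v in ~` U].
Proof. by exists 0 => _ [v _ <-]. Qed.

Lemma dist_compl_ge0 u : 0 <= dist_compl u.
Proof.
have [E0|/set0P nE] := eqVneq [set `|u - v| | v in ~` U] set0.
  by rewrite /dist_compl E0 inf0.
by apply: lb_le_inf => // _ [v _ <-].
Qed.

Lemma dist_compl_lip u v : dist_compl u <= `|u - v| + dist_compl v.
Proof.
have [[c Uc]|E] := pselect ((~` U) !=set0); last first.
  have E0 : ~` U = set0 by apply/seteqP; split=> // c Uc; case: E; exists c.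
  by rewrite /dist_compl E0 !image_set0 inf0 addr0.
rewrite -lerBlDl; apply: lb_le_inf.
  by exists `|v - c|; exists c.
move=> _ [w Uw <-]; rewrite lerBlDl.
apply: (@le_trans _ _ `|u - w|); first by apply: ge_inf => //; exists w.
by rewrite -[u - w](subrKA v); exact: ler_normD.
Qed.

Lemma dist_compl_continuous : continuous dist_compl.
Proof.
move=> u; apply/cvgrPdist_lt => e e0.
have : \forall v \near u, ball u e v by exact: nbhsx_ballx.
apply: filterS => v; rewrite -ball_normE /= => uv.
rewrite ltr_norml; apply/andP; split.
  rewrite ltrBrDr addrC ltrBlDr.
  by apply: (le_lt_trans (dist_compl_lip v u)); rewrite distrC addrC ltrD2l.
rewrite ltrBlDr; apply: (le_lt_trans (dist_compl_lip u v)).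
by rewrite ltrD2r.
Qed.

Lemma dist_compl0 u : ~ U u -> dist_compl u = 0.
Proof.
move=> Uu; apply/eqP; rewrite eq_le dist_compl_ge0 andbT.
by apply: ge_inf => //; exists u => //; rewrite subrr normr0.
Qed.

Lemma dist_compl_gt0 u : open U -> (~` U) !=set0 -> U u -> 0 < dist_compl u.
Proof.
move=> oU [c Uc] Uu.
have [r /= r0 rU] : exists2 r : R, 0 < r & ball u r `<=` U.
  have : nbhs u U by apply: open_nbhs_nbhs.
  by rewrite -nbhs_ballE => -[r /= r0 rU]; exists r.
apply: (lt_le_trans r0); apply: lb_le_inf; first by exists `|u - c|, c.
move=> _ [v Uv <-]; rewrite leNgt; apply/negP => uv.
by apply: Uv; apply: rU; rewrite -ball_normE.
Qed.

(** The functions min(1, k dist(u, complement of U)) converge to the indicator of U.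
    If U is the whole space, the distance is the infimum of an empty set and has the
    wrong value 0; the constant function 1 is taken instead. *)
Lemma open_approx : open U -> exists f : nat -> V -> R,
  [/\ forall k, continuous (f k), forall k u, 0 <= f k u <= 1,
      forall k u, ~ U u -> f k u = 0 &
      forall u, f k u @[k --> \oo] --> (\1_U u : R)].
Proof.
move=> oU; have [nE|E] := pselect ((~` U) !=set0); last first.
  have UT : U = setT.
    by apply/seteqP; split=> // c _; apply: contrapT => Uc; apply: E; exists c.
  exists (fun _ _ => 1); split => //.
  - by move=> k u; exact: cst_continuous.
  - by move=> k u; rewrite ler01 lexx.
  - by move=> k u; rewrite UT => /(_ I).
  - by move=> u; rewrite UT indicT; exact: cvg_cst.
exists (fun k u => Num.min 1 (k%:R * dist_compl u)); split.
- move=> k u.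
  apply: (@continuous_min _ _ (fun=> 1) (fun u => k%:R * dist_compl u)).
    exact: cst_continuous.
  by apply: continuousM; [exact: cst_continuous|exact: dist_compl_continuous].
- by move=> k u; rewrite le_min ler01 mulr_ge0 ?dist_compl_ge0// ge_min lexx.
- by move=> k u Uu; rewrite dist_compl0// mulr0 min_r.
move=> u; have [Uu|Uu] := pselect (U u); last first.
  rewrite indicE memNset//=; under eq_fun do rewrite dist_compl0// mulr0 min_r//.
  exact: cvg_cst.
rewrite indicE mem_set//=; apply: cvg_near_cst.
have D0 := dist_compl_gt0 oU nE Uu.
near=> k; rewrite min_l// -ler_pdivrMr//.
by near: k; exact: nbhs_infty_ger.
Unshelve. all: by end_near. Qed.

End open_approx.

Section density.
Context d (T : measurableType d) (R : realType).
Context (mu : {sigma_finite_measure set T -> \bar R}) (nu : probability T R).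
Context (a : T -> R) (ma : measurable_fun setT a) (a0 : forall t, 0 <= a t).
Local Open Scope ereal_scope.

(** The density a is almost everywhere the Radon-Nikodym derivative, for which the
    formula is known. *)
Lemma integral_density (g : T -> \bar R) :
  (forall B, measurable B -> nu B = \int[mu]_(t in B) (a t)%:E) ->
  measurable_fun setT g -> (forall t, 0 <= g t) ->
  \int[nu]_t g t = \int[mu]_t ((a t)%:E * g t).
Proof.
move=> nuE mg g0.
have mE : measurable_fun setT (fun t => (a t)%:E) by exact/measurable_EFinP.
have dom : nu `<< mu.
  apply/null_content_dominatesP => A mA A0; rewrite nuE//.
  by apply: null_set_integral => //; exact: measurable_funTS.
have ia : mu.-integrable setT (fun t => (a t)%:E).
  apply/integrableP; split => //.
  under eq_integral do rewrite gee0_abs ?lee_fin//.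
  by rewrite -nuE// probability_setT ltry.
rewrite -(Radon_Nikodym_SigmaFinite.change_of_variables dom)//.
apply: ae_eq_integral => //.
- apply: emeasurable_funM => //.
  exact: (measurable_int _ (Radon_Nikodym_SigmaFinite.f_integrable dom)).
- exact: emeasurable_funM.
have : ae_eq mu setT (Radon_Nikodym_SigmaFinite.f nu mu) (fun t => (a t)%:E).
  apply: integral_ae_eq => //; first exact: Radon_Nikodym_SigmaFinite.f_integrable.
  move=> E _ mE'; transitivity (nu E); last exact: nuE.
  exact/esym/Radon_Nikodym_SigmaFinite.f_integral.
by apply: filterS => t h Tt; rewrite h// muleC.
Qed.

End density.

Lemma dominated_cvgT d (T : measurableType d) (R : realType) (mu : {measure set T -> \bar R})
    (f_ : nat -> T -> \bar R) (f g : T -> \bar R) :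
  (forall n, measurable_fun setT (f_ n)) -> measurable_fun setT f ->
  (forall t, f_ n t @[n --> \oo] --> f t) ->
  mu.-integrable setT g -> (forall n t, (`|f_ n t| <= g t)%E) ->
  [/\ mu.-integrable setT f,
   (\int[mu]_t `|f_ n t - f t| @[n --> \oo] --> 0)%E &
   (\int[mu]_t f_ n t @[n --> \oo] --> \int[mu]_t f t)%E].
Proof.
move=> mf_ mf cf ig fg.
have [] := @dominated_convergence _ _ _ mu setT measurableT f_ f g mf_ mf _ ig _.
- exact/aeW.
- by apply/aeW.
- by [].
Qed.

Lemma bounded_funE (T : Type) (R : realType) (f : T -> R) :
  bounded_fun f <-> exists M, forall t, `|f t| <= M.
Proof.
split=> [[M [_ fM]]|[M fM]].
  by exists (M + 1) => t; apply: fM => //; rewrite ltrDl.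
exists M; split; first exact: num_real.
by move=> y My t _; exact: le_trans (fM t) (ltW My).
Qed.

(** * The jump rate and the jump law, from the generator *)

Section generator.
Context (R : realType) (dO : measure_display) (Omega : measurableType dO).
Context (P : probability Omega R) (d : nat) (x : 'rV[R]_d) (lambda : R).
Context (nu : probability 'rV[R]_d R) (N : R -> Omega -> nat).
Context (xi : nat -> Omega -> 'rV[R]_d) (X : R -> Omega -> 'rV[R]_d).
Context (H : compound_poisson_sum P x lambda nu N xi X).
Local Notation V := 'rV[R]_d.
Local Notation leb := (lebesgue_rV R d).
Context (a : V -> R) (ca : continuous a) (a0 : forall u, 0 <= a u).
Context (aN : forall u, a (- u) = a u) (a1 : (\int[leb]_y (a y)%:E = 1)%E).
Context (Hgen : has_generator P x X (jump_operator a)).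
Context (d0 : (0 < d)%N).

Let ma : measurable_fun setT a. Proof. exact: continuous_measurable_rV. Qed.
Let mEa : measurable_fun setT (fun u => (a u)%:E).
Proof. exact/measurable_EFinP. Qed.

Lemma poisson_small (s : R) : 0 < s -> [/\ poisson_pmf s 0 = expR (- s),
  poisson_pmf s 1 = s * expR (- s), 1 - s <= expR (- s) & expR (- s) <= 1].
Proof.
move=> s0; rewrite /poisson_pmf s0; split.
- by rewrite expr0 fact0 invr1 !mul1r.
- by rewrite expr1 factS fact0 mul1n invr1 mulr1.
- by have := expR_ge1Dx (- s).
- by rewrite -expR0 ler_expR oppr_le0 ltW.
Qed.

(** Up to time t there are no jumps, one jump or at least two, the last with
    probability at most (lambda t)^2.  As f vanishes at 0, the first case contributes
    nothing, and one jump contributes lambda t e^(- lambda t) times the mean of f. *)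
Lemma small_time (f : V -> R) (t : R) : measurable_fun setT f ->
  (forall u, 0 <= f u <= 1) -> f 0 = 0 -> 0 < t ->
  `| t^-1 * transition P x X t f 0 - lambda * \int[nu]_h f h | <= 2 * lambda ^+ 2 * t.
Proof.
move=> mf f01 f0 t0; have t0' := ltW t0.
have l0 := cps_rate H.
have fge u : 0 <= f u by have /andP[] := f01 u.
have fle u : f u <= 1 by have /andP[] := f01 u.
have mfE : measurable_fun setT (fun u => (f u)%:E) by exact/measurable_EFinP.
set m := \int[nu]_h f h.
have mE : (\int[nu]_h (f h)%:E = m%:E)%E.
  rewrite fineK// ge0_fin_numE; last by apply: integral_ge0 => u _; rewrite lee_fin.
  by apply: (@le_lt_trans _ _ 1%:E); [exact: integral_prob_le|exact: ltry].
have m0 : 0 <= m.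
  by rewrite -lee_fin -mE; apply: integral_ge0 => u _; rewrite lee_fin.
have m1 : m <= 1 by rewrite -lee_fin -mE; exact: integral_prob_le.
pose g w : R := f (X t w - x).
have mg : measurable_fun setT (fun w => (g w)%:E).
  apply: (measurableT_comp mfE); apply: measurable_rVB => //.
  exact: (measurable_X H t0').
have g0 w : (0 <= (g w)%:E)%E by rewrite lee_fin; exact: fge.
pose T := transition P x X t f 0.
have TE : (\int[P]_w (g w)%:E = T%:E)%E.
  rewrite /T /transition /Rintegral.
  under [in RHS]eq_integral do rewrite add0r.
  rewrite fineK// ge0_fin_numE; last by apply: integral_ge0 => w _; exact: g0.
  apply: (@le_lt_trans _ _ 1%:E); last exact: ltry.
  by apply: integral_prob_le => //; exact/measurable_EFinP.
have [p0 p1 e1 e2] := poisson_small (mulr_gt0 l0 t0).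
set s := lambda * t in p0 p1 e1 e2; set e := expR (- s) in p0 p1 e1 e2.
pose D k := N t @^-1` [set k].
have mD k : measurable (D k) by exact: (measurable_count H k t0').
have mD2 : measurable (~` (D 0%N `|` D 1%N)).
  by apply: measurableC; exact: measurableU.
have D01 : [disjoint D 0%N & D 1%N].
  by apply/disj_setPS => w []; rewrite /D/= => ->.
have PD k : P (D k) = (poisson_pmf s k)%:E by exact: (count_prob H).
have PU : P (D 0%N `|` D 1%N) = (e + s * e)%:E.
  transitivity (P (D 0%N) + P (D 1%N))%E; last by rewrite !PD p0 p1.
  by apply: measureU => //; exact/disj_set2P.
have PD2 : P (~` (D 0%N `|` D 1%N)) = (1 - (e + s * e))%:E.
  by rewrite probability_setC ?PU//; exact: measurableU.
have := TE; rewrite -(setvU (D 0%N `|` D 1%N)) setUC.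
rewrite ge0_integral_setU//; last 3 first.
- exact: measurableU.
- by rewrite setUv.
- by apply/disj_setPS => w [].
rewrite ge0_integral_setU//; last exact: measurable_funTS.
have -> : (\int[P]_(w in D 0%N) (g w)%:E = 0)%E.
  apply: integral0_eq => w Dw.
  by rewrite /g (X_walk H)// Dw /walk big_ord0 addr0 subrr f0.
have -> : (\int[P]_(w in D 1%N) (g w)%:E = (s * e * m)%:E)%E.
  transitivity (\int[P]_(w in D 1%N) (f (walk x xi 1 w - x))%:E)%E.
    by apply: eq_integral => w; rewrite inE => Dw; rewrite /g (X_walk H)// Dw.
  rewrite (int_walk_on H 1 (g := fun v : V => (f (v - x))%:E))//.
  - rewrite (integral_law1 H (g := fun v : V => (f v)%:E))//.
    by rewrite [P _]PD p1 mE -EFinM.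
  - by apply: (measurableT_comp mfE); exact: measurable_rVB.
  - by move=> v; rewrite lee_fin.
set r := (\int[P]_(w in ~` _) _)%E.
have r0 : (0 <= r)%E by apply: integral_ge0 => w _; exact: g0.
have r1 : (r <= (1 - (e + s * e))%:E)%E.
  rewrite -PD2 -[leRHS]mul1e -integral_cst//; apply: ge0_le_integral => //.
    exact: measurable_funTS.
  by move=> w _; rewrite lee_fin; exact: fle.
rewrite add0e; case: r r0 r1 => [r| |]//; rewrite !lee_fin => r0 r1.
rewrite -EFinD => -[TEE]; rewrite -/T -TEE.
have tn0 : t != 0 by rewrite gt_eqF.
rewrite (_ : _ - _ = r / t - lambda * m * (1 - e)); last first.
  by rewrite /s; field.
have q0 : 0 <= r / t by rewrite divr_ge0.
have q1 : r / t <= lambda ^+ 2 * t.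
  rewrite ler_pdivrMr// (le_trans r1)// (_ : lambda ^+ 2 * t * t = s ^+ 2); last first.
    by rewrite /s; ring.
  have s0 : 0 <= s by rewrite mulr_ge0// ltW.
  have := ler_wpM2l s0 e1; rewrite mulrBr mulr1 -expr2; lra.
have c0 : 0 <= lambda * m * (1 - e).
  by rewrite !mulr_ge0 ?subr_ge0// ltW.
have c1 : lambda * m * (1 - e) <= lambda ^+ 2 * t.
  rewrite (_ : lambda ^+ 2 * t = lambda * s); last by rewrite /s; ring.
  rewrite -mulrA ler_pM2l//.
  apply: (@le_trans _ _ (1 - e)); last by lra.
  by rewrite ler_piMl// subr_ge0.
by rewrite ler_norml; apply/andP; split; lra.
Qed.

Let fin_prob_le1 (f : V -> R) : measurable_fun setT f ->
  (forall u, 0 <= f u <= 1) ->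
  (\int[nu]_h (f h)%:E = (\int[nu]_h f h)%:E /\
   \int[leb]_u (a u * f u)%:E = (\int[leb]_u (a u * f u))%:E)%E.
Proof.
move=> mf f01.
have fge u : 0 <= f u by have /andP[] := f01 u.
have fle u : f u <= 1 by have /andP[] := f01 u.
split; rewrite fineK// ge0_fin_numE.
- by apply: (@le_lt_trans _ _ 1%:E); [exact: integral_prob_le|exact: ltry].
- by apply: integral_ge0 => u _; rewrite lee_fin.
- apply: (@le_lt_trans _ _ (1%:E)); last exact: ltry.
  rewrite -a1; apply: ge0_le_intT => //.
  + by move=> u; rewrite lee_fin mulr_ge0.
  + by apply/measurable_EFinP/measurable_funM.
  + by move=> u; rewrite lee_fin ler_piMr.
- by apply: integral_ge0 => u _; rewrite lee_fin mulr_ge0.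
Qed.

(** Since f(0) = 0 and a is even, the generator at 0 is the integral of a f; by
    [small_time] it is also lambda times the mean of f under nu. *)
Lemma generator_int (f : V -> R) : continuous f ->
  (forall u, 0 <= f u <= 1) -> f 0 = 0 ->
  (lambda%:E * \int[nu]_h (f h)%:E = \int[leb]_u (a u * f u)%:E)%E.
Proof.
move=> cf f01 f0; have mf := continuous_measurable_rV cf.
have [-> ->] := fin_prob_le1 mf f01.
rewrite -EFinM; congr EFin.
have JE : jump_operator a f 0 = \int[leb]_u (a u * f u).
  rewrite /jump_operator; congr fine; apply: eq_integral => u _.
  by rewrite sub0r aN f0 subr0.
have Cbf : Cb f.
  split => //; apply/bounded_funE; exists 1 => u.
  by have /andP[f1 f2] := f01 u; rewrite ger0_norm.
apply/eqP; rewrite -subr_eq0 -normr_le0; apply/ler_addgt0Pl => e e0.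
rewrite addr0 -JE.
have e20 : 0 < e / 2 by rewrite divr_gt0.
have l0 := cps_rate H.
have G := Hgen Cbf e20.
near (0:R)^'+ => t.
have t0 : 0 < t by near: t; exact: nbhs_right_gt.
have t1 : t < e / 2 / (2 * lambda ^+ 2).
  by near: t; apply: nbhs_right_lt; rewrite divr_gt0// mulr_gt0// exprn_gt0.
have Gt : forall u, `|t^-1 * (transition P x X t f u - f u) - jump_operator a f u| <= e / 2.
  by near: t.
have := Gt 0; rewrite f0 subr0 => h1.
have h2 := small_time mf f01 f0 t0.
have h3 : 2 * lambda ^+ 2 * t <= e / 2.
  by rewrite mulrC -ler_pdivlMr ?ltW// mulr_gt0// exprn_gt0.
rewrite (splitr e).
rewrite distrC in h2.
rewrite -[X in `|X|](subrKA (t^-1 * transition P x X t f 0)).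
apply: (le_trans (ler_normD _ _)); rewrite lerD//.
exact: le_trans h3.
Unshelve. all: by end_near. Qed.

Lemma generator_open (U : set V) : open U -> ~ U 0 ->
  (lambda%:E * nu U = \int[leb]_(u in U) (a u)%:E)%E.
Proof.
move=> oU U0; have mU : measurable U by exact: sub_sigma_algebra.
have [f [cf f01 fU fcvg]] := open_approx oU.
have mf k : measurable_fun setT (f k) by exact: continuous_measurable_rV.
have mI : measurable_fun setT (fun u => (\1_U u : R)%:E).
  by apply/measurable_EFinP; exact: measurable_indic.
have c1 : (\int[nu]_h (f k h)%:E @[k --> \oo] --> \int[nu]_h (\1_U h)%:E)%E.
  have [] // := @dominated_cvgT _ _ _ nu (fun k h => (f k h)%:E) (fun h => (\1_U h)%:E) (cst 1%E).
  - by move=> k; exact/measurable_EFinP.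
  - by move=> u; apply/fine_cvgP; split; [exact/nearW|exact: fcvg].
  - apply/integrableP; split => //; rewrite integral_cst// normr1.
    by rewrite [X in (_ * X)%E]probability_setT mule1 ltry.
  - move=> k u; have /andP[f1 f2] := f01 k u.
    by rewrite gee0_abs ?lee_fin.
have c2 : (\int[leb]_h (a h * f k h)%:E @[k --> \oo] --> \int[leb]_h (a h * \1_U h)%:E)%E.
  have [] // := @dominated_cvgT _ _ _ leb (fun k h => (a h * f k h)%:E)
    (fun h => (a h * \1_U h)%:E) (fun h => (a h)%:E).
  - by move=> k; apply/measurable_EFinP/measurable_funM.
  - by apply/measurable_EFinP/measurable_funM.
  - move=> u; apply/fine_cvgP; split; first exact/nearW.
    by apply: cvgM; [exact: cvg_cst|exact: fcvg].
  - apply/integrableP; split => //.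
    by under eq_integral do rewrite gee0_abs ?lee_fin//; rewrite a1 ltry.
  - move=> k u; have /andP[f1 f2] := f01 k u.
    by rewrite gee0_abs ?lee_fin ?mulr_ge0// ler_piMr.
have c1' : (lambda%:E * \int[nu]_h (f k h)%:E @[k --> \oo] -->
    lambda%:E * \int[nu]_h (\1_U h)%:E)%E by apply: cvgeZl.
have E k : (lambda%:E * \int[nu]_h (f k h)%:E = \int[leb]_h (a h * f k h)%:E)%E.
  by apply: generator_int => //; apply: fU.
rewrite (eq_cvg _ _ E) in c1'.
have := cvg_unique _ c1' c2; rewrite integral_indic// setIT => -> //.
rewrite [RHS]integral_mkcond; apply: eq_integral => u _.
by rewrite patchE indicE; case: ifPn => _; rewrite ?mulr1 ?mulr0.
Qed.

Lemma lebesgue_rV_set1 (b : V) : lebesgue_rV R d [set b] = 0%E.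
Proof.
have -> : [set b] = [set v | forall i, [set b ord0 i] (v ord0 i)].
  apply/seteqP; split => [v -> //|v /= h]; apply/rowP => i; exact: h.
rewrite (lebesgue_rV_box (A := fun i => [set b ord0 i]))//.
by case: d d0 b => // n _ b; rewrite big_ord_recl lebesgue_measure_set1 mul0e.
Qed.

(** By [generator_open], lambda nu and a(u) du agree on open sets that avoid the
    origin.  The origin is null for both: for nu by the normalization in the
    definition of the process, for Lebesgue measure because d > 0.  The total masses
    give lambda = 1, and Dynkin's lemma extends the equality to Borel sets. *)
Lemma generator_law : lambda = 1 /\
  forall B, measurable B -> (nu B = \int[leb]_(u in B) (a u)%:E)%E.
Proof.
pose O := [set (0 : V)].
have o0 : open (~` O).
  by apply: closed_openC; apply: accessible_closed_set1; exact: hausdorff_accessible.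
have mC0 : measurable (~` O) by exact: sub_sigma_algebra.
have m0 : measurable O by rewrite -(setCK O); exact: measurableC.
have split0 (S : set V) : measurable S ->
    (nu S = nu (S `&` ~` O) /\
     \int[leb]_(u in S) (a u)%:E = \int[leb]_(u in S `&` ~` O) (a u)%:E)%E.
  move=> mS; have mS1 : measurable (S `&` ~` O) by exact: measurableI.
  have mS2 : measurable (S `&` O) by exact: measurableI.
  have E : S = (S `&` ~` O) `|` (S `&` O) by rewrite -setIUr setvU setIT.
  have dj : [disjoint (S `&` ~` O) & (S `&` O)].
    by apply/disj_setPS => u [[_ h] [_ h']].
  split.
    rewrite {1}E measureU//; last exact/disj_set2P.
    rewrite [X in (_ + X)%E](_ : _ = 0%E) ?adde0//.
    apply/eqP; rewrite eq_le measure_ge0 andbT -(cps_jump_neq0 H).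
    by apply: le_measure; rewrite ?inE.
  rewrite {1}E ge0_integral_setU//; last first.
  + by move=> u _; rewrite lee_fin.
  + exact: measurable_funTS.
  rewrite [X in (_ + X)%E](_ : _ = 0%E) ?adde0//.
  apply: null_set_integral => //; first exact: measurable_funTS.
  apply/eqP; rewrite eq_le measure_ge0 andbT -(lebesgue_rV_set1 0).
  by apply: le_measure; rewrite ?inE.
have key U : open U -> (lambda%:E * nu U = \int[leb]_(u in U) (a u)%:E)%E.
  move=> oU; have mU : measurable U by exact: sub_sigma_algebra.
  have oU0 : open (U `&` ~` O) by exact: openI.
  have [-> ->] := split0 _ mU; apply: generator_open => //.
  by move=> [_ h]; exact: h.
have l1 : lambda = 1.
  have := key setT openT; rewrite probability_setT mule1 a1 => -[].
  by [].
split=> // B mB.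
have K U : open U -> (nu U = \int[leb]_(u in U) (a u)%:E)%E.
  by move=> /key; rewrite l1 mul1e.
apply: (dynkin_induction (G := @open V)
  (P := fun B => nu B = \int[leb]_(u in B) (a u)%:E)%E) => //.
- exact: openI.
- by rewrite probability_setT a1.
- move=> S mS ES; rewrite probability_setC// ES -a1 -(setvU S).
  have I0 : (0 <= \int[leb]_(u in S) (a u)%:E)%E.
    by apply: integral_ge0 => u _; rewrite lee_fin.
  have mSc := measurableC mS.
  have dj : [disjoint ~` S & S] by apply/disj_setPS => u [].
  rewrite ge0_integral_setU//; last first.
  + by move=> u _; rewrite lee_fin.
  + exact: measurable_funTS.
  by rewrite addeK// -ES; exact: fin_num_measure.
- move=> F mF tF EF; rewrite measure_bigcup//.
  rewrite ge0_integral_bigcup//.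
  + rewrite (eq_eseriesl (Q := xpredT)); last by move=> k; rewrite in_setT.
    by apply: eq_eseriesr => k _; exact: EF.
  + exact: measurable_funTS.
  + by move=> u _; rewrite lee_fin.
Qed.

End generator.

(** * The Green measure *)

Section poisson_time.
Context (R : realType).
Local Notation leb := (@lebesgue_measure R).

Let q n (t : R) : R := t ^+ n * n`!%:R^-1 * expR (- t).

Let q0 n t : 0 <= t -> 0 <= q n t.
Proof. by move=> t0; rewrite /q !mulr_ge0// ?expR_ge0// exprn_ge0. Qed.

Let Dexp (t : R) : is_derive t 1 (fun s => expR (- s)) (- expR (- t)).
Proof. by apply: is_derive_eq; rewrite mulrN1. Qed.

Let Dq0 (t : R) : is_derive t 1 (q 0) (- q 0 t).
Proof.
rewrite (_ : q 0 = (fun s => expR (- s))); last first.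
  by apply/funext => s; rewrite /q expr0 fact0 invr1 !mul1r.
exact: Dexp.
Qed.

Let Dq n (t : R) : is_derive t 1 (q n.+1) (q n t - q n.+1 t).
Proof.
have Dp : is_derive t 1 (fun s : R => s ^+ n.+1) (n.+1%:R * t ^+ n).
  have := is_deriveX n.+1 (is_derive_id t 1); rewrite /= => D.
  have E : ((id : R -> R) ^+ n.+1 = (fun s => s ^+ n.+1))%R.
    by apply/funext => s; rewrite exprfctE.
  by rewrite -E; apply: (is_derive_eq D); rewrite /GRing.scale/= mulr1.
have D := is_deriveM (is_deriveM Dp (is_derive_cst (n.+1`!%:R^-1 : R) t 1)) (Dexp t).
apply: (is_derive_eq D).
rewrite mulrfctE /GRing.scale/= mulr0 add0r /q factS natrM.
have h1 : n`!%:R != 0 :> R by rewrite pnatr_eq0 -lt0n fact_gt0.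
have h2 : n.+1%:R != 0 :> R by rewrite pnatr_eq0.
move: (n`!%:R : R) (n.+1%:R : R) h1 h2 => b c h1 h2.
by field; rewrite h1 h2.
Qed.

(** A primitive of the Poisson weight q n. *)
Let F n t : R := - \sum_(k < n.+1) q k t.

Let DF n (t : R) : is_derive t 1 (F n) (q n t).
Proof.
elim: n => [|n IH].
  rewrite (_ : F 0 = - q 0); last first.
    by apply/funext => s; rewrite /F big_ord1 !fctE.
  by apply: (is_derive_eq (is_deriveN (Dq0 t))); rewrite opprK.
rewrite (_ : F n.+1 = F n - q n.+1); last first.
  by apply/funext => s; rewrite /F big_ord_recr/= opprD !fctE.
apply: (is_derive_eq (is_deriveB IH (Dq n t))).
by rewrite opprB addrC subrK.
Qed.

Let cq n : continuous (q n).
Proof.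
move=> t; have D : derivable (q n) t 1.
  by case: n => [|n]; [case: (Dq0 t)|case: (Dq n t)].
by apply: differentiable_continuous; apply/derivable1_diffP.
Qed.

Let cF n : continuous (F n).
Proof.
move=> t; have D : derivable (F n) t 1 by case: (DF n t).
by apply: differentiable_continuous; apply/derivable1_diffP.
Qed.

Let int_q n (T : R) : 0 < T -> (\int[leb]_(t in `[0%R, T]) (q n t)%:E <= 1)%E.
Proof.
move=> T0; rewrite (continuous_FTC2 T0 (F := F n)).
- have S0 : \sum_(k < n.+1) q k 0 = 1.
    rewrite big_ord_recl [q _ 0]/q expr0 fact0 invr1 !mul1r oppr0 expR0.
    by rewrite big1 ?addr0// => i _; rewrite /q exprS !mul0r.
  rewrite -EFinB lee_fin /F opprK S0.
  by rewrite gerDr oppr_le0 sumr_ge0// => i _; exact/q0/ltW.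
- exact: continuous_subspaceT.
- split.
  + by move=> t _; case: (DF n t).
  + by apply: cvg_at_right_filter; exact: cF.
  + by apply: cvg_at_left_filter; exact: cF.
- by move=> t _; rewrite derive1E; case: (DF n t).
Qed.

Let mq n : measurable_fun setT (q n).
Proof. exact: continuous_measurable_fun. Qed.

Lemma integral_poisson_time n :
  (\int[leb]_(t in `[0%R, +oo[) (t ^+ n * n`!%:R^-1 * expR (- t))%:E <= 1)%E.
Proof.
rewrite -/(q n).
have itvE : `[0%R, +oo[%classic = \bigcup_k `[0%R, (k.+1%:R : R)]%classic :> set R.
  apply/seteqP; split => [t /=|t [k _]]; rewrite /= !in_itv/= ?andbT; last by case/andP.
  move=> t0; exists (Num.truncn t) => //=.
  by rewrite in_itv/= t0/= ltW//; have /andP[] := truncn_itv t0.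
have q00 k (t : R) : `[0, (k.+1%:R : R)]%classic t -> (0 <= (q n t)%:E)%E.
  by rewrite /= in_itv/= => /andP[t0 _]; rewrite lee_fin q0.
rewrite itvE.
have h : (\int[leb]_(t in `[0%R, (k.+1%:R : R)]) (q n t)%:E @[k --> \oo] -->
    \int[leb]_(t in \bigcup_k `[0%R, (k.+1%:R : R)]%classic) (q n t)%:E)%E.
  apply: ge0_nondecreasing_set_cvg_integral => //.
  - move=> i j ij; apply/subsetPset => t /=; rewrite !in_itv/= => /andP[-> ti]/=.
    by apply: (le_trans ti); rewrite ler_nat ltnS.
  - by move=> k; apply/measurable_EFinP/measurable_funTS; exact: mq.
apply: (cvge_to_le h); apply: nearW => k; exact: int_q.
Qed.

End poisson_time.

Section green.
Context (R : realType) (dO : measure_display) (Omega : measurableType dO).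
Context (P : probability Omega R) (d : nat) (x : 'rV[R]_d) (lambda : R).
Context (nu : probability 'rV[R]_d R) (N : R -> Omega -> nat).
Context (xi : nat -> Omega -> 'rV[R]_d) (X : R -> Omega -> 'rV[R]_d).
Context (H : compound_poisson_sum P x lambda nu N xi X).
Local Notation V := 'rV[R]_d.
Local Notation leb := (@lebesgue_measure R).
Let T := measurableTypeR R.

(** Negative times are moved to 0, so that [joint] is defined and measurable on all of
    Omega x R. *)
Definition pos (t : R) := Num.max t 0.

Let pos0 t : 0 <= pos t. Proof. by rewrite /pos le_max lexx orbT. Qed.
Let posE t : 0 <= t -> pos t = t. Proof. by move=> t0; rewrite /pos max_l. Qed.

Definition joint_count (z : Omega * T) : nat := N (pos z.2) z.1.
Definition joint (z : Omega * T) : V := walk x xi (joint_count z) z.1.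

(** By monotonicity and right continuity, at most m jumps have occurred by time t if
    and only if this holds at some rational time larger than t; this is a countable
    union of measurable rectangles. *)
Lemma joint_count_le m : measurable [set z | (joint_count z <= m)%N].
Proof.
have Hp := cps_poisson H.
have -> : [set z | (joint_count z <= m)%N] = \bigcup_(q in [set: rat])
    ([set w | (N (pos (ratr q)) w <= m)%N] `*` [set t : T | t < ratr q]).
  apply/seteqP; split => [[w t] /= Nm|[w t] [q _ [/= Nm tq]]]; last first.
    apply: leq_trans Nm; apply: (poisson_nondecreasing Hp) => //.
    by rewrite /pos ge_max !le_max lexx orbT (ltW tq).
  have := poisson_right_continuous Hp w (pos0 t) => rc.
  have [s st Ns] : exists2 s, pos t < s & N s w = N (pos t) w.
    near (pos t)^'+ => s.
    exists s; first by near: s; exact: nbhs_right_gt.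
    by near: s.
  have /rat_in_itvoo[q] := st; rewrite in_itv/= => /andP[tq qs].
  exists q => //; split => /=; last by apply: le_lt_trans tq; rewrite /pos le_max lexx.
  have q0 : 0 <= ratr q :> R by apply/ltW/(le_lt_trans (pos0 t)).
  rewrite posE//; apply: leq_trans Nm.
  rewrite /joint_count -Ns; apply: (poisson_nondecreasing Hp) => //; exact: ltW.
apply: countable_bigcupT_measurable; first exact: countableP.
move=> q; apply: measurableX.
  rewrite -[X in measurable X]setTI.
  by apply: (poisson_measurable Hp (pos0 (ratr q)) measurableT (Y := [set k | (k <= m)%N])).
have -> : [set t : T | t < ratr q] = `]-oo, ratr q[%classic.
  by apply/seteqP; split => t /=; rewrite in_itv.
exact: measurable_itv.
Unshelve. all: by end_near. Qed.

Lemma measurable_joint : measurable_fun setT joint.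
Proof.
apply: (measurable_nat_select (K := joint_count) (F := fun n z => walk x xi n z.1)).
  case=> [|n].
    rewrite (_ : _ @^-1` _ = [set z | (joint_count z <= 0)%N]); first exact: joint_count_le.
    by apply/seteqP; split => z /=; rewrite leqn0 => /eqP.
  rewrite (_ : _ @^-1` _ = [set z | (joint_count z <= n.+1)%N] `\`
      [set z | (joint_count z <= n)%N]).
    by apply: measurableD; exact: joint_count_le.
  apply/seteqP; split => z /=; first by move=> ->; rewrite leqnn ltnn.
  by case; rewrite leq_eqVlt => /orP[/eqP//|]; rewrite ltnS => h /(_ h).
by move=> n; apply: measurableT_comp => //; exact: measurable_walk H n.
Qed.

Lemma jointE w t : 0 <= t -> joint (w, t) = X t w.
Proof. by move=> t0; rewrite /joint /joint_count/= posE// (X_walk H). Qed.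

Let D : set (Omega * T) := setT `*` `[0, +oo[%classic.
Let mD : measurable D. Proof. exact: measurableX. Qed.

(** The expected time spent by the process in a set. *)
Definition green : {measure set V -> \bar R} :=
  pushm (mrestr (P \x leb)%E mD) measurable_joint.

Local Open Scope ereal_scope.

Lemma green_integral (g : V -> \bar R) : measurable_fun setT g ->
  (forall v, 0 <= g v) ->
  \int[green]_v g v =
  \int[P \x leb]_z if (0 <= z.2)%R then g (joint z) else 0.
Proof.
move=> mg g0.
have mgj : measurable_fun setT (fun z => g (joint z)).
  exact: (measurableT_comp mg measurable_joint).
transitivity (\int[mrestr (P \x leb) mD]_z g (joint z)).
  have g0' : {in setT, forall v, 0 <= g v} by move=> v _.
  have := ge0_integral_pushforward measurable_joint (mrestr (P \x leb) mD) measurableT mg g0'.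
  by rewrite preimage_setT.
rewrite ge0_integral_mrestr// integral_mkcond; apply: eq_integral => z _.
rewrite patchE /D; case: (boolP (0 <= z.2)%R) => t0.
  by rewrite mem_set//; split => //=; rewrite in_itv/= t0.
by rewrite memNset// => -[_ /=]; rewrite in_itv/= andbT; exact/negP.
Qed.

Lemma green_fubini (g : V -> \bar R) : measurable_fun setT g ->
  (forall v, 0 <= g v) ->
  measurable_fun (`[0%R, +oo[%classic : set T) (fun t => \int[P]_w g (X t w)) /\
  \int[green]_v g v = \int[leb]_(t in `[0%R, +oo[) \int[P]_w g (X t w).
Proof.
move=> mg g0.
have mgj : measurable_fun setT (fun z => g (joint z)).
  exact: (measurableT_comp mg measurable_joint).
pose F (z : Omega * T) := if (0 <= z.2)%R then g (joint z) else 0.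
have mF : measurable_fun setT F.
  apply: measurable_fun_if => //.
    exact: measurable_fun_ler.
  exact: measurable_funTS.
have F0 z : 0 <= F z by rewrite /F; case: ifP.
have FE w t : F (w, t) = (fun t => g (X t w)) \_ `[0%R, +oo[ t.
  rewrite /F patchE/=; case: (boolP (0 <= t)%R) => t0.
    by rewrite mem_set/= ?jointE// in_itv/= t0.
  by rewrite memNset//= in_itv/= andbT; exact/negP.
have E1 : \int[green]_v g v = \int[P \x leb]_z F z by exact: green_integral.
have E3 t : \int[P]_w F (w, t) = (fun t => \int[P]_w g (X t w)) \_ `[0%R, +oo[ t.
  rewrite patchE; under eq_integral do rewrite FE patchE.
  by case: ifP => // _; rewrite integral0.
split.
- apply: (eq_measurable_fun (fun t => \int[P]_w F (w, t))).
    by move=> t ht; rewrite E3 patchE ht.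
  by apply: measurable_funTS; exact: measurable_fun_fubini_tonelli_G.
- rewrite E1 fubini_tonelli2// [RHS]integral_mkcond.
  by apply: eq_integral => t _; rewrite /fubini_G E3.
Qed.

(** Conditioning on the number n of jumps, the law of the walk is weighted by the
    expected time during which there have been exactly n jumps, which is at most one
    at rate one. *)
Lemma green_le (g : V -> R) (c : nat -> R) : lambda = 1%R ->
  measurable_fun setT g -> (forall v, 0 <= g v)%R ->
  (forall n, \int[law H n]_v (g v)%:E = (c n)%:E) ->
  \int[green]_v (g v)%:E <= \sum_(n <oo) (c n)%:E.
Proof.
move=> l1 mg g0 cE.
have mgE : measurable_fun setT (fun v => (g v)%:E) by exact/measurable_EFinP.
have gE0 v : 0 <= (g v)%:E by rewrite lee_fin.
have c0 n : (0 <= c n)%R.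
  by rewrite -lee_fin -cE; exact: integral_ge0.
have [mEg ->] := green_fubini mgE gE0.
pose p n (t : R) : R := (t ^+ n * n`!%:R^-1 * expR (- t))%R.
have p0 n t : (0 <= t)%R -> (0 <= p n t)%R.
  by move=> t0; rewrite /p !mulr_ge0// ?expR_ge0// exprn_ge0.
have mp n : measurable_fun setT (p n : T -> R).
  apply: measurable_funM; first by apply: measurable_funM => //; exact: measurable_funX.
  by apply: measurableT_comp => //; exact: oppr_measurable.
have -> : \int[leb]_(t in `[0%R, +oo[) \int[P]_w (g (X t w))%:E =
    \int[leb]_(t in `]0%R, +oo[) \int[P]_w (g (X t w))%:E.
  rewrite -integral_itv_obnd_cbnd//; apply: measurable_funS mEg => //.
  by move=> t /=; rewrite !in_itv/= !andbT; exact: ltW.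
have -> : \int[leb]_(t in `]0%R, +oo[) \int[P]_w (g (X t w))%:E =
    \int[leb]_(t in `]0%R, +oo[) \sum_(n <oo) ((c n)%:E * (p n t)%:E).
  apply: eq_integral => t; rewrite inE/= in_itv/= andbT => t0.
  rewrite (expectation_X H (g := fun v => (g v)%:E))//.
  by apply: eq_eseriesr => n _; rewrite cE l1 mul1r /poisson_pmf t0 muleC.
rewrite integral_nneseries//; last 2 first.
- move=> n; apply: emeasurable_funM => //; apply/measurable_EFinP.
  exact: measurable_funTS.
- by move=> n t; rewrite /= in_itv/= andbT => t0; rewrite -EFinM lee_fin mulr_ge0// p0// ltW.
apply: lee_nneseries => n.
  move=> _ _; apply: integral_ge0 => t; rewrite /= in_itv/= andbT => t0.
  by rewrite -EFinM lee_fin mulr_ge0// p0// ltW.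
move=> _; rewrite ge0_integralZl_EFin//; last 2 first.
- by move=> t; rewrite /= in_itv/= andbT => t0; rewrite lee_fin p0// ltW.
- by apply/measurable_EFinP; exact: measurable_funTS.
rewrite -[leRHS]mule1; apply: lee_wpmul2l; first by rewrite lee_fin.
rewrite integral_itv_obnd_cbnd; first exact: integral_poisson_time.
have mpn : measurable_fun setT (fun t : T => (p n t)%:E) by exact/measurable_EFinP.
exact: measurable_funTS mpn.
Qed.

End green.

(** * Distance in L^1 and integration over one variable *)

Section L1dist.
Context (R : realType) (dO : measure_display) (Omega : measurableType dO).
Context (P : probability Omega R).
Local Open Scope ereal_scope.
Implicit Types y z : Omega -> R.

Lemma L1distE y z : L1dist P y z = \int[P]_w (`|y w - z w|%R)%:E.
Proof. by rewrite /L1dist Lnorm1. Qed.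

Lemma Lfun1_meas y : y \in Lfun P 1 -> measurable_fun setT y.
Proof. by move=> /sub_Lfun_mfun; rewrite inE. Qed.

Lemma L1dist_ge0 y z : 0 <= L1dist P y z.
Proof. by rewrite L1distE; apply: integral_ge0 => w _; rewrite lee_fin. Qed.

Let mdist y z : measurable_fun setT y -> measurable_fun setT z ->
  measurable_fun setT (fun w => (`|y w - z w|%R)%:E).
Proof.
move=> my mz; apply/measurable_EFinP; apply: measurableT_comp => //.
exact: measurable_funB.
Qed.

Lemma L1dist_triangle y z u : measurable_fun setT y -> measurable_fun setT z ->
  measurable_fun setT u -> L1dist P y u <= L1dist P y z + L1dist P z u.
Proof.
move=> my mz mu; rewrite !L1distE -intDT//; last 2 first.
- exact: mdist.
- exact: mdist.
apply: ge0_le_intT => //.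
- exact: mdist.
- by apply: emeasurable_funD; exact: mdist.
- by move=> w; rewrite -EFinD lee_fin ler_distD.
Qed.

Lemma L1distC y z : L1dist P y z = L1dist P z y.
Proof. by rewrite !L1distE; apply: eq_integral => w _; rewrite distrC. Qed.

Lemma L1dist_ae y y' z z' : measurable_fun setT y -> measurable_fun setT z ->
  measurable_fun setT y' -> measurable_fun setT z' ->
  {ae P, forall w, y w = y' w} -> {ae P, forall w, z w = z' w} ->
  L1dist P y z = L1dist P y' z'.
Proof.
move=> my mz my' mz' yy zz; rewrite !L1distE; apply: ae_eq_integral => //.
- exact: mdist.
- exact: mdist.
by apply: filterS2 yy zz => w -> ->.
Qed.

End L1dist.

Section fibre_integral.
Context (R : realType) (dO : measure_display) (Omega : measurableType dO).
Context (P : probability Omega R).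
Context (d : measure_display) (T : measurableType d).
Context (m : {sigma_finite_measure set T -> \bar R}).
Local Open Scope ereal_scope.
Implicit Types f g : Omega * T -> R.

(** Where f(w, .) is not integrable the value is a default one; by [fibre_ae] this
    only happens on a negligible set. *)
Definition fibre f (w : Omega) : R := (\int[m]_t f (w, t))%R.
Definition fibre_int f := (P \x m).-integrable setT (EFin \o f).

Lemma fibre_ae f : fibre_int f ->
  {ae P, forall w, m.-integrable setT (fun t => (f (w, t))%:E)}.
Proof. by move=> /ae_integrable1. Qed.

Lemma fibre_E f : fibre_int f ->
  {ae P, forall w, (fibre f w)%:E = \int[m]_t (f (w, t))%:E}.
Proof.
move=> /integrable_fubini_F /(integrable_ae measurableT).
by apply: filterS => w /(_ I) h; rewrite /fibre /Rintegral fineK.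
Qed.

Lemma fibre_meas f : fibre_int f -> measurable_fun setT (fibre f).
Proof.
move=> /measurable_fubini_F mF; rewrite (_ : fibre f = fine \o fubini_F m (EFin \o f))//.
by apply: measurableT_comp => //; exact: fine_measurable.
Qed.

Lemma fibre_L1 f : fibre_int f -> fibre f \in Lfun P 1.
Proof.
move=> fi; apply/Lfun1_integrable.
have mfb : measurable_fun setT (EFin \o fibre f).
  by apply/measurable_EFinP; exact: fibre_meas.
have iF := integrable_fubini_F fi.
apply/integrableP; split => //; have /integrableP[mF] := iF.
rewrite [X in X < _ -> _](ae_eq_integral (fun w => `|(EFin \o fibre f) w|))//.
- exact: measurableT_comp.
- exact: measurableT_comp.
- by have := fibre_E fi; apply: filterS => w E _; congr abse; rewrite -[LHS]E.
Qed.

Lemma fibre_dist f g : fibre_int f -> fibre_int g ->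
  L1dist P (fibre f) (fibre g) <= \int[P \x m]_z (`|f z - g z|%R)%:E.
Proof.
move=> fi gi; have mf : measurable_fun setT f.
  by apply/measurable_EFinP; exact: measurable_int fi.
have mg : measurable_fun setT g.
  by apply/measurable_EFinP; exact: measurable_int gi.
have md : measurable_fun setT (fun z => (`|f z - g z|%R)%:E).
  by apply/measurable_EFinP; apply: measurableT_comp => //; exact: measurable_funB.
rewrite L1distE fubini_tonelli1//.
apply: ae_ge0_le_integral => //.
- apply/measurable_EFinP; apply: measurableT_comp => //.
  by apply: measurable_funB; exact: fibre_meas.
- by move=> w _; apply: integral_ge0.
- exact: measurable_fun_fubini_tonelli_F.
apply: filterS2 (fibre_ae fi) (fibre_ae gi) => w fw gw _.
rewrite /fibre -RintegralB//.
have dw : m.-integrable setT (EFin \o (fun t => f (w, t) - g (w, t))%R).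
  have -> : EFin \o (fun t => f (w, t) - g (w, t))%R =
      (fun t => (f (w, t))%:E) \- (fun t => (g (w, t))%:E) by [].
  exact: integrableB.
apply: (@le_trans _ _ (\int[m]_t `|f (w, t) - g (w, t)|)%R%:E).
  by rewrite lee_fin; exact: le_normr_Rintegral.
rewrite /Rintegral /fubini_F fineK//.
by apply: integrable_fin_num => //; exact: (integrable_norm dw).
Qed.

Lemma fibre_lin (I : Type) (s : seq I) (c : I -> R) (f : I -> Omega * T -> R) :
  (forall i, fibre_int (f i)) ->
  fibre_int (fun z => \sum_(i <- s) c i * f i z)%R /\
  {ae P, forall w, (\sum_(i <- s) c i * fibre (f i) w =
    fibre (fun z => \sum_(i <- s) c i * f i z) w)%R}.
Proof.
move=> fi; elim: s => [|i s [IH1 IH2]].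
  split.
    rewrite /fibre_int (_ : _ \o _ = cst 0); first exact: integrable0.
    by apply/funext => z /=; rewrite big_nil.
  apply/aeW => w; rewrite big_nil /fibre /Rintegral integral0_eq//.
  by move=> t _; rewrite big_nil.
have hi : fibre_int (fun z => c i * f i z)%R.
  rewrite /fibre_int (_ : _ \o _ = fun z => (c i)%:E * (f i z)%:E)//.
  exact: (integrableZl measurableT (c i) (fi i)).
split.
  rewrite /fibre_int (_ : _ \o _ = (fun z => (c i * f i z)%R%:E) \+
      (fun z => (\sum_(j <- s) c j * f j z)%R%:E)).
    exact: integrableD.
  by apply/funext => z /=; rewrite big_cons.
move: IH2 (fibre_ae (fi i)) (fibre_ae IH1); apply: filterS3 => w E f1 f2.
rewrite big_cons E /fibre -RintegralZl// -RintegralD//.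
  by apply: eq_Rintegral => t _; rewrite big_cons.
rewrite (_ : _ \o _ = fun t => (c i)%:E * (f i (w, t))%:E)//.
exact: (integrableZl measurableT (c i) f1).
Qed.

End fibre_integral.

(** * Total occupation times *)

Section bounded_sets.
Context (R : realType) (d : nat).
Local Notation V := 'rV[R]_d.
Local Notation leb := (lebesgue_rV R d).

Lemma coord_le_norm (v : V) (i : 'I_d) : `|v ord0 i| <= `|v|.
Proof.
rewrite [leRHS]/Num.norm/= mx_normrE; apply/bigmax_geP; right => /=.
by exists (ord0, i).
Qed.

Lemma bounded_setE (A : set V) : bounded_set A <-> exists M, forall v, A v -> `|v| <= M.
Proof.
split=> [[M [_ AM]]|[M AM]].
  by exists (M + 1) => v Av; apply: (AM (M + 1)) => //; rewrite ltrDl.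
exists M; split; first exact: num_real.
by move=> y My v Av; exact: le_trans (AM v Av) (ltW My).
Qed.

Lemma measurable_cball (r : R) : measurable [set v : V | `|v| <= r].
Proof.
have mn : measurable_fun setT (fun v : V => `|v|).
  by apply: continuous_measurable_rV => v; exact: norm_continuous.
have := mn measurableT `]-oo, r]%classic (measurable_itv _).
by rewrite setTI; congr measurable; apply/seteqP; split => v /=; rewrite in_itv.
Qed.

Lemma lebesgue_bounded (A : set V) : Bb A -> (leb A < +oo)%E.
Proof.
move=> [mA /bounded_setE[M AM]].
pose B (i : 'I_d) : set R := `[- M, M]%classic.
have mB (i : 'I_d) : measurable (B i) by exact: measurable_itv.
have mBox : measurable [set v : V | forall i, B i (v ord0 i)].
  have -> : [set v : V | forall i, B i (v ord0 i)] =
      \bigcap_(i in [set: 'I_d]) (fun v : V => v ord0 i) @^-1` B i.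
    by apply/seteqP; split=> [v h i _|v h i]; exact: h.
  apply: fin_bigcap_measurable => // i _.
  by rewrite -[X in measurable X]setTI; exact: measurable_coord.
apply: (@le_lt_trans _ _ (leb [set v : V | forall i, B i (v ord0 i)])).
  apply: le_measure; rewrite ?inE// => v Av i.
  by rewrite /B/= in_itv/= -ler_norml (le_trans (coord_le_norm v i))// AM.
rewrite (lebesgue_rV_box mB).
suff [] : (0 <= \prod_(i < d) (@lebesgue_measure R) (B i) /\ \prod_(i < d) (@lebesgue_measure R) (B i) < +oo)%E by [].
apply: (big_rec (fun u => (0 <= u)%E /\ (u < +oo)%E)).
  by split; [exact: lee01|exact: ltry].
move=> i u _ [u0 uoo]; split; first by rewrite mule_ge0.
rewrite lte_mul_pinfty//.
  by rewrite ge0_fin_numE// lebesgue_measure_itv/=; case: ifP => _; rewrite -?EFinB ltry.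
Qed.

Lemma bL1_indic (A : set V) : Bb A -> bounded_L1p (\1_A : V -> R).
Proof.
move=> bA; have mA : measurable A by case: bA.
split.
- exact: measurable_indic.
- by move=> u; rewrite indicE.
- by exists 1 => u; rewrite indicE; case: (_ \in _).
- by rewrite integral_indic// setIT lebesgue_bounded.
Qed.

End bounded_sets.

Section total_occupation.
Context (R : realType) (dO : measure_display) (Omega : measurableType dO).
Context (P : probability Omega R) (d : nat) (x : 'rV[R]_d) (lambda : R).
Context (nu : probability 'rV[R]_d R) (N : R -> Omega -> nat).
Context (xi : nat -> Omega -> 'rV[R]_d) (X : R -> Omega -> 'rV[R]_d).
Context (H : compound_poisson_sum P x lambda nu N xi X).
Local Notation V := 'rV[R]_d.
Local Notation leb := (@lebesgue_measure R).
Local Notation T := (measurableTypeR R).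
Local Notation joint := (joint x N xi).
Local Notation green := (green H).
Context (green_fin : forall g : V -> R, bounded_L1p g -> (\int[green]_v (g v)%:E < +oo)%E).
Implicit Types f g : V -> R.

(** The function f(X(t)) on Omega x R, extended by 0 to negative times. *)
Definition on_path f (z : Omega * T) : R := if 0 <= z.2 then f (joint z) else 0.
Definition occ f := fibre leb (on_path f).

Lemma measurable_on_path f : measurable_fun setT f -> measurable_fun setT (on_path f).
Proof.
move=> mf; apply: measurable_fun_if => //.
  exact: measurable_fun_ler.
by apply: measurable_funTS; exact: (measurableT_comp mf (measurable_joint H)).
Qed.

Lemma on_path_dist f g : measurable_fun setT f -> measurable_fun setT g ->
  (\int[P \x leb]_z (`|on_path f z - on_path g z|%R)%:E =
   \int[green]_v (`|f v - g v|%R)%:E)%E.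
Proof.
move=> mf mg; rewrite green_integral//.
  by apply: eq_integral => z _; rewrite /on_path; case: ifP => // _; rewrite subrr normr0.
by apply/measurable_EFinP; apply: measurableT_comp => //; exact: measurable_funB.
Qed.

Lemma on_path_int f : green.-integrable setT (EFin \o f) -> fibre_int P leb (on_path f).
Proof.
move=> /integrableP[mf foo]; have mfR : measurable_fun setT f by exact/measurable_EFinP.
apply/integrableP; split; first by apply/measurable_EFinP; exact: measurable_on_path.
have E : on_path (cst 0) = cst 0 by apply/funext => z; rewrite /on_path; case: ifP.
have := on_path_dist mfR (@measurable_cst _ _ _ _ setT (0 : R)); rewrite E.
under eq_integral do rewrite subr0; under [RHS]eq_integral do rewrite subr0.
by rewrite /= => ->.
Qed.

(** The contraction property on which all the convergence statements about occupation
    times rest. *)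
Lemma occ_dist f g : green.-integrable setT (EFin \o f) ->
  green.-integrable setT (EFin \o g) ->
  (L1dist P (occ f) (occ g) <= \int[green]_v (`|f v - g v|%R)%:E)%E.
Proof.
move=> fi gi; have /measurable_EFinP mf := measurable_int _ fi.
have /measurable_EFinP mg := measurable_int _ gi.
by rewrite -on_path_dist//; apply: fibre_dist; exact: on_path_int.
Qed.

Lemma green_integrable_bounded f M : measurable_fun setT f ->
  (forall u, `|f u| <= M) ->
  (lebesgue_rV R d).-integrable setT (EFin \o f) ->
  green.-integrable setT (EFin \o f).
Proof.
move=> mf fM /integrableP[_ foo]; apply/integrableP; split; first exact/measurable_EFinP.
apply: (green_fin (g := fun v => `|f v|)); split => //.
- exact: measurableT_comp.
- by exists M.
Qed.

Lemma CL_green f : CL f -> green.-integrable setT (EFin \o f).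
Proof.
move=> [[cf /bounded_funE[M fM]] fi].
by apply: (@green_integrable_bounded f M) => //; exact: continuous_measurable_rV.
Qed.

Lemma indic_green A : Bb A -> green.-integrable setT (EFin \o (\1_A : V -> R)).
Proof.
move=> bA; have g := bL1_indic bA.
apply: (@green_integrable_bounded _ 1); first exact: bL1_meas g.
  by move=> u; rewrite ger0_norm ?(bL1_ge0 g)// indicE; case: (_ \in _).
apply/integrableP; split; first by apply/measurable_EFinP; exact: bL1_meas g.
under eq_integral do rewrite /= ger0_norm ?(bL1_ge0 g)//.
exact: bL1_fin g.
Qed.

Definition on_path_to S f (z : Omega * T) : R :=
  if 0 <= z.2 <= S then f (joint z) else 0.

Lemma occupationE S f : occupation X f S = fibre leb (on_path_to S f).
Proof.
apply/funext => w; rewrite /occupation Rintegral_mkcond /fibre.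
apply: eq_Rintegral => t _; rewrite patchE /on_path_to/=.
have [ts|ts] := boolP (0 <= t <= S).
  by rewrite mem_set/= ?in_itv//; have /andP[t0 _] := ts; rewrite (jointE H).
by rewrite memNset//= in_itv/=; exact/negP.
Qed.

Lemma measurable_on_path_to S f : measurable_fun setT f ->
  measurable_fun setT (on_path_to S f).
Proof.
move=> mf; apply: measurable_fun_if => //.
  by apply: measurable_and; exact: measurable_fun_ler.
by apply: measurable_funTS; exact: (measurableT_comp mf (measurable_joint H)).
Qed.

Lemma on_path_to_int S f : green.-integrable setT (EFin \o f) ->
  fibre_int P leb (on_path_to S f).
Proof.
move=> fi; have /measurable_EFinP mf := measurable_int _ fi.
apply: le_integrable (on_path_int fi) => //.
  by apply/measurable_EFinP; exact: measurable_on_path_to.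
move=> z _; rewrite /= lee_fin /on_path_to /on_path.
by case: ifPn => [/andP[-> _]//|_]; rewrite normr0.
Qed.

Lemma occupation_cvg f : green.-integrable setT (EFin \o f) ->
  (L1dist P (occupation X f S) (occ f) @[S --> +oo%R] --> 0)%E.
Proof.
move=> fi; have /measurable_EFinP mf := measurable_int _ fi.
apply/cvge_pinftyP => u uoo.
apply: (@squeeze_cvge _ _ _ _ (cst 0%E) _
  (fun n => \int[P \x leb]_z (`|on_path_to (u n) f z - on_path f z|%R)%:E)%E).
- apply: nearW => n; rewrite L1dist_ge0/= occupationE.
  by apply: fibre_dist; [exact: on_path_to_int|exact: on_path_int].
- exact: cvg_cst.
have [||||| _ c0 _] := @dominated_cvgT _ _ _ (P \x leb)%E (fun n z => (on_path_to (u n) f z)%:E)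
  (fun z => (on_path f z)%:E) (fun z => (`|on_path f z|)%:E).
- by move=> n; apply/measurable_EFinP; exact: measurable_on_path_to.
- by apply/measurable_EFinP; exact: measurable_on_path.
- move=> z; apply: cvg_near_cst.
  have uz : \forall n \near \oo, z.2 <= u n by move/cvgryPge : uoo; exact.
  by apply: filterS uz => n uz; rewrite /on_path_to /on_path uz andbT.
- exact: (integrable_norm (on_path_int fi)).
- move=> n z; rewrite lee_fin /on_path_to /on_path.
  by case: ifPn => [/andP[-> _]//|_]; rewrite normr0.
exact: c0.
Qed.

Lemma occ_is_Y f : CL f -> is_Y P X f (occ f).
Proof.
move=> /CL_green fi; split.
- exact/fibre_L1/on_path_int.
- by move=> S _; rewrite occupationE; exact/fibre_L1/on_path_to_int.
- exact: occupation_cvg.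
Qed.

Lemma is_Y_occ f y : CL f -> is_Y P X f y -> L1dist P (occ f) y = 0%E.
Proof.
move=> cf [yL occL yc]; have [oL _ oc] := occ_is_Y cf.
apply/eqP; rewrite eq_le L1dist_ge0 andbT.
have c0 : (L1dist P (occupation X f S) (occ f) + L1dist P (occupation X f S) y
    @[S --> +oo%R] --> 0)%E by rewrite -[X in _ --> X]adde0; apply: cvgeD.
apply: (cvge_to_ge c0); near=> S.
rewrite [L1dist P (occupation X f S) (occ f)]L1distC.
have S0 : 0 <= S by near: S; exact: nbhs_pinfty_ge.
apply: L1dist_triangle; first exact: Lfun1_meas oL.
  exact: Lfun1_meas (occL _ S0).
exact: Lfun1_meas yL.
Unshelve. all: by end_near. Qed.

End total_occupation.

Section representation.
Context (R : realType) (dO : measure_display) (Omega : measurableType dO).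
Context (P : probability Omega R) (d : nat) (x : 'rV[R]_d) (lambda : R).
Context (nu : probability 'rV[R]_d R) (N : R -> Omega -> nat).
Context (xi : nat -> Omega -> 'rV[R]_d) (X : R -> Omega -> 'rV[R]_d).
Context (H : compound_poisson_sum P x lambda nu N xi X).
Local Notation V := 'rV[R]_d.
Local Notation leb := (@lebesgue_measure R).
Local Notation T := (measurableTypeR R).
Local Notation joint := (joint x N xi).
Local Notation green := (green H).
Context (green_fin : forall g : V -> R, bounded_L1p g -> (\int[green]_v (g v)%:E < +oo)%E).
Local Notation occ := (occ x N xi).
Local Notation on_path := (on_path x N xi).

Definition occupation_measure (A : set V) : Omega -> R := occ (\1_A).

Lemma occ_sum (I : Type) (s : seq I) (c : I -> R) (f : I -> V -> R) :
  (forall i, green.-integrable setT (EFin \o f i)) ->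
  {ae P, forall w, \sum_(i <- s) c i * occ (f i) w =
    occ (fun v => \sum_(i <- s) c i * f i v) w}.
Proof.
move=> fi; have [_] := fibre_lin s c (fun i => on_path_int (fi i)).
rewrite /occ (_ : on_path (fun v => _) = fun z => \sum_(i <- s) c i * on_path (f i) z)//.
apply/funext => z; rewrite /on_path; case: ifP => // _.
by rewrite big1// => i _; rewrite mulr0.
Qed.

(** The indicators of the partial unions increase to that of the union, hence converge
    to it in L^1(green); [occ_dist] transfers the convergence. *)
Lemma occupation_measure_radon : vector_radon_measure P occupation_measure.
Proof.
split=> [A bA|F bF tF bU].
  exact: (fibre_L1 (on_path_int (indic_green green_fin bA))).
pose U := \bigcup_i F i.
have mF i : measurable (F i) by case: (bF i).
have mU : measurable U by case: bU.
have iF i := indic_green green_fin (bF i).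
have iU := indic_green green_fin bU.
pose S n : V -> R := fun v => \sum_(i < n) \1_(F i) v.
have SE n v : S n v = \1_(\big[setU/set0]_(i < n) F i) v.
  rewrite /S; elim: n => [|n IH]; first by rewrite !big_ord0 indicE in_set0.
  rewrite !big_ord_recr/= IH !indicE in_setU.
  case: (boolP (v \in F n)) => vn; last by rewrite orbF addr0.
  rewrite memNset; first by rewrite add0r.
  rewrite -bigcup_mkord => -[i /= ni Fi]; move: vn; rewrite inE => vn.
  have := tF i n I I (ex_intro _ v (conj Fi vn)) => ine.
  by move: ni; rewrite ine ltnn.
have S1 n v : 0 <= S n v <= \1_U v.
  rewrite SE !indicE; case: (boolP (v \in \big[setU/set0]_(i < n) F i)).
    rewrite -bigcup_mkord inE => -[i _ Fi].
    by rewrite mem_set ?lexx ?ler01//; exists i.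
  by move=> _; rewrite lexx/= ler0n.
have mS n : measurable_fun setT (S n).
  by apply: measurable_sum => i; exact: measurable_indic.
have iS n : green.-integrable setT (EFin \o S n).
  apply: le_integrable iU => //; first exact/measurable_EFinP.
  move=> v _; rewrite /= lee_fin; have /andP[S0 SU] := S1 n v.
  by rewrite !ger0_norm// (le_trans S0).
have [||||| _ c0 _] := @dominated_cvgT _ _ _ green (fun n v => (S n v)%:E)
  (fun v => (\1_U v)%:E) (fun v => (\1_U v)%:E).
- by move=> n; exact/measurable_EFinP.
- by apply/measurable_EFinP; exact: measurable_indic.
- move=> v; apply: cvg_near_cst.
  have [[k _ Fk]|Uv] := pselect (U v); last first.
    apply: nearW => n; have := S1 n v.
    by rewrite [\1_U v]indicE memNset//= -eq_le => /eqP <-.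
  near=> n; rewrite SE !indicE !mem_set//.
    by exists k.
  rewrite -bigcup_mkord; exists k => //=.
  by near: n; exact: nbhs_infty_gt.
- exact: iU.
- move=> n v; rewrite lee_fin; have /andP[S0 SU] := S1 n v.
  by rewrite ger0_norm.
apply: (@squeeze_cvge _ _ _ _ (cst 0%E) _ _ _ _ _ c0); last exact: cvg_cst.
apply: nearW => n; rewrite L1dist_ge0/=.
apply: (le_trans _ (occ_dist (iS n) iU)).
rewrite le_eqVlt; apply/orP; left; apply/eqP; apply: L1dist_ae.
- apply: measurable_sum => i; apply: Lfun1_meas; exact: (fibre_L1 (on_path_int (iF _))).
- apply: Lfun1_meas; exact: (fibre_L1 (on_path_int iU)).
- apply: Lfun1_meas; exact: (fibre_L1 (on_path_int (iS n))).
- apply: Lfun1_meas; exact: (fibre_L1 (on_path_int iU)).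
- have := occ_sum (index_enum 'I_n) (fun=> 1) (fun i => iF i).
  apply: filterS => w /=; under eq_bigr do rewrite mul1r.
  by move=> ->; congr (occ _ _); apply/funext => v; apply: eq_bigr => i _; rewrite mul1r.
- exact: aeW.
Unshelve. all: by end_near. Qed.

Lemma vintegral_occ (s : {sfun V >-> R}) (A : set V) :
  bounded_set (s @^-1` [set~ 0]) -> measurable A ->
  measurable_fun setT (vintegral_sfun occupation_measure s A) /\
  {ae P, forall w, vintegral_sfun occupation_measure s A w = occ (fun v => \1_A v * s v) w}.
Proof.
move=> bs mA.
pose f (c : R) : V -> R := if c == 0 then cst 0 else \1_(A `&` s @^-1` [set c]).
have mAc c : measurable (A `&` s @^-1` [set c]).
  by apply: measurableI => //; exact: measurable_sfunP.
have iF c : green.-integrable setT (EFin \o f c).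
  rewrite /f; case: eqP => [_|c0]; first exact: integrable0.
  apply: indic_green => //; split => //.
  move/bounded_setE: bs => [M sM]; apply/bounded_setE; exists M => v [_ /= vc].
  by apply: sM; rewrite /= vc; exact: c0.
have E : vintegral_sfun occupation_measure s A =
    fun w => \sum_(c <- finmap.enum_fset (fset_set (range s))) c * occ (f c) w.
  apply/funext => w; rewrite /vintegral_sfun fsbig_finite//=.
  apply: eq_bigr => c _; rewrite /occupation_measure /f.
  by case: eqP => [->|//]; rewrite !mul0r.
split.
  rewrite E; apply: measurable_sum => c; apply: measurable_funM => //.
  apply: Lfun1_meas; exact: (fibre_L1 (on_path_int (iF _))).
rewrite E; have := occ_sum (finmap.enum_fset (fset_set (range s))) id iF.
apply: filterS => w ->; congr (occ _ _); apply/funext => v.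
rewrite [s v]fimfunE fsbig_finite//= big_distrr/=; apply: eq_bigr => c _.
rewrite /f; case: eqP => [->|_]; first by rewrite !mul0r mulr0.
by rewrite indicI/= mulrCA.
Qed.

(** Simple functions approximating f in L^1(green), cut off outside balls of growing
    radius to make their supports bounded. *)
Lemma bounded_sfun_approx f : green.-integrable setT (EFin \o f) ->
  exists s : nat -> {sfun V >-> R},
    [/\ forall n, bounded_set (s n @^-1` [set~ 0]),
        forall n, green.-integrable setT (EFin \o s n),
        forall u, s n u @[n --> \oo] --> f u &
        (\int[green]_v (`|s n v - f v|%R)%:E @[n --> \oo] --> 0)%E].
Proof.
move=> fi; have /measurable_EFinP mf := measurable_int _ fi.
have [g [gi gf g0]] := approximation_sfun_integrable measurableT fi.
pose B n := [set v : V | `|v| <= n%:R].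
have mB n : measurable (B n) := measurable_cball n%:R.
pose s n : {sfun V >-> R} := (g n * indic_sfun (B n) (mB n))%R.
have sE n v : s n v = g n v * \1_(B n) v by [].
have ind01 n v : 0 <= (\1_(B n) v : R) <= 1.
  by rewrite indicE; case: (_ \in _); rewrite lexx ler01.
have s_int n : green.-integrable setT (EFin \o s n).
  apply: le_integrable (gi n) => //; first by apply/measurable_EFinP.
  move=> v _; change ((`|g n v * \1_(B n) v|)%:E <= (`|g n v|)%:E)%E.
  rewrite lee_fin normrM; have /andP[i0 i1] := ind01 n v.
  by rewrite ler_piMr// ger0_norm.
exists s; split => //.
- move=> n; apply/bounded_setE; exists n%:R => v /= sv.
  apply: contrapT => Bv; apply: sv.
  by rewrite [LHS]sE indicE memNset// mulr0.
- move=> u.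
  have gu : g n u @[n --> \oo] --> f u.
    by have /fine_cvgP[_] := gf u I.
  rewrite -[f u]mulr1; apply: cvgM => //; apply: cvg_near_cst.
  near=> n; change ((\1_(B n) u : R) = 1); rewrite indicE mem_set// /B/=.
  by near: n; exact: nbhs_infty_ger.
have mdom n : measurable_fun setT (fun v => f v * (1 - \1_(B n) v)).
  by apply: measurable_funM => //; apply: measurable_funB.
have [||||| _ _ c0] := @dominated_cvgT _ _ _ green (fun n v => (`|f v * (1 - \1_(B n) v)|)%:E)
  (cst 0%E) (fun v => (`|f v|)%:E).
- by move=> n; apply/measurable_EFinP; exact: measurableT_comp.
- exact: measurable_cst.
- move=> v; apply: cvg_near_cst; near=> n.
  rewrite indicE mem_set/= ?subrr ?mulr0 ?normr0//.
  by rewrite /B/=; near: n; exact: nbhs_infty_ger.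
- exact: (integrable_norm fi).
- move=> n v; rewrite lee_fin normr_id normrM; have /andP[i0 i1] := ind01 n v.
  by rewrite ler_piMr// ger0_norm ?subr_ge0// gerBl.
rewrite integral0 in c0.
apply: (@squeeze_cvge _ _ _ _ (cst 0%E) _ (fun n =>
  \int[green]_v `|(EFin \o f) v - (g n v)%:E| +
  \int[green]_v (`|f v * (1 - \1_(B n) v)|)%:E)%E).
- apply: nearW => n; apply/andP; split.
    by apply: integral_ge0 => v _; rewrite lee_fin.
  have mgn : measurable_fun setT (fun v => `|(EFin \o f) v - (g n v)%:E|%E).
    apply: measurableT_comp => //; apply: emeasurable_funB.
      exact/measurable_EFinP.
    exact/measurable_EFinP.
  rewrite -intDT//.
  + apply: ge0_le_intT.
    * by move=> v; rewrite lee_fin.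
    * apply/measurable_EFinP; apply: measurableT_comp => //.
      by apply: measurable_funB.
    * apply: emeasurable_funD => //; apply/measurable_EFinP.
      exact: measurableT_comp.
    * move=> v.
      change ((`|g n v * \1_(B n) v - f v|)%:E <=
        (`|f v - g n v|)%:E + (`|f v * (1 - \1_(B n) v)|)%:E)%E.
      rewrite -EFinD lee_fin.
      rewrite (_ : _ - _ = (g n v - f v) * \1_(B n) v - f v * (1 - \1_(B n) v)); last by ring.
      apply: (le_trans (ler_normB _ _)); rewrite lerD2r normrM distrC.
      by have /andP[i0 i1] := ind01 n v; rewrite ler_piMr// ger0_norm.
  + by apply/measurable_EFinP; exact: measurableT_comp.
- exact: cvg_cst.
- by rewrite -[X in _ --> X]adde0; apply: cvgeD.
Unshelve. all: by end_near. Qed.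

(** The same simple functions serve every set A, because multiplication by an
    indicator does not increase distances in L^1(green). *)
Lemma occupation_measure_represents : represents P X occupation_measure.
Proof.
move=> f y cf Yf; have fi := CL_green green_fin cf.
have [s [bs si sf s0]] := bounded_sfun_approx fi.
have /measurable_EFinP mf := measurable_int _ fi.
have Ai g A : measurable A -> green.-integrable setT (EFin \o g) ->
    green.-integrable setT (EFin \o (fun v => \1_A v * g v)).
  move=> mA gi; have /measurable_EFinP mg := measurable_int _ gi.
  apply: le_integrable gi => //.
    by apply/measurable_EFinP/measurable_funM => //; exact: measurable_indic.
  move=> v _; rewrite /= lee_fin normrM ler_piMl// indicE.
  by case: (_ \in _); rewrite ?normr1 ?normr0.
have lim A : measurable A ->
    (L1dist P (vintegral_sfun occupation_measure (s n) A) (occ (fun v => (\1_A v * f v)%R))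
      @[n --> \oo] --> 0)%E.
  move=> mA; apply: (@squeeze_cvge _ _ _ _ (cst 0%E) _ _ _ _ _ s0); last exact: cvg_cst.
  apply: nearW => n; rewrite L1dist_ge0/=.
  have [mv vE] := vintegral_occ (bs n) mA.
  have iAs := Ai _ _ mA (si n); have iAf := Ai _ _ mA fi.
  have /measurable_EFinP mAs := measurable_int _ iAs.
  have /measurable_EFinP mAf := measurable_int _ iAf.
  rewrite (L1dist_ae mv _ _ _ vE (aeW _ (fun=> erefl))).
  - apply: (le_trans (occ_dist iAs iAf)); apply: ge0_le_intT.
    + by move=> v; rewrite lee_fin.
    + apply/measurable_EFinP; apply: measurableT_comp => //.
      exact: measurable_funB.
    + apply/measurable_EFinP; apply: measurableT_comp => //.
      by apply: measurable_funB.
    + move=> v; rewrite lee_fin -mulrBr normrM ler_piMl// indicE.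
      by case: (_ \in _); rewrite ?normr1 ?normr0.
  - exact: Lfun1_meas (fibre_L1 (on_path_int iAf)).
  - exact: Lfun1_meas (fibre_L1 (on_path_int iAs)).
  - exact: Lfun1_meas (fibre_L1 (on_path_int iAf)).
have [yL _ _] := Yf.
exists s; split => //.
  move=> A mA; exists (occ (fun v => \1_A v * f v)); last exact: lim.
  exact: (fibre_L1 (on_path_int (Ai _ _ mA fi))).
have limT := lim setT measurableT.
have fE : (fun v => \1_setT v * f v) = f.
  by apply/funext => v; rewrite indicT mul1r.
rewrite fE in limT.
apply: (@squeeze_cvge _ _ _ _ (cst 0%E) _ _ _ _ _ limT); last exact: cvg_cst.
apply: nearW => n; rewrite L1dist_ge0/=.
have [mv _] := vintegral_occ (bs n) measurableT.
have my : measurable_fun setT y := Lfun1_meas yL.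
have mo : measurable_fun setT (occ f) := Lfun1_meas (fibre_L1 (on_path_int fi)).
apply: (le_trans (L1dist_triangle P mv mo my)).
by rewrite (is_Y_occ green_fin cf Yf) adde0.
Qed.

End representation.

(** * Uniform smallness of tails *)

Section uniform_tails.
Context (R : realType) (m : nat -> set nat -> R).
Context (madd : forall n A B, A `&` B = set0 -> m n (A `|` B) = m n A + m n B).
Context (mtail : forall n e, 0 < e -> exists q, forall J : set nat,
  (forall j, J j -> (q <= j)%N) -> `|m n J| <= e).
Context (mcvg : forall J, cvgn (fun n => m n J)).

Let agree q (J J' : set nat) := forall j, (j < q)%N -> J j <-> J' j.
Let below q (J : set nat) := [set j | J j /\ (j < q)%N].
Let above q (J : set nat) := [set j | J j /\ (q <= j)%N].

Let msplit n q J : m n J = m n (below q J) + m n (above q J).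
Proof.
rewrite -madd.
  congr m; apply/seteqP; split => j /=; last by case => -[].
  by move=> Jj; case: (ltnP j q) => h; [left|right].
by apply/seteqP; split => // j [[_ h1] [_ h2]]; move: h1; rewrite ltnNge h2.
Qed.

Let agree_below q J J' : agree q J J' -> below q J = below q J'.
Proof. by move=> a; apply/seteqP; split => j [Jj jq]; split => //; apply/(a j jq). Qed.

Let agree_close n e J : 0 < e -> exists q, forall q' J', (q <= q')%N ->
  agree q' J J' -> `|m n J' - m n J| <= e.
Proof.
move=> e0; have e20 : 0 < e / 2 by rewrite divr_gt0.
have [q hq] := mtail n e20; exists q => q' J' qq' a.
rewrite (msplit n q' J) (msplit n q' J') (agree_below a) opprD addrACA subrr add0r.
rewrite (splitr e) (le_trans (ler_normB _ _))// lerD//; apply: hq => j [_ h];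
  exact: leq_trans h.
Qed.

Let bad e q J N := exists n k, [/\ (N <= n)%N, (N <= k)%N &
  forall J', agree q J J' -> e < `|m n J' - m k J'|].

(** A Baire category argument in the space of sets of integers.  If the sequence were
    not uniformly Cauchy up to e on any cylinder, a decreasing sequence of cylinders
    could be chosen such that, throughout the N-th one, some terms with indices at
    least N differ by more than e.  The sequence would not converge at a common point
    of these cylinders. *)
Let cylinder e : 0 < e -> exists N q J0, forall J, agree q J0 J ->
  forall n k, (N <= n)%N -> (N <= k)%N -> `|m n J - m k J| <= e.
Proof.
move=> e0; apply: contrapT => H.
have step (N q : nat) (J0 : set nat) : exists p : nat * set nat,
    [/\ (q < p.1)%N, agree q J0 p.2 & bad e p.1 p.2 N].
  apply: contrapT => H'; apply: H; exists N, q, J0 => J aJ n k Nn Nk.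
  rewrite leNgt; apply/negP => lt; apply: H'.
  pose D := `|m n J - m k J| - e.
  have D0 : 0 < D by rewrite subr_gt0.
  have D40 : 0 < D / 4 by rewrite divr_gt0.
  have [q1 h1] := agree_close n J D40.
  have [q2 h2] := agree_close k J D40.
  exists (maxn q.+1 (maxn q1 q2), J); split => //=.
    by rewrite leq_max ltnSn.
  exists n, k; split => // J' a'.
  have k1 := h1 _ J' (leq_trans (leq_maxl q1 q2) (leq_maxr q.+1 _)) a'.
  have k2 := h2 _ J' (leq_trans (leq_maxr q1 q2) (leq_maxr q.+1 _)) a'.
  have : `|m n J - m k J| <= `|m n J' - m k J'| + `|m n J' - m n J| + `|m k J' - m k J|.
    have -> : m n J - m k J = (m n J' - m k J') - (m n J' - m n J) + (m k J' - m k J).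
      by ring.
    by apply: (le_trans (ler_normD _ _)); rewrite lerD2r; exact: ler_normB.
  have : `|m n J - m k J| = D + e by rewrite /D subrK.
  lra.
pose nxt N p := projT1 (cid (step N p.1 p.2)).
have nxtP N p : [/\ (p.1 < (nxt N p).1)%N, agree p.1 p.2 (nxt N p).2 &
  bad e (nxt N p).1 (nxt N p).2 N] by rewrite /nxt; case: cid.
pose st := fix st i := if i is i'.+1 then nxt i' (st i') else (0%N, set0).
have st_lt i : ((st i).1 < (st i.+1).1)%N by have [] := nxtP i (st i).
have st_ge i : (i <= (st i).1)%N.
  by elim: i => // i IH; exact: leq_ltn_trans IH (st_lt i).
have st_agree i j : (i <= j)%N -> agree (st i).1 (st i).2 (st j).2.
  elim: j => [|j IH]; first by rewrite leqn0 => /eqP ->.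
  rewrite leq_eqVlt => /orP[/eqP -> //|]; rewrite ltnS => ij l li.
  rewrite (IH ij l li); have [_ a _] := nxtP j (st j).
  apply: a; apply: (leq_trans li).
  have mono i' d' : ((st i').1 <= (st (i' + d')).1)%N.
    by elim: d' => [|d' IHd]; rewrite ?addn0// addnS (leq_trans IHd)// ltnW.
  by rewrite -(subnKC ij).
pose Jlim : set nat := [set j | (st j.+1).2 j].
have lim_agree i : agree (st i).1 (st i).2 Jlim.
  move=> j ji; rewrite /Jlim/=; case: (leqP i j.+1) => ij.
    exact: (st_agree i j.+1 ij j ji).
  apply: iff_sym; apply: (st_agree j.+1 i (ltnW ij) j).
  exact: st_ge.
have e20 : 0 < e / 2 by rewrite divr_gt0.
have [M _ hM] := (cvgrPdist_le _ _).1 (@mcvg Jlim) _ e20.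
have [_ _ [n [k [Mn Mk /(_ Jlim (lim_agree M.+1))]]]] := nxtP M (st M).
rewrite ltNge => /negP; apply.
have hn := hM n Mn; have hk := hM k Mk; set l := lim _ in hn hk.
have -> : m n Jlim - m k Jlim = (l - m k Jlim) - (l - m n Jlim) by ring.
by rewrite (splitr e) (le_trans (ler_normB _ _))// lerD.
Qed.

(** In the cylinder of [cylinder], compare A, the part of J0 below q, with A `|` J for
    a set J beyond q: the difference of the values at n and at N is small for both,
    hence for J, and the value of J at the fixed index N is small by itself. *)
Lemma uniform_tails e : 0 < e -> exists q N, forall n J, (N <= n)%N ->
  (forall j, J j -> (q <= j)%N) -> `|m n J| <= e.
Proof.
move=> e0; have e30 : 0 < e / 3 by rewrite divr_gt0.
have [N [q [J0 h]]] := cylinder e30.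
have [q' hq'] := mtail N e30.
exists (maxn q q'), N => n J Nn JJ.
pose A := below q J0.
have AJ : A `&` J = set0.
  apply/seteqP; split => // j [[_ jq] /JJ]; rewrite geq_max => /andP[qj _].
  by move: jq; rewrite ltnNge qj.
have agA : agree q J0 A by move=> j jq; split => // -[].
have agAJ : agree q J0 (A `|` J).
  move=> j jq; split => [Jj|[[]//|/JJ]]; first by left.
  by rewrite geq_max => /andP[qj _]; move: jq; rewrite ltnNge qj.
have h1 := h A agA n N Nn (leqnn N).
have h2 := h (A `|` J) agAJ n N Nn (leqnn N).
rewrite !madd// in h2.
have h3 : `|m N J| <= e / 3.
  by apply: hq' => j /JJ; rewrite geq_max => /andP[].
have -> : m n J = (m n A + m n J - (m N A + m N J)) - (m n A - m N A) + m N J by ring.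
apply: (le_trans (ler_normD _ _)); have := ler_normB (m n A + m n J - (m N A + m N J)) (m n A - m N A).
lra.
Qed.

End uniform_tails.

(** * Set functions that are countably additive on bounded sets *)

Section signed_integral.
Context d (T : measurableType d) (R : realType).
Context (p q : {finite_measure set T -> \bar R}).
Implicit Types (g : T -> R) (A : set T).

Definition signed_int g : R := \int[p]_t g t - \int[q]_t g t.

Lemma bounded_int (m : {finite_measure set T -> \bar R}) g M :
  measurable_fun setT g -> (forall t, `|g t| <= M) -> m.-integrable setT (EFin \o g).
Proof.
move=> mg gM; apply: measurable_bounded_integrable => //.
  by rewrite ltey_eq fin_num_measure.
by apply/bounded_funE; exists M.
Qed.

Lemma Rint_lim (m : {finite_measure set T -> \bar R}) (g : nat -> T -> R) (f : T -> R) M :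
  (forall n, measurable_fun setT (g n)) -> (forall n t, `|g n t| <= M) ->
  (forall t, g n t @[n --> \oo] --> f t) ->
  \int[m]_t g n t @[n --> \oo] --> \int[m]_t f t.
Proof.
move=> mg gM gf.
have mf : measurable_fun setT f.
  by apply: (measurable_fun_cvg (h := g)) => // t _; exact: gf.
have [||||| fi _ c] := @dominated_cvgT _ _ _ m (fun n t => (g n t)%:E) (EFin \o f) (cst M%:E).
- by move=> n; exact/measurable_EFinP.
- exact/measurable_EFinP.
- by move=> t; apply: cvg_EFin => //; [exact: nearW|exact: gf].
- by apply: (@bounded_int m (cst M) `|M|).
- by move=> n t; rewrite lee_fin.
rewrite /Rintegral; apply: fine_cvg.
by rewrite fineK//; exact: integrable_fin_num.
Qed.

Lemma signed_int_lim (g : nat -> T -> R) (f : T -> R) M :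
  (forall n, measurable_fun setT (g n)) -> (forall n t, `|g n t| <= M) ->
  (forall t, g n t @[n --> \oo] --> f t) -> signed_int (g n) @[n --> \oo] --> signed_int f.
Proof. by move=> mg gM gf; apply: cvgB; exact: (Rint_lim mg gM gf). Qed.

Lemma signed_int_sum (I : Type) (s : seq I) (c : I -> R) (g : I -> T -> R) M :
  (forall i, measurable_fun setT (g i)) -> (forall i t, `|g i t| <= M) ->
  signed_int (fun t => \sum_(i <- s) c i * g i t) = \sum_(i <- s) c i * signed_int (g i).
Proof.
move=> mg gM.
have K (m : {finite_measure set T -> \bar R}) :
    \int[m]_t (\sum_(i <- s) c i * g i t) = \sum_(i <- s) c i * \int[m]_t g i t.
  have gi i : m.-integrable setT (EFin \o g i) := bounded_int m (mg i) (gM i).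
  elim: s => [|i s IH].
    rewrite big_nil; under eq_Rintegral do rewrite big_nil.
    by rewrite /Rintegral integral0.
  rewrite big_cons -IH -RintegralZl//; under eq_Rintegral do rewrite big_cons.
  rewrite RintegralD//.
    exact: (integrableZl measurableT (c i) (gi i)).
  rewrite (_ : EFin \o _ = fun t => \sum_(j <- s) (c j)%:E * (EFin \o g j) t)%E.
    by apply: integrable_sum => // j _; exact: integrableZl.
  by apply/funext => t; rewrite /= sumEFin.
by rewrite /signed_int !K -sumrB; apply: eq_bigr => i _; rewrite mulrBr.
Qed.

Lemma signed_int_indic A : measurable A -> signed_int \1_A = fine (p A) - fine (q A).
Proof. by move=> mA; rewrite /signed_int /Rintegral !integral_indic// setIT. Qed.

Lemma signed_int_sfun (s : {sfun T >-> R}) A : measurable A ->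
  signed_int (fun t => \1_A t * s t) = \sum_(c <- finmap.enum_fset (fset_set (range s)))
    c * (fine (p (A `&` s @^-1` [set c])) - fine (q (A `&` s @^-1` [set c]))).
Proof.
move=> mA.
have mAc c : measurable (A `&` s @^-1` [set c]).
  by apply: measurableI => //; exact: measurable_sfunP.
under [RHS]eq_bigr do rewrite -signed_int_indic//.
rewrite -(@signed_int_sum _ _ _ _ 1).
- congr signed_int; apply/funext => t; rewrite [s t]fimfunE fsbig_finite//= big_distrr/=.
  by apply: eq_bigr => c _; rewrite indicI/= mulrCA.
- by move=> c; exact: measurable_indic.
- by move=> c t; rewrite ger0_norm indicE; case: (_ \in _).
Qed.

End signed_integral.

Section bounded_charge.
Context (R : realType) (d : nat).
Local Notation V := 'rV[R]_d.
Context (sg : set V -> R).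
Context (sg_sigma : forall F : nat -> set V, (forall i, Bb (F i)) ->
  trivIset setT F -> Bb (\bigcup_i F i) ->
  \sum_(i < n) sg (F i) @[n --> \oo] --> sg (\bigcup_i F i)).

Definition oball (k : nat) : set V := [set v | `|v| < k%:R].

Lemma measurable_oball k : measurable (oball k).
Proof.
have mn : measurable_fun setT (fun v : V => `|v|).
  by apply: continuous_measurable_rV => v; exact: norm_continuous.
have := mn measurableT `]-oo, k%:R[%classic (measurable_itv _).
by rewrite setTI; congr measurable; apply/seteqP; split => v /=; rewrite in_itv.
Qed.

Lemma Bb_oball A k : measurable A -> A `<=` oball k -> Bb A.
Proof.
move=> mA Ak; split => //; apply/bounded_setE; exists k%:R => v /Ak.
exact: ltW.
Qed.

Lemma bounded_oball (A : set V) : bounded_set A -> exists k, A `<=` oball k.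
Proof.
move=> /bounded_setE[M AM]; exists (Num.truncn M).+1 => v Av.
apply: (le_lt_trans (AM v Av)); exact: truncnS_gt.
Qed.

Lemma sg0 : sg set0 = 0.
Proof.
have b0 : Bb (set0 : set V) by apply: (@Bb_oball _ 0).
have U0 : \bigcup_(i : nat) (set0 : set V) = set0 by rewrite bigcup0.
have c : \sum_(i < n) sg set0 @[n --> \oo] --> sg set0.
  rewrite -[X in _ --> sg X]U0; apply: (sg_sigma (F := fun=> set0)) => //.
    exact: trivIset_set0.
  by rewrite U0.
have c1 : \sum_(i < n.+1) sg set0 @[n --> \oo] --> sg set0.
  by move: c; rewrite -(cvg_shiftS (fun n => \sum_(i < n) sg set0)).
have c2 := cvgB c1 c; rewrite subrr in c2.
have E : (fun n => \sum_(i < n.+1) sg set0) - (fun n => \sum_(i < n) sg set0) = cst (sg set0).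
  apply/funext => n; change (\sum_(i < n.+1) sg set0 - \sum_(i < n) sg set0 = sg set0).
  by rewrite big_ord_recr/= (addrC (\sum_(i < n) sg set0)) addrK.
have c3 : cst (sg set0) @ \oo --> (0 : R) by rewrite -E; exact: c2.
refine (cvg_unique (@Rhausdorff R) (cvg_cst (sg set0)) c3).
Qed.

Lemma sgU A B : Bb A -> Bb B -> A `&` B = set0 -> sg (A `|` B) = sg A + sg B.
Proof.
move=> bA bB AB; have bF i : Bb (bigcup2 A B i).
  by case: i => [|[|i]]//=; apply: (@Bb_oball _ 0).
have bAB : Bb (A `|` B).
  case: bA bB => mA /bounded_setE[M AM] [mB /bounded_setE[K BK]]; split.
    exact: measurableU.
  apply/bounded_setE; exists (Num.max M K) => v [/AM|/BK] h;
    by rewrite le_max h ?orbT.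
have tF : trivIset setT (bigcup2 A B) by rewrite -trivIset_bigcup2.
have c := sg_sigma bF tF; rewrite bigcup2E in c.
apply: (cvg_unique (@Rhausdorff R) (c bAB)) => /=.
apply: cvg_near_cst; exists 2%N => // -[|[|n]]// _.
rewrite 2!big_ord_recl/= big1 ?addr0// => i _.
exact: sg0.
Qed.

Section decomposition.
Context (k : nat).

Definition charge_on_ball (A : set V) : \bar R := (sg (A `&` oball k))%:E.

Let bI A : measurable A -> Bb (A `&` oball k).
Proof.
move=> mA; apply: (@Bb_oball _ k); last exact: subIsetr.
by apply: measurableI => //; exact: measurable_oball.
Qed.

Let charge_on_ball0 : charge_on_ball set0 = 0%E. Proof. by rewrite /charge_on_ball set0I sg0. Qed.

Let charge_on_ball_fin A : measurable A -> charge_on_ball A \is a fin_num. Proof. by []. Qed.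

Let charge_on_ball_sigma : semi_sigma_additive charge_on_ball.
Proof.
move=> F mF tF mU; rewrite /charge_on_ball.
under eq_fun do rewrite sumEFin; apply: cvg_EFin; first exact: nearW.
rewrite setI_bigcupl (_ : _ \o _ = fun n => \sum_(i < n) sg (F i `&` oball k)); last first.
  by apply/funext => n; rewrite /= big_mkord.
apply: sg_sigma.
- by move=> i; exact: bI.
- exact: trivIset_setIr.
- by rewrite -setI_bigcupl; exact: bI.
Qed.

HB.instance Definition _ := isCharge.Build _ _ _ charge_on_ball charge_on_ball0 charge_on_ball_fin charge_on_ball_sigma.

(** The Jordan decomposition of the restriction to a ball.  One is needed for each
    ball, since the variation may be infinite on the whole space. *)
Lemma sg_decomp : exists p q : {finite_measure set V -> \bar R},
  forall A, measurable A -> sg (A `&` oball k) = fine (p A) - fine (q A).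
Proof.
have [P [N PN]] := Hahn_decomposition charge_on_ball.
exists (jordan_pos PN), (jordan_neg PN) => A mA.
apply: EFin_inj; rewrite EFinB !fineK ?fin_num_measure//.
by apply: (eq_trans (jordan_decomp PN mA)); rewrite /cadd /cscale/= /cscale EFinN mulN1e.
Qed.

End decomposition.

End bounded_charge.

Section simple_integral.
Context (R : realType) (d : nat).
Local Notation V := 'rV[R]_d.
Context (sg : set V -> R).
Context (sg_sigma : forall F : nat -> set V, (forall i, Bb (F i)) ->
  trivIset setT F -> Bb (\bigcup_i F i) ->
  \sum_(i < n) sg (F i) @[n --> \oo] --> sg (\bigcup_i F i)).
Local Notation oball := (@oball R d).

(** The integral of s over A.  The value c = 0 contributes nothing, so only the
    behaviour of sg on bounded sets matters if s has bounded support. *)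
Definition simple_int (s : {sfun V >-> R}) (A : set V) : R :=
  \sum_(c <- finmap.enum_fset (fset_set (range s))) c * sg (A `&` s @^-1` [set c]).

Definition decomposes k (p q : {finite_measure set V -> \bar R}) :=
  forall A, measurable A -> sg (A `&` oball k) = fine (p A) - fine (q A).

Let mAc (s : {sfun V >-> R}) A c : measurable A -> measurable (A `&` s @^-1` [set c]).
Proof. by move=> mA; apply: measurableI => //; exact: measurable_sfunP. Qed.

Lemma simple_int_signed k p q (s : {sfun V >-> R}) A : decomposes k p q -> measurable A ->
  (forall v, A v -> s v != 0 -> oball k v) ->
  simple_int s A = signed_int p q (fun v => \1_A v * s v).
Proof.
move=> pq mA As; rewrite signed_int_sfun//; apply: eq_bigr => c _.
have [->|c0] := eqVneq c 0; first by rewrite !mul0r.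
rewrite -pq; last exact: mAc.
congr (_ * sg _); apply/esym/setIidPl => v [Av /= vc].
by apply: As => //; rewrite vc.
Qed.

Lemma simple_intU (s : {sfun V >-> R}) A B : bounded_set (s @^-1` [set~ 0]) ->
  measurable A -> measurable B -> A `&` B = set0 ->
  simple_int s (A `|` B) = simple_int s A + simple_int s B.
Proof.
move=> /bounded_oball[k sk] mA mB AB; rewrite /simple_int -big_split/=.
apply: eq_bigr => c _; have [->|c0] := eqVneq c 0; first by rewrite !mul0r addr0.
have b C : measurable C -> Bb (C `&` s @^-1` [set c]).
  move=> mC; apply: (@Bb_oball _ _ _ k); first exact: mAc.
  by move=> v [_ /= vc]; apply: sk; rewrite /= vc; exact/eqP.
rewrite -mulrDr setIUl (sgU sg_sigma)//; [exact: b|exact: b|].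
by rewrite setIACA AB set0I.
Qed.

Lemma simple_int_bound k p q (s : {sfun V >-> R}) : decomposes k p q ->
  s @^-1` [set~ 0] `<=` oball k -> exists2 C, 0 <= C &
  forall A D, measurable A -> measurable D -> A `<=` D ->
    `|simple_int s A| <= C * (fine (p D) + fine (q D)).
Proof.
move=> pq sk; exists (\sum_(c <- finmap.enum_fset (fset_set (range s))) `|c|).
  by apply: sumr_ge0.
move=> A D mA mD AD; rewrite mulr_suml; apply: (le_trans (ler_norm_sum _ _ _)).
apply: ler_sum => c _; rewrite normrM.
have [->|c0] := eqVneq c 0; first by rewrite normr0 !mul0r.
rewrite ler_wpM2l// (_ : _ `&` _ = (A `&` s @^-1` [set c]) `&` oball k).
  rewrite pq; last exact: mAc.
  have fle (m : {finite_measure set V -> \bar R}) :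
      0 <= fine (m (A `&` s @^-1` [set c])) <= fine (m D).
    have mc := mAc s c mA; rewrite fine_ge0//=; apply: fine_le.
    - exact: fin_num_measure.
    - exact: fin_num_measure.
    - by apply: le_measure; rewrite ?inE// => v [Av _]; exact: AD.
  have /andP[p0 p1] := fle p; have /andP[q0 q1] := fle q.
  by rewrite (le_trans (ler_normB _ _))// !ger0_norm// lerD.
by apply/esym/setIidPl => v [_ /= vc]; apply: sk; rewrite /= vc; exact/eqP.
Qed.

Section sequence.
Context (s : nat -> {sfun V >-> R}).
Context (sb : forall n, bounded_set (s n @^-1` [set~ 0])).
Context (f : V -> R) (sf : forall u, s n u @[n --> \oo] --> f u).
Context (sc : forall A, measurable A -> exists l : R, simple_int (s n) A @[n --> \oo] --> l).

(** The sets on which bounded convergence applies to the sequence s.  They exhaust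
    the space, since a convergent sequence is bounded. *)
Definition tame q := [set v : V | `|v| <= q%:R /\ forall n, `|s n v| <= q%:R].

Lemma measurable_tame q : measurable (tame q).
Proof.
rewrite (_ : tame q = [set v | `|v| <= q%:R] `&`
  \bigcap_n (fun v => `|s n v|) @^-1` `]-oo, q%:R]%classic); last first.
  apply/seteqP; split => v [v1 v2]; split => // n; first by move=> _; rewrite /= in_itv/=.
  by have := v2 n I; rewrite /= in_itv.
apply: measurableI; first exact: measurable_cball.
apply: bigcapT_measurable => n; rewrite -[X in measurable X]setTI.
have ms : measurable_fun setT (fun v => `|s n v|) by exact: measurableT_comp.
exact: ms.
Qed.

Lemma tame_homo : {homo tame : q r / (q <= r)%N >-> q `<=` r}.
Proof.
move=> q r qr v [v1 v2]; have qr' : q%:R <= r%:R :> R by rewrite ler_nat.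
by split=> [|n]; exact: le_trans qr'.
Qed.

Lemma tame_all v : exists q, tame q v.
Proof.
have [M hM] : exists M, forall n, `|s n v| <= M.
  have /cvg_seq_bounded/bounded_funE[M hM] : cvgn (fun n => s n v).
    by apply/cvg_ex; exists (f v); exact: sf.
  by exists M.
exists (Num.truncn (Num.max `|v| M)).+1; split.
  by rewrite (le_trans _ (ltW (truncnS_gt _)))// le_max lexx.
by move=> n; rewrite (le_trans (hM n))// (le_trans _ (ltW (truncnS_gt _)))// le_max lexx orbT.
Qed.

Lemma tame_indic A u : \1_(A `&` tame q) u @[q --> \oo] --> (\1_A u : R).
Proof.
apply: cvg_near_cst; have [q uq] := tame_all u; exists q => // r qr.
have ur := tame_homo qr uq.
rewrite !indicE; congr ((nat_of_bool _)%:R); apply/idP/idP; rewrite !inE; first by case.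
by split.
Qed.

(** The points that enter the sets [tame j] at a stage j in J; tails in J correspond
    to complements of tame sets. *)
Let layer (J : set nat) : set V := \bigcup_(j in J) seqDU tame j.

Let measurable_layer J : measurable (layer J).
Proof.
apply: bigcup_measurable => j _; apply: seqDU_measurable => i.
exact: measurable_tame.
Qed.

Let layerU J K : layer (J `|` K) = layer J `|` layer K.
Proof. exact: bigcup_setU. Qed.

Let layerI J K : J `&` K = set0 -> layer J `&` layer K = set0.
Proof.
move=> JK; apply/seteqP; split => // v [[i Ji vi] [j Kj vj]].
have ij := @trivIset_seqDU _ tame i j I I (ex_intro _ v (conj vi vj)).
by have : (J `&` K) i; [split => //; rewrite ij|rewrite JK].
Qed.

Let layer_tail r : layer [set j | (r < j)%N] = ~` tame r.
Proof.
apply/seteqP; split => [v [j /= rj [_ vj]] vr|v vr].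
  by apply: vj; rewrite -bigcup_mkord; exists r.
have [q vq] := tame_all v.
have : (\bigcup_k seqDU tame k) v by rewrite -seqDU_bigcup_eq; exists q.
move=> [j _ vj]; exists j => //=; rewrite ltnNge; apply/negP => jr.
by apply: vr; apply: (tame_homo jr); case: vj.
Qed.

Let layer_sub r J : (forall j, J j -> (r < j)%N) -> layer J `<=` ~` tame r.
Proof. by move=> Jr; rewrite -layer_tail; apply: bigcup_subset => j /Jr. Qed.

(** For a single n the function s n has its support in a ball, where sg is controlled
    by finite measures, and these are small on the complement of [tame r]. *)
Let simple_int_tail A n e : measurable A -> 0 < e -> exists q, forall J : set nat,
  (forall j, J j -> (q <= j)%N) -> `|simple_int (s n) (A `&` layer J)| <= e.
Proof.
move=> mA e0; have [k sk] := bounded_oball (sb n).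
have [p [q pq]] := sg_decomp sg_sigma k.
have [C C0 CL] := simple_int_bound pq sk.
have small (m : {finite_measure set V -> \bar R}) : fine (m (~` tame r)) @[r --> \oo] --> (0 : R).
  have mt r : measurable (~` tame r) by apply: measurableC; exact: measurable_tame.
  have c : \int[m]_v \1_(~` tame r) v @[r --> \oo] --> (\int[m]_v 0 : R).
    apply: (@Rint_lim _ _ _ _ _ _ 1).
    - by move=> r; exact: measurable_indic.
    - by move=> r v; rewrite indicE; case: (_ \in _); rewrite ?normr1 ?normr0.
    - move=> v; apply: cvg_near_cst; have [r0 vr] := tame_all v.
      exists r0 => // r rr; rewrite indicE memNset//= => /(_ (tame_homo rr vr)).
      by [].
  rewrite /Rintegral integral0 in c; move: c; apply: cvg_trans.
  by apply: near_eq_cvg; apply: nearW => r; rewrite integral_indic// setIT.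
have c : C * (fine (p (~` tame r)) + fine (q (~` tame r))) @[r --> \oo] --> (0 : R).
  by rewrite -(mulr0 C) -[X in C * X](addr0 0); apply: cvgMr; apply: cvgD.
have [r _ hr] := (cvgrPdist_le _ _).1 c _ e0.
exists r.+1 => J Jr; have := hr r (leqnn r); rewrite sub0r normrN.
apply: le_trans; rewrite [leRHS]ger0_norm; last first.
  by rewrite mulr_ge0// addr_ge0// fine_ge0.
apply: CL.
- exact: measurableI.
- by apply: measurableC; exact: measurable_tame.
- by move=> v [_]; apply: layer_sub.
Qed.

(** [uniform_tails] applied to the integrals of s n over the layers. *)
Lemma tame_tails A e : measurable A -> 0 < e -> exists q N, forall r n,
  (N <= n)%N -> (q <= r)%N -> `|simple_int (s n) (A `\` tame r)| <= e.
Proof.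
move=> mA e0.
have [||| q [N h]] := @uniform_tails R (fun n J => simple_int (s n) (A `&` layer J)) _ _ _ e e0.
- move=> n J K JK; rewrite layerU setIUr simple_intU//.
  + exact: measurableI.
  + exact: measurableI.
  + by rewrite setIACA layerI// setI0.
- by move=> n e' e'0; exact: simple_int_tail.
- move=> J; have [l cl] := sc (measurableI _ _ mA (measurable_layer J)).
  by apply/cvg_ex; exists l.
exists q, N => r n Nn qr; rewrite setDE -layer_tail.
by apply: h => // j /= rj; exact: leq_trans (ltnW rj).
Qed.

(** The limits in n and in q can be exchanged, by [tame_tails]. *)
Lemma tame_limit A (l : R) (rho : nat -> R) : measurable A ->
  simple_int (s n) A @[n --> \oo] --> l ->
  (forall q, simple_int (s n) (A `&` tame q) @[n --> \oo] --> rho q) ->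
  rho q @[q --> \oo] --> l.
Proof.
move=> mA cl crho; apply/cvgrPdist_le => e e0.
have [q [N h]] := tame_tails mA e0.
exists q => // r /= qr.
have c : simple_int (s n) A - simple_int (s n) (A `&` tame r) @[n --> \oo] --> l - rho r.
  exact: cvgB.
have mt := measurable_tame r.
apply: (cvgr_to_le (cvg_norm c)); exists N => // n /= Nn.
have -> : simple_int (s n) A = simple_int (s n) (A `&` tame r) + simple_int (s n) (A `\` tame r).
  rewrite -[in LHS](setUIDK A (tame r)); apply: simple_intU => //.
  - exact: measurableI.
  - exact: measurableD.
  - by apply/seteqP; split => // v [[_ ?] []].
by rewrite addrAC subrr add0r; exact: h.
Qed.

(** On a ball that contains the support of f, bounded convergence on the tame sets
    identifies the limit, and [tame_limit] removes the restriction to tame sets.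
    Outside that ball the same reasoning gives the limit 0, as f vanishes there. *)
Lemma dunford_schwartz_signed_int m p q M (l : R) : decomposes m p q ->
  (forall v, `|f v| <= M) -> (forall v, f v != 0 -> oball m v) ->
  simple_int (s n) setT @[n --> \oo] --> l -> l = signed_int p q f.
Proof.
move=> pq fM fm cl.
have mm : measurable (oball m) by exact: measurable_oball.
have mf : measurable_fun setT f.
  by apply: (measurable_fun_cvg (h := fun n => s n)) => // t _; exact: sf.
have key k (p' q' : {finite_measure set V -> \bar R}) A r : decomposes k p' q' -> measurable A ->
    (A `&` tame r `<=` oball k) ->
    simple_int (s n) (A `&` tame r) @[n --> \oo] --> signed_int p' q' (fun v => \1_(A `&` tame r) v * f v).
  move=> pq' mA Ak; have mAt : measurable (A `&` tame r).
    by apply: measurableI => //; exact: measurable_tame.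
  rewrite (_ : (fun n => _) = fun n => signed_int p' q' (fun v => \1_(A `&` tame r) v * s n v)); last first.
    by apply/funext => n; apply: (simple_int_signed pq' mAt) => v Av _; exact: Ak.
  apply: (@signed_int_lim _ _ _ _ _ _ _ r%:R).
  - by move=> n; apply: measurable_funM.
  - move=> n v; rewrite indicE; case: (boolP (v \in _)) => [|_].
      by rewrite inE => -[_ [_ ?]]; rewrite mul1r.
    by rewrite mul0r normr0.
  - by move=> v; apply: cvgM; [exact: cvg_cst|exact: sf].
have [l1 c1] := sc mm; have [l2 c2] := sc (measurableC mm).
have e1 : l1 = signed_int p q f.
  have t1 := tame_limit mm c1 (fun r => key m p q (oball m) r pq mm (@subIsetl _ _ _)).
  apply: (cvg_unique (@Rhausdorff R) t1).
  apply: (@signed_int_lim _ _ _ _ _ _ _ M).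
  - move=> r; apply: measurable_funM => //; apply: measurable_indic.
    by apply: measurableI => //; exact: measurable_tame.
  - move=> r v; rewrite normrM (le_trans _ (fM v))// ler_piMl// indicE.
    by case: (_ \in _); rewrite ?normr1 ?normr0.
  - move=> v; rewrite [X in _ --> X](_ : f v = \1_(oball m) v * f v).
      by apply: cvgM; [exact: tame_indic|exact: cvg_cst].
    have [->|/fm fv] := eqVneq (f v) 0; first by rewrite mulr0.
    by rewrite indicE mem_set// mul1r.
have e2 : l2 = 0.
  have t2 : (fun=> (0 : R)) @ \oo --> l2.
    apply: (tame_limit (measurableC mm) c2) => r.
    have [p' [q' pq']] := sg_decomp sg_sigma r.+1.
    have := key r.+1 p' q' (~` oball m) r pq' (measurableC mm).
    rewrite (_ : (fun v => _) = (fun v => \sum_(i <- [::]) f i * f v)).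
      rewrite (@signed_int_sum _ _ _ _ _ _ _ _ _ M) ?big_nil//; last first.
      apply; move=> v [_ [vr _]]; apply: (le_lt_trans vr); by rewrite ltr_nat.
    apply/funext => v; rewrite big_nil.
    have [->|/fm fv] := eqVneq (f v) 0; first by rewrite mulr0.
    by rewrite indicE memNset ?mul0r// => -[].
  exact: (cvg_unique (@Rhausdorff R) t2 (cvg_cst 0)).
have c12 : simple_int (s n) setT @[n --> \oo] --> l1 + l2.
  rewrite (_ : (fun n => _) = fun n => simple_int (s n) (oball m) + simple_int (s n) (~` oball m)).
    exact: cvgD.
  apply/funext => n; rewrite -(setUv (oball m)) simple_intU//; last by rewrite setICr.
  exact: measurableC.
by rewrite (cvg_unique (@Rhausdorff R) cl c12) e1 e2 addr0.
Qed.

End sequence.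

End simple_integral.

(** * Uniqueness of the representing measure *)

Section pairing.
Context (R : realType) (dO : measure_display) (Omega : measurableType dO).
Context (P : probability Omega R) (W : set Omega) (mW : measurable W).
Implicit Types y z : Omega -> R.

Definition pairing y : R := \int[P]_(w in W) y w.

Let intW y : y \in Lfun P 1 -> P.-integrable W (EFin \o y).
Proof. by move=> /Lfun1_integrable; apply: integrableS. Qed.

Lemma pairing_lin (I : Type) (s : seq I) (c : I -> R) (y : I -> Omega -> R) :
  (forall i, y i \in Lfun P 1) ->
  (fun w => \sum_(i <- s) c i * y i w) \in Lfun P 1 /\
  pairing (fun w => \sum_(i <- s) c i * y i w) = \sum_(i <- s) c i * pairing (y i).
Proof.
move=> yL; elim: s => [|i s [IH1 IH2]].
  split.
    apply/Lfun1_integrable; rewrite (_ : EFin \o _ = cst 0%E); first exact: integrable0.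
    by apply/funext => w /=; rewrite big_nil.
  rewrite big_nil /pairing; under eq_Rintegral do rewrite big_nil.
  by rewrite /Rintegral integral0.
have yi : P.-integrable setT (EFin \o (fun w => c i * y i w)).
  exact: (integrableZl measurableT (c i) ((Lfun1_integrable _ _).1 (yL i))).
have IH1' := (Lfun1_integrable _ _).1 IH1.
split.
  apply/Lfun1_integrable.
  rewrite (_ : EFin \o _ = (fun w => (c i * y i w)%R%:E) \+
    (fun w => (\sum_(j <- s) c j * y j w)%R%:E))%E.
    exact: integrableD.
  by apply/funext => w /=; rewrite big_cons.
rewrite big_cons -IH2 /pairing -RintegralZl//; last exact: intW.
rewrite -RintegralD//.
- by apply: eq_Rintegral => w _; rewrite big_cons.
- exact: integrableS yi.
- exact: integrableS IH1'.
Qed.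

Lemma pairing_dist y z : y \in Lfun P 1 -> z \in Lfun P 1 ->
  `|pairing y - pairing z| <= fine (L1dist P y z).
Proof.
move=> yL zL; rewrite /pairing -RintegralB//; [|exact: intW|exact: intW].
have dT : P.-integrable setT (EFin \o (fun w => y w - z w)).
  rewrite (_ : EFin \o _ = (EFin \o y) \- (EFin \o z))%E//.
  by apply: integrableB => //; exact/Lfun1_integrable.
have dW := integrableS measurableT mW (@subsetT _ W) dT.
apply: (le_trans (le_normr_Rintegral mW dW)); rewrite L1distE.
have nT := integrable_norm dT; have nW := integrable_norm dW.
apply: fine_le.
- exact: integrable_fin_num nW.
- exact: integrable_fin_num nT.
- apply: ge0_subset_integral => //.
  exact: measurable_int nT.
Qed.

Lemma pairing_cvg (y : nat -> Omega -> R) z : (forall n, y n \in Lfun P 1) ->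
  z \in Lfun P 1 -> (L1dist P (y n) z @[n --> \oo] --> 0)%E ->
  pairing (y n) @[n --> \oo] --> pairing z.
Proof.
move=> yL zL c.
have c' : fine (L1dist P (y n) z) @[n --> \oo] --> (0 : R) by exact: (fine_cvg c).
apply/cvgrPdist_le => e e0; have [N _ h] := (cvgrPdist_le _ _).1 c' _ e0.
exists N => // n Nn; have := h n Nn; rewrite sub0r normrN => hn.
rewrite distrC (le_trans (pairing_dist _ _))// (le_trans _ hn)//.
exact: ler_norm.
Qed.

End pairing.

Section test_event.
Context (R : realType) (dO : measure_display) (Omega : measurableType dO).
Context (P : probability Omega R) (W : set Omega) (mW : measurable W) (d : nat).
Local Notation V := 'rV[R]_d.
Context (rho : set V -> Omega -> R) (radon : vector_radon_measure P rho).

Definition slice (A : set V) : R := pairing P W (rho A).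

Lemma slice_sigma (F : nat -> set V) : (forall i, Bb (F i)) ->
  trivIset setT F -> Bb (\bigcup_i F i) ->
  \sum_(i < n) slice (F i) @[n --> \oo] --> slice (\bigcup_i F i).
Proof.
move=> bF tF bU; have L i : rho (F i) \in Lfun P 1 by exact: vrm_L1.
have E n : (fun w => \sum_(i < n) rho (F i) w) =
    (fun w => \sum_(i < n) 1 * rho (F i) w).
  by apply/funext => w; apply: eq_bigr => i _; rewrite mul1r.
rewrite (_ : (fun n => _) = fun n => pairing P W (fun w => \sum_(i < n) rho (F i) w)).
  apply: pairing_cvg => //; last exact: vrm_sigma_additive.
    by move=> n; rewrite E; apply: (pairing_lin mW _ _ (fun i : 'I_n => L i)).1.
  exact: vrm_L1.
apply/funext => n; rewrite E (pairing_lin mW _ _ (fun i : 'I_n => L i)).2.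
by apply: eq_bigr => i _; rewrite mul1r.
Qed.

Lemma slice_sfun (s : {sfun V >-> R}) A : bounded_set (s @^-1` [set~ 0]) ->
  measurable A -> vintegral_sfun rho s A \in Lfun P 1 /\
  pairing P W (vintegral_sfun rho s A) = simple_int slice s A.
Proof.
move=> bs mA.
pose y (c : R) : Omega -> R := if c == 0 then cst 0 else rho (A `&` s @^-1` [set c]).
have yL c : y c \in Lfun P 1.
  rewrite /y; case: eqP => [_|c0].
    by apply/Lfun1_integrable; exact: integrable0.
  apply: (vrm_L1 radon); split.
    by apply: measurableI => //; exact: measurable_sfunP.
  move/bounded_setE: bs => [M sM]; apply/bounded_setE; exists M => v [_ /= vc].
  by apply: sM; rewrite /= vc; exact: c0.
have E : vintegral_sfun rho s A =
    fun w => \sum_(c <- finmap.enum_fset (fset_set (range s))) c * y c w.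
  apply/funext => w; rewrite /vintegral_sfun fsbig_finite//=.
  by apply: eq_bigr => c _; rewrite /y; case: eqP => [->|//]; rewrite !mul0r.
have [h1 h2] := pairing_lin mW (finmap.enum_fset (fset_set (range s))) id yL.
rewrite E; split; first exact: h1.
rewrite [LHS]h2; apply: eq_bigr => c _; rewrite /y/=.
by case: eqP => [->|//]; rewrite !mul0r.
Qed.

Lemma slice_vintegral f y m p q M : is_vintegral P rho f y ->
  decomposes slice m p q -> (forall v, `|f v| <= M) ->
  (forall v, f v != 0 -> oball m v) -> pairing P W y = signed_int p q f.
Proof.
move=> [s [sb sf sc yL cy]] pq fM fm.
apply: (dunford_schwartz_signed_int slice_sigma sb sf _ pq fM fm).
  move=> A mA; have [z zL cz] := sc A mA; exists (pairing P W z).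
  rewrite (_ : (fun n => _) = fun n => pairing P W (vintegral_sfun rho (s n) A)).
    by apply: pairing_cvg => // n; exact: (slice_sfun (sb n) mA).1.
  by apply/funext => n; rewrite (slice_sfun (sb n) mA).2.
rewrite (_ : (fun n => _) = fun n => pairing P W (vintegral_sfun rho (s n) setT)).
  by apply: pairing_cvg => // n; exact: (slice_sfun (sb n) measurableT).1.
by apply/funext => n; rewrite (slice_sfun (sb n) measurableT).2.
Qed.

End test_event.

Section uniqueness.
Context (R : realType) (dO : measure_display) (Omega : measurableType dO).
Context (P : probability Omega R) (d : nat) (X : R -> Omega -> 'rV[R]_d).
Local Notation V := 'rV[R]_d.
Context (Y_exists : forall f : V -> R, CL f -> exists y, is_Y P X f y).
Context (rho1 rho2 : set V -> Omega -> R).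
Context (vrm1 : vector_radon_measure P rho1) (vrm2 : vector_radon_measure P rho2).
Context (rep1 : represents P X rho1) (rep2 : represents P X rho2).

Let slice_open W m (U : set V) : measurable W -> open U -> U `<=` oball m ->
  slice P W rho1 U = slice P W rho2 U.
Proof.
move=> mW oU Um; have mU : measurable U by exact: sub_sigma_algebra.
have [f [cf f01 f0 fU]] := open_approx oU.
have [p1 [q1 pq1]] := sg_decomp (slice_sigma mW vrm1) m.
have [p2 [q2 pq2]] := sg_decomp (slice_sigma mW vrm2) m.
have fM k v : `|f k v| <= 1 by have /andP[? ?] := f01 k v; rewrite ger0_norm.
have fm k v : f k v != 0 -> oball m v.
  by move=> fv; apply: Um; apply: contrapT => /(f0 k) /eqP; exact/negP.
have mf k : measurable_fun setT (f k) by exact: continuous_measurable_rV.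
have E k : signed_int p1 q1 (f k) = signed_int p2 q2 (f k).
  have fCL : CL (f k).
    split; first by split => //; apply/bounded_funE; exists 1.
    have g := bL1_indic (Bb_oball mU Um).
    apply: (@le_integrable _ _ _ _ _ _ _ (EFin \o (\1_U : V -> R))) => //.
    - exact/measurable_EFinP.
    - move=> v _; rewrite /= lee_fin indicE.
      case: (boolP (v \in U)) => [_|/negP]; first by rewrite normr1.
      by rewrite inE => /(f0 k) ->; rewrite normr0.
    - apply/integrableP; split; first by apply/measurable_EFinP; exact: bL1_meas g.
      under eq_integral do rewrite /= ger0_norm ?(bL1_ge0 g)//.
      exact: bL1_fin g.
  have [y Yy] := Y_exists fCL.
  rewrite -(slice_vintegral mW vrm1 (rep1 fCL Yy) pq1 (fM k) (fm k)).
  exact: (slice_vintegral mW vrm2 (rep2 fCL Yy) pq2 (fM k) (fm k)).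
have lim (p q : {finite_measure set V -> \bar R}) : signed_int p q (f k) @[k --> \oo] --> signed_int p q \1_U.
  exact: (@signed_int_lim _ _ _ p q f \1_U 1 mf fM fU).
have c1 := lim p1 q1; rewrite (funext E) in c1.
have e : signed_int p1 q1 \1_U = signed_int p2 q2 \1_U.
  exact: (cvg_unique (@Rhausdorff R) c1 (lim p2 q2)).
rewrite !signed_int_indic// in e; rewrite -(setIidl Um).
exact: (etrans (pq1 _ mU) (etrans e (esym (pq2 _ mU)))).
Qed.

Let slice_Bb W A : measurable W -> Bb A -> slice P W rho1 A = slice P W rho2 A.
Proof.
move=> mW [mA /bounded_oball[m Am]]; rewrite -(setIidl Am).
have om : open (oball m : set V).
  rewrite (_ : oball m = Num.norm @^-1` `]-oo, m%:R[%classic).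
    by apply: (continuousP _).1; [exact: norm_continuous|exact: interval_open].
  by apply/seteqP; split => v /=; rewrite in_itv.
have oI U : open U -> slice P W rho1 (U `&` oball m) = slice P W rho2 (U `&` oball m).
  by move=> oU; apply: (@slice_open W m) => //; exact: openI.
have bI (S : set V) : measurable S -> Bb (S `&` oball m).
  move=> mS; apply: (@Bb_oball _ _ _ m); last exact: subIsetr.
  by apply: measurableI => //; exact: measurable_oball.
apply: (dynkin_induction (G := @open V)
  (P := fun A => slice P W rho1 (A `&` oball m) = slice P W rho2 (A `&` oball m))) => //.
- exact: openI.
- by apply: oI; exact: openT.
- move=> S mS ES; have := oI setT openT.
  rewrite -(setUv S) setIUl; have dj : S `&` oball m `&` (~` S `&` oball m) = set0.
    by apply/seteqP; split => // v [[? _] []].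
  have bS := bI _ mS; have bC := bI _ (measurableC mS).
  rewrite (sgU (slice_sigma mW vrm1) bS bC dj) (sgU (slice_sigma mW vrm2) bS bC dj).
  by rewrite ES => /addrI.
- move=> F mF tF EF; rewrite setI_bigcupl.
  have bF i := bI _ (mF i).
  have tI : trivIset setT (fun i => F i `&` oball m) by exact: trivIset_setIr.
  have bU : Bb (\bigcup_i (F i `&` oball m)).
    by rewrite -setI_bigcupl; apply: bI; exact: bigcup_measurable.
  have c1 := slice_sigma mW vrm1 bF tI bU.
  have c2 := slice_sigma mW vrm2 bF tI bU.
  have E : (fun n => \sum_(i < n) slice P W rho1 (F i `&` oball m)) =
      (fun n => \sum_(i < n) slice P W rho2 (F i `&` oball m)).
    by apply/funext => n; apply: eq_bigr => i _; rewrite EF.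
  rewrite E in c1; exact: (cvg_unique (@Rhausdorff R) c1 c2).
Qed.

(** Two integrable functions are equal almost everywhere when their integrals over
    every event W are.  For fixed W, both representations give the same mean of Y(f)
    over W for the functions f of [open_approx], which yields equality on bounded open
    sets and, by Dynkin's lemma in a ball, on bounded Borel sets. *)
Lemma representation_unique A : Bb A -> rho1 A = rho2 A %[ae P].
Proof.
move=> bA; have L1 := vrm_L1 vrm1 bA; have L2 := vrm_L1 vrm2 bA.
have i1 := (Lfun1_integrable _ _).1 L1; have i2 := (Lfun1_integrable _ _).1 L2.
have K W : W `<=` setT -> measurable W ->
    (\int[P]_(w in W) (EFin \o rho1 A) w = \int[P]_(w in W) (EFin \o rho2 A) w)%E.
  move=> _ mW; have := slice_Bb mW bA; rewrite /slice /pairing /Rintegral => E.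
  have f1 : (\int[P]_(w in W) (EFin \o rho1 A) w)%E \is a fin_num.
    by apply: integrable_fin_num => //; exact: integrableS i1.
  have f2 : (\int[P]_(w in W) (EFin \o rho2 A) w)%E \is a fin_num.
    by apply: integrable_fin_num => //; exact: integrableS i2.
  by rewrite -(fineK f1) -(fineK f2); congr EFin.
have ae := @integral_ae_eq _ _ _ P setT measurableT (EFin \o rho2 A) (EFin \o rho1 A)
  i1 (measurable_int _ i2) K.
by apply: filterS ae => w /(_ I) [].
Qed.

End uniqueness.

(** * The representation theorem *)

(** Transience, in the form in which the construction of the occupation measure uses
    it. *)
Lemma green_finite (R : realType) (dO : measure_display) (Omega : measurableType dO)
    (P : probability Omega R) (d : nat) (x : 'rV[R]_d) (lambda : R)
    (nu : probability 'rV[R]_d R) (N : R -> Omega -> nat)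
    (xi : nat -> Omega -> 'rV[R]_d) (X : R -> Omega -> 'rV[R]_d)
    (H : compound_poisson_sum P x lambda nu N xi X) (a : 'rV[R]_d -> R) :
  (3 <= d)%N -> bounded_fun a -> continuous a -> (forall u, 0 <= a u) ->
  (forall u, a (- u) = a u) -> (\int[lebesgue_rV R d]_y (a y)%:E = 1)%E ->
  has_generator P x X (jump_operator a) ->
  forall g : 'rV[R]_d -> R, bounded_L1p g -> (\int[green H]_v (g v)%:E < +oo)%E.
Proof.
move=> d3 /bounded_funE[M aM'] ca a0 aN a1 Hgen g gg.
have aM u : a u <= M by apply: le_trans (aM' u); exact: ler_norm.
have ma : measurable_fun setT a by exact: continuous_measurable_rV.
have [l1 nuE] := generator_law H ca a0 aN a1 Hgen (leq_trans (isT : (0 < 3)%N) d3).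
have nuE' (h : 'rV[R]_d -> \bar R) : measurable_fun setT h -> (forall v, 0 <= h v)%E ->
    (\int[nu]_v h v = \int[lebesgue_rV R d]_v ((a v)%:E * h v))%E.
  exact: integral_density.
have [B hB] := potential_summable ma a0 aM aN nuE' x d3 gg.
have gm n := integral_law_iter H n gg.
apply: (le_lt_trans (green_le l1 (bL1_meas gg) (bL1_ge0 gg) gm)).
apply: (@le_lt_trans _ _ B%:E); last exact: ltry.
have c0 n : (0 <= (iter n (avg nu) g x)%:E)%E.
  by rewrite -gm; apply: integral_ge0 => v _; rewrite lee_fin; exact: bL1_ge0.
apply: lime_le; first by apply: is_cvg_nneseries => n _ _; exact: c0.
by apply: nearW => n; rewrite sumEFin lee_fin big_mkord.
Qed.

Theorem theorem1 (R : realType) (d : nat) (a : 'rV[R]_d -> R)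
    (d_ge3 : (3 <= d)%N)
    (a_bounded : bounded_fun a) (a_continuous : continuous a)
    (a_ge0 : forall u, 0 <= a u) (a_even : forall u, a (- u) = a u)
    (a_mass : (\int[lebesgue_rV R d]_y (a y)%:E = 1)%E)
    (a_moment2 : (\int[lebesgue_rV R d]_u (dotv u u * a u)%:E < +oo)%E)
    (a_fourier : fourier_L1 a)
    (x : 'rV[R]_d)
    (dO : measure_display) (Omega : measurableType dO) (P : probability Omega R)
    (X : R -> Omega -> 'rV[R]_d)
    (X_process : compound_poisson_process P x X)
    (X_generator : has_generator P x X (jump_operator a)) :
  (forall f, CL f -> exists y, is_Y P X f y) /\
  exists mu : set 'rV[R]_d -> Omega -> R,
    [/\ vector_radon_measure P mu,
        represents P X mu &
        forall nu : set 'rV[R]_d -> Omega -> R,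
          vector_radon_measure P nu -> represents P X nu ->
          forall A, Bb A -> nu A = mu A %[ae P]].
Proof.
have [lambda [nu [N [xi H]]]] := X_process.
have gf := green_finite H d_ge3 a_bounded a_continuous a_ge0 a_even a_mass X_generator.
have Yex f : CL f -> exists y, is_Y P X f y.
  by move=> cf; exists (occ x N xi f); exact: (occ_is_Y gf).
split=> //; exists (occupation_measure x N xi); split.
- exact: (occupation_measure_radon gf).
- exact: (occupation_measure_represents gf).
- move=> rho vr rr A bA.
  exact: (representation_unique Yex vr (occupation_measure_radon gf) rr (occupation_measure_represents gf)).
Qed.
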